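(* Let $n\ge 1$ be an integer, let $0<s<\frac n2$, let $c$ and $q$ be real numbers, and put $2^*_c:=\frac{2(n+c)}{n-2s}$. Suppose that $2<q<2^*_c$ and $$-2s<c<\frac{(n-1)(q-2)}{2}.$$ Then there is a compact imbedding $$H^s_{rad}(\mathbb{R}^n)\subset L^q(\mathbb{R}^n,|x|^c\,dx),$$ that is, every $u\in H^s_{rad}(\mathbb{R}^n)$ belongs to $L^q(\mathbb{R}^n,|x|^c\,dx)$ and the inclusion map is a compact linear operator.
   Context: For $s\ge 0$, $H^s(\mathbb{R}^n)=\{u\in L^2(\mathbb{R}^n):(-\Delta)^{s/2}u\in L^2(\mathbb{R}^n)\}$ is the fractional order Sobolev space with its usual norm, and $H^s_{rad}(\mathbb{R}^n)$ is the subspace of radially symmetric functions of $H^s(\mathbb{R}^n)$ (functions depending only on $|x|$). The space $L^q(\mathbb{R}^n,|x|^c\,dx)$ is the Lebesgue space with norm $\left(\int_{\mathbb{R}^n}|u(x)|^q|x|^c\,dx\right)^{1/q}$. *)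

(* Defs.v *)
From HB Require Import structures.
From mathcomp Require Import all_boot all_order all_algebra.
From mathcomp Require Import all_classical all_reals all_analysis.
From mathcomp.real_closed Require Import complex.

Set Implicit Arguments.
Unset Strict Implicit.
Unset Printing Implicit Defensive.

Import Order.TTheory GRing.Theory Num.Theory.
Import numFieldNormedType.Exports.

Local Open Scope classical_set_scope.
Local Open Scope ring_scope.
Local Open Scope complex_scope.

Notation Rn R n := (n.-tuple (measurableTypeR R)).

Section lebesgue_measure_Rn.
Context {R : realType}.

Definition cons_Rn n (p : measurableTypeR R * Rn R n) : Rn R n.+1 :=
  [tuple of p.1 :: p.2].

Definition uncons_Rn n (x : Rn R n.+1) : measurableTypeR R * Rn R n :=
  (thead x, [tuple of behead x]).

Lemma measurable_cons_Rn n : measurable_fun setT (@cons_Rn n).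
Proof. exact: measurable_cons. Qed.

Lemma measurable_uncons_Rn n : measurable_fun setT (@uncons_Rn n).
Proof.
apply/measurable_fun_pair => /=; first exact: measurable_tnth.
exact: measurable_behead.
Qed.

Lemma cons_RnK n : cancel (@cons_Rn n) (@uncons_Rn n).
Proof. by case=> a x; congr pair; apply/val_inj. Qed.

Lemma uncons_RnK n : cancel (@uncons_Rn n) (@cons_Rn n).
Proof. by move=> x; rewrite /cons_Rn /uncons_Rn /= [RHS]tuple_eta. Qed.

Section cons_measure.
Variables (n : nat) (m : {sigma_finite_measure set (Rn R n) -> \bar R}).

Definition cons_measure : set (Rn R n.+1) -> \bar R :=
  pushforward (@lebesgue_measure R \x m)%E (@cons_Rn n).

Let cons_measure0 : cons_measure set0 = 0%E.
Proof. by rewrite /cons_measure /pushforward preimage_set0 measure0. Qed.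

Let cons_measure_ge0 A : (0 <= cons_measure A)%E.
Proof. by rewrite /cons_measure /pushforward measure_ge0. Qed.

Let cons_measure_sigma_additive : semi_sigma_additive cons_measure.
Proof.
have mf A : measurable A -> measurable (@cons_Rn n @^-1` A).
  by move=> mA; rewrite -[X in measurable X]setTI; exact: measurable_cons_Rn.
move=> F mF tF mUF; rewrite /cons_measure /pushforward preimage_bigcup.
apply: measure_semi_sigma_additive.
- by move=> k; exact: mf.
- apply/trivIsetP => /= i j _ _ ij; rewrite -preimage_setI.
  by move/trivIsetP : tF => /(_ _ _ _ _ ij) ->//; rewrite preimage_set0.
- by rewrite -preimage_bigcup; exact: mf.
Qed.

HB.instance Definition _ := isMeasure.Build _ _ _ cons_measure
  cons_measure0 cons_measure_ge0 cons_measure_sigma_additive.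

Let cons_measure_sigma_finite : sigma_finite setT cons_measure.
Proof.
have /sigma_finiteP[F [FT ndF Foo]] := sigma_finiteT (@lebesgue_measure R).
have /sigma_finiteP[G [GT ndG Goo]] := sigma_finiteT m.
exists (fun k => @uncons_Rn n @^-1` (F k `*` G k)).
  rewrite -preimage_bigcup (_ : \bigcup_k _ = setT) ?preimage_setT//.
  rewrite -subTset => -[x y] _.
  have [i _ Fix] : (\bigcup_k F k) x by rewrite -FT.
  have [j _ Gjy] : (\bigcup_k G k) y by rewrite -GT.
  exists (maxn i j) => //; split => /=.
  - by move: x Fix; exact/subsetPset/ndF/leq_maxl.
  - by move: y Gjy; exact/subsetPset/ndG/leq_maxr.
move=> k; have [mF Fk] := Foo k; have [mG Gk] := Goo k; split.
  rewrite -[X in measurable X]setTI.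
  by apply: measurable_uncons_Rn => //; exact: measurableX.
rewrite /cons_measure /pushforward -comp_preimage.
rewrite (_ : _ \o _ = id) ?preimage_id; last first.
  by apply/funext => x /=; rewrite cons_RnK.
by rewrite product_measure1E// lte_mul_pinfty// ge0_fin_numE.
Qed.

HB.instance Definition _ := Measure_isSigmaFinite.Build _ _ _ cons_measure
  cons_measure_sigma_finite.

End cons_measure.

Fixpoint lebesgue_Rn n : {sigma_finite_measure set (Rn R n) -> \bar R} :=
  if n is n'.+1 then cons_measure (lebesgue_Rn n')
  else \d_([tuple] : Rn R 0).

End lebesgue_measure_Rn.

Section function_spaces.
Context {R : realType} {n : nat}.
Implicit Types (x xi : Rn R n) (u v g : Rn R n -> R[i]) (s c q : R).

Local Notation mu := (lebesgue_Rn n : {measure set (Rn R n) -> \bar R}).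

Definition dotRn x xi : R := \sum_(i < n) tnth x i * tnth xi i.

Definition enorm x : R := Num.sqrt (\sum_(i < n) tnth x i ^+ 2).

(* R[i] has no measurable structure in the library and its norm is R[i]-valued:
   complex functions are measured and integrated componentwise, and the modulus
   used is the R-valued normc. *)
Local Notation normc := (@ComplexField.Normc.normc R).

Definition cmeasurable u :=
  measurable_fun setT (fun x => complex.Re (u x)) /\
  measurable_fun setT (fun x => complex.Im (u x)).

Definition cintegral u : R[i] :=
  (\int[mu]_x complex.Re (u x)) +i* (\int[mu]_x complex.Im (u x)).

Definition cLnorm (p : \bar R) u : \bar R :=
  'N[mu]_p[EFin \o (normc \o u)]%E.

Definition cLp (p : \bar R) : set (Rn R n -> R[i]) :=
  [set u | cmeasurable u /\ (cLnorm p u < +oo)%E].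

Definition weighted_norm q c u : \bar R :=
  ((\int[mu]_x (normc (u x) `^ q * enorm x `^ c)%:E) `^ q^-1)%E.

Definition weighted_Lq q c : set (Rn R n -> R[i]) :=
  [set u | cmeasurable u /\ (weighted_norm q c u < +oo)%E].

Definition expi (t : R) : R[i] := cos t +i* sin t.

Definition fourierL1 u xi : R[i] :=
  ((2 * pi) `^ (- (n%:R / 2)))%:C *
  cintegral (fun x => expi (- dotRn x xi) * u x).

(* v is the Fourier-Plancherel transform of u: the extension by L^2-density of
   fourierL1 from L^1 /\ L^2 to L^2. *)
Definition is_fourierL2 u v :=
  [/\ cLp 2 u, cLp 2 v & exists w : nat -> Rn R n -> R[i],
    [/\ (forall k, cLp 1 (w k) /\ cLp 2 (w k)),
        cLnorm 2 (w k - u) @[k --> \oo] --> 0%E &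
        cLnorm 2 (fourierL1 (w k) - v) @[k --> \oo] --> 0%E]].

(* g = (-Delta)^(s/2) u in L^2, the Fourier multiplier of symbol |xi|^s. *)
Definition is_fracLap s u g :=
  exists v, is_fourierL2 u v /\
            is_fourierL2 g (fun xi => (enorm xi `^ s)%:C * v xi).

Definition fracLap s u : Rn R n -> R[i] := xget 0 [set g | is_fracLap s u g].

Definition Hs s : set (Rn R n -> R[i]) :=
  [set u | cLp 2 u /\ exists2 g, cLp 2 g & is_fracLap s u g].

Definition Hs_norm s u : \bar R :=
  ((cLnorm 2 u `^ 2 + cLnorm 2 (fracLap s u) `^ 2) `^ 2^-1)%E.

(* Functions are representatives of classes modulo a.e. equality. *)
Definition radial u :=
  exists f : R -> R[i], {ae mu, forall x, u x = f (enorm x)}.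

Definition Hs_rad s : set (Rn R n -> R[i]) := [set u | Hs s u /\ radial u].

End function_spaces.

Definition critical_exponent (R : realType) (n : nat) (s c : R) : R :=
  2 * (n%:R + c) / (n%:R - 2 * s).

Section compact_operators.
Context {R : realType} {V W : lmodType R[i]}.

Definition compact_linear_operator (X : set V) (NX : V -> \bar R)
    (Y : set W) (NY : W -> \bar R) (T : V -> W) :=
  [/\ (forall (a : R[i]) u v, X u -> X v -> T (a *: u + v) = a *: T u + T v),
      (forall u, X u -> Y (T u)) &
      forall u : nat -> V,
        (forall k, X (u k)) ->
        (exists M : R, forall k, (NX (u k) <= M%:E)%E) ->
        exists (phi : nat -> nat) (w : W),
          [/\ {homo phi : i j / (i < j)%N}, Y w &
              NY (T (u (phi k)) - w) @[k --> \oo] --> 0%E]].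

End compact_operators.

(* Main.v *)
(* Let M_r denote the mean over the ball of radius r, and let A_r be the combination
   of the M_(ir), i = 1..m, for which u - A_r u is, up to sign, the mean over |y| < r
   of the m-th differences D_y^m u. By Plancherel, |D_y^m u|_2 <= C |y|^s |u|_(H^s)
   as soon as s <= m, so |u - A_r u|_2 <= C r^s. A radial function is invariant under
   Householder reflections, which act transitively on spheres; hence its L^2 mass in a
   ball of radius r around x is at most C (r/|x|)^(n-1) times its total mass, and A_r u
   satisfies both a uniform and a radial decay bound. Applied to the dyadic pieces
   A_(r/2)^2 u - A_r^2 u, these bounds give a weighted L^q norm O(r^(gap/q)), where
   gap = n + c - (n/2 - s) q > 0 means q < 2^*_c and the upper bound on c makes the
   integral converge at infinity. Summing over r = 2^-k yields the imbedding with a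
   tail that is uniformly small, so it is enough to prove compactness for A_r^2 u with
   r fixed. There, uniform equicontinuity and the decay at infinity reduce the matter
   to finitely many points, where bounded sequences converge along an ultrafilter.
   Plancherel's theorem on L^1 /\ L^2 is obtained by integrating the power spectrum
   against exp (-t |xi|_1), whose Fourier transform is a product of Cauchy kernels. *)

Require Import Defs.
From HB Require Import structures.
From mathcomp Require Import all_boot all_order all_algebra.
From mathcomp Require Import all_classical all_reals all_analysis.
From mathcomp.real_closed Require Import complex.
From mathcomp Require Import measurable_realfun.
From mathcomp Require Import ring lra.

Set Implicit Arguments.
Unset Strict Implicit.
Unset Printing Implicit Defensive.

Import Order.TTheory GRing.Theory Num.Theory.
Import numFieldNormedType.Exports.
Local Open Scope classical_set_scope.
Local Open Scope ring_scope.

(** * Lebesgue measure on R^n *)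

(** Fourier analysis enters only through upper bounds for the L^2 norms of finite differences, where
    constants do not matter; the weighted estimates then concern real functions and are applied to
    the real and to the imaginary part. Since s may be large, a single mean would not reach the rate
    r^s, which the whole range q < 2^*_c requires; hence differences of order m. Means over balls
    are preferred to frequency cut-offs because they are local: locality allows the mass of a radial
    function near a point to be compared with its mass on an annulus. No polar coordinates occur;
    translations, dilations and reflections suffice.

    A dyadic piece of scale r is cut at |x| = r. Inside, the uniform bound is of order r^(s - n/2);
    outside, the radial bound is of order r^(s - 1/2) |x|^(-(n-1)/2). Both halves of the weighted
    integral scale like the same power of r, so one condition on q controls all small scales, while
    the bounds on c give integrability at the origin and at infinity. *)

Section Rn_lmodule.
Context {R : realType} {n : nat}.
Implicit Types x y z : Rn R n.

(** The module structure lets translations, dilations and reflections of tuples be handled by the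
    generic algebraic lemmas. *)
Definition Rn_zero : Rn R n := [tuple 0 | i < n].
Definition Rn_add x y : Rn R n := [tuple tnth x i + tnth y i | i < n].
Definition Rn_opp x : Rn R n := [tuple - tnth x i | i < n].
Definition Rn_scale (a : R) x : Rn R n := [tuple a * tnth x i | i < n].

Fact Rn_addA : associative Rn_add.
Proof. by move=> x y z; apply: eq_from_tnth => i; rewrite !tnth_mktuple addrA. Qed.
Fact Rn_addC : commutative Rn_add.
Proof. by move=> x y; apply: eq_from_tnth => i; rewrite !tnth_mktuple addrC. Qed.
Fact Rn_add0 : left_id Rn_zero Rn_add.
Proof. by move=> x; apply: eq_from_tnth => i; rewrite !tnth_mktuple add0r. Qed.
Fact Rn_addN : left_inverse Rn_zero Rn_opp Rn_add.
Proof. by move=> x; apply: eq_from_tnth => i; rewrite !tnth_mktuple addNr. Qed.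

HB.instance Definition _ := GRing.isZmodule.Build (n.-tuple (measurableTypeR R))
  Rn_addA Rn_addC Rn_add0 Rn_addN.

Fact Rn_scaleA a b x : Rn_scale a (Rn_scale b x) = Rn_scale (a * b) x.
Proof. by apply: eq_from_tnth => i; rewrite !tnth_mktuple mulrA. Qed.
Fact Rn_scale1 : left_id 1 Rn_scale.
Proof. by move=> x; apply: eq_from_tnth => i; rewrite !tnth_mktuple mul1r. Qed.
Fact Rn_scaleDr : right_distributive Rn_scale +%R.
Proof. by move=> a x y; apply: eq_from_tnth => i; rewrite !tnth_mktuple mulrDr. Qed.
Fact Rn_scaleDl x : {morph Rn_scale^~ x : a b / a + b}.
Proof. by move=> a b; apply: eq_from_tnth => i; rewrite !tnth_mktuple mulrDl. Qed.

HB.instance Definition _ := GRing.Zmodule_isLmodule.Build R (n.-tuple (measurableTypeR R))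
  Rn_scaleA Rn_scale1 Rn_scaleDr Rn_scaleDl.

Lemma tnthD x y i : tnth (x + y) i = tnth x i + tnth y i.
Proof. exact: tnth_mktuple. Qed.
Lemma tnthN x i : tnth (- x) i = - tnth x i.
Proof. exact: tnth_mktuple. Qed.
Lemma tnthZ a x i : tnth (a *: x) i = a * tnth x i.
Proof. exact: tnth_mktuple. Qed.
Lemma tnth0v i : tnth (0 : Rn R n) i = 0.
Proof. exact: tnth_mktuple. Qed.

Lemma measurable_addRn d (T : measurableType d) (f g : T -> Rn R n) :
  measurable_fun setT f -> measurable_fun setT g ->
  measurable_fun setT (fun t => f t + g t).
Proof.
move=> mf mg; apply/measurable_fun_tnthP => i.
rewrite (_ : _ \o _ = (fun t => tnth (f t) i + tnth (g t) i)); last first.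
  by apply/funext => t /=; rewrite tnthD.
by apply: measurable_funD; move: i; apply/measurable_fun_tnthP.
Qed.

End Rn_lmodule.

Section Rn_measurable.
Context {R : realType}.

Lemma measurable_oppRn n d (T : measurableType d) (f : T -> Rn R n) :
  measurable_fun setT f -> measurable_fun setT (fun t => - f t).
Proof.
move=> mf; apply/measurable_fun_tnthP => i.
rewrite (_ : _ \o _ = (fun t => - tnth (f t) i)); last first.
  by apply/funext => t /=; rewrite tnthN.
by apply: measurable_funN; move: i; apply/measurable_fun_tnthP.
Qed.

Lemma measurable_subRn n d (T : measurableType d) (f g : T -> Rn R n) :
  measurable_fun setT f -> measurable_fun setT g ->
  measurable_fun setT (fun t => f t - g t).
Proof. by move=> mf mg; apply: measurable_addRn => //; exact: measurable_oppRn. Qed.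

Lemma measurable_scaleRn n d (T : measurableType d) (a : T -> R) (f : T -> Rn R n) :
  measurable_fun setT a -> measurable_fun setT f ->
  measurable_fun setT (fun t => a t *: f t).
Proof.
move=> ma mf; apply/measurable_fun_tnthP => i.
rewrite (_ : _ \o _ = (fun t => a t * tnth (f t) i)); last first.
  by apply/funext => t /=; rewrite tnthZ.
by apply: measurable_funM => //; move: i; apply/measurable_fun_tnthP.
Qed.

Lemma measurable_dotRn n d (T : measurableType d) (f g : T -> Rn R n) :
  measurable_fun setT f -> measurable_fun setT g ->
  measurable_fun setT (fun t => dotRn (f t) (g t)).
Proof.
move=> mf mg; apply: measurable_sum => i.
by apply: measurable_funM; move: i; apply/measurable_fun_tnthP.
Qed.

Lemma measurable_enorm n d (T : measurableType d) (f : T -> Rn R n) :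
  measurable_fun setT f -> measurable_fun setT (fun t => enorm (f t)).
Proof.
move=> mf; rewrite /enorm.
apply: (@measurableT_comp _ _ _ _ _ _ (@Num.sqrt R)).
  by apply: continuous_measurable_fun; exact: sqrt_continuous.
apply: measurable_sum => i; apply: measurable_funX.
by move: i; apply/measurable_fun_tnthP.
Qed.

Lemma tnth_cons_Rn0 n (p : R * Rn R n) : tnth (cons_Rn p) ord0 = p.1.
Proof. by []. Qed.

Lemma tnth_cons_RnS n (p : R * Rn R n) i : tnth (cons_Rn p) (lift ord0 i) = tnth p.2 i.
Proof. by rewrite tnthS. Qed.

Lemma cons_RnD n (t u : R) (x y : Rn R n) :
  cons_Rn (t + u, x + y) = cons_Rn (t, x) + cons_Rn (u, y) :> Rn R n.+1.
Proof.
apply: eq_from_tnth => i; rewrite tnthD.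
case: (unliftP ord0 i) => [j|] ->; last by rewrite !tnth_cons_Rn0.
by rewrite !tnth_cons_RnS tnthD.
Qed.

Lemma Rn_consP n (x : Rn R n.+1) : exists t y, x = cons_Rn (t, y).
Proof. by exists (uncons_Rn x).1, (uncons_Rn x).2; rewrite -surjective_pairing uncons_RnK. Qed.

Local Open Scope ereal_scope.

Lemma ge0_integral_cons n (f : Rn R n.+1 -> \bar R) :
  measurable_fun setT f -> (forall x, 0 <= f x) ->
  \int[lebesgue_Rn n.+1]_x f x =
  \int[lebesgue_measure]_t \int[lebesgue_Rn n]_x f (cons_Rn (t, x)).
Proof.
move=> mf f0.
transitivity (\int[(@lebesgue_measure R \x lebesgue_Rn n)]_p f (cons_Rn p)).
  rewrite /= /cons_measure.
  rewrite (@ge0_integral_pushforward _ _ _ _ _ (@cons_Rn R n))//.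
  exact: measurable_cons_Rn.
rewrite (fubini_tonelli1 (f \o @cons_Rn R n))//; last by move=> x; exact: f0.
by apply: measurableT_comp => //; exact: measurable_cons_Rn.
Qed.

(** The translated measure and the Lebesgue measure agree on half-open intervals, and these
    determine the measure. *)
Lemma ge0_integral_shift1 (f : R -> \bar R) (a : R) :
  measurable_fun setT f -> (forall x, 0 <= f x) ->
  \int[lebesgue_measure]_t f (t + a)%R = \int[lebesgue_measure]_t f t.
Proof.
move=> mf f0.
have ma : measurable_fun [set: measurableTypeR R] (fun t : measurableTypeR R => (t + a)%R : measurableTypeR R).
  exact: measurable_funD.
rewrite [RHS](_ : _ = \int[pushforward (@lebesgue_measure R) (fun t : measurableTypeR R => (t + a)%R : measurableTypeR R)]_t f t); last first.
  apply: eq_measure_integral => A mA _.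
  apply: lebesgue_measure_unique => //= X /ocitvP [->|[[b c] /= bc ->]].
    by rewrite /pushforward preimage_set0 !measure0.
  rewrite /pushforward.
  rewrite (_ : _ @^-1` _ = `](b - a)%R, (c - a)%R]%classic); last first.
    apply/seteqP; split => x /=; rewrite !in_itv/=; lra.
  rewrite !lebesgue_measure_itv/= !lte_fin bc ltrD2r bc -!EFinB; congr EFin; ring.
by rewrite ge0_integral_pushforward.
Qed.

(** Induction on the dimension: Tonelli separates the first coordinate, shifted by the
    one-dimensional lemma, from the others. *)
Lemma ge0_integral_shift n (f : Rn R n -> \bar R) (a : Rn R n) :
  measurable_fun setT f -> (forall x, 0 <= f x) ->
  \int[lebesgue_Rn n]_x f (x + a)%R = \int[lebesgue_Rn n]_x f x.
Proof.
elim: n => [|n ih] in f a *; move=> mf f0.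
  by apply: eq_integral => x _; congr f; rewrite [x]tuple0 [LHS]tuple0.
have [t [b ->]] := Rn_consP a.
have mc : measurable_fun setT (fun p : R * Rn R n => f (cons_Rn p)).
  by apply: measurableT_comp => //; exact: measurable_cons_Rn.
have mfa : measurable_fun setT (fun x : Rn R n.+1 => f (x + cons_Rn (t, b))%R).
  by apply: measurableT_comp => //; exact: measurable_addRn.
rewrite (ge0_integral_cons mfa)// (ge0_integral_cons mf)//.
under eq_integral => u _.
  under eq_integral do rewrite -cons_RnD.
  rewrite (ih (fun x => f (cons_Rn ((u + t)%R, x))))//; last first.
    exact: (measurableT_comp mc (pair1_measurable _)).
  over.
rewrite (ge0_integral_shift1 (f := fun u => \int[lebesgue_Rn n]_x f (cons_Rn (u, x))))//.
  exact: (measurable_fun_fubini_tonelli_F (fun p : R * Rn R n => f (cons_Rn p))).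
by move=> u; exact: integral_ge0.
Qed.

(* Tonelli applied to g x * f (T y + x), once in x and once in y. This replaces the
   Jacobian: with g the indicator of a ball it shows that isometries preserve the measure. *)
Lemma ge0_integral_additive n (T S : Rn R n -> Rn R n) (f g : Rn R n -> \bar R) :
  measurable_fun setT T -> {morph T : x y / (x + y)%R} -> cancel S T ->
  measurable_fun setT f -> (forall x, 0 <= f x) ->
  measurable_fun setT g -> (forall x, 0 <= g x) ->
  (\int[lebesgue_Rn n]_x g x) * \int[lebesgue_Rn n]_y f (T y) =
  (\int[lebesgue_Rn n]_x f x) * \int[lebesgue_Rn n]_y g (- T y)%R.
Proof.
move=> mT TD ST mf f0 mg g0.
have mfT : measurable_fun setT (fun y => f (T y)) by exact: measurableT_comp.
have mgT : measurable_fun setT (fun y => g (- T y)%R).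
  by apply: measurableT_comp => //; exact: measurable_oppRn.
have mT2 : measurable_fun setT (fun p : Rn R n * Rn R n => T p.2).
  exact: measurableT_comp.
rewrite -ge0_integralZr//; last exact: integral_ge0.
transitivity (\int[lebesgue_Rn n]_x \int[lebesgue_Rn n]_y (g x * f (T y + x)%R)).
  apply: eq_integral => x _; rewrite -ge0_integralZl//.
  (* By additivity T (y + S x) = T y + x. The same shift serves again for the last integral. *)
  rewrite -[LHS](ge0_integral_shift (S x)); last 2 first.
    exact: measurable_funeM.
    by move=> y; rewrite mule_ge0.
  by apply: eq_integral => y _; rewrite TD ST.
rewrite (fubini_tonelli (fun p : Rn R n * Rn R n => g p.1 * f (T p.2 + p.1)%R))//=; last 2 first.
  apply: emeasurable_funM; first exact: measurableT_comp.
  by apply: measurableT_comp => //; exact: measurable_addRn.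
  by move=> x; rewrite mule_ge0.
transitivity (\int[lebesgue_Rn n]_y \int[lebesgue_Rn n]_x (g (x - T y)%R * f x)).
  apply: eq_integral => y _; rewrite -[RHS](ge0_integral_shift (T y)); last 2 first.
    apply: emeasurable_funM => //.
    by apply: measurableT_comp => //; exact: measurable_subRn.
    by move=> x; rewrite mule_ge0.
  by apply: eq_integral => x _; rewrite addrK addrC.
rewrite (fubini_tonelli (fun p : Rn R n * Rn R n => g (p.2 - T p.1)%R * f p.2))//=; last 2 first.
  apply: emeasurable_funM; last exact: measurableT_comp.
  apply: measurableT_comp => //; apply: measurable_subRn => //.
  exact: measurableT_comp.
  by move=> x; rewrite mule_ge0.
rewrite -ge0_integralZr//; last exact: integral_ge0.
apply: eq_integral => x _.
rewrite ge0_integralZr//; last first.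
  by apply: measurableT_comp => //; apply: measurable_subRn.
rewrite muleC; congr (_ * _).
rewrite -[LHS](ge0_integral_shift (S x)); last 2 first.
  by apply: measurableT_comp => //; apply: measurable_subRn.
  by [].
by apply: eq_integral => y _; rewrite TD ST opprD addrCA subrr addr0.
Qed.

End Rn_measurable.

(** * Euclidean norm and Householder reflections *)

Section Rn_norm.
Context {R : realType} {n : nat}.
Implicit Types (x y z a : Rn R n) (r : R).

Lemma dotRnC x y : dotRn x y = dotRn y x.
Proof. by apply: eq_bigr => i _; rewrite mulrC. Qed.

Lemma dotRnDl x y z : dotRn (x + y) z = dotRn x z + dotRn y z.
Proof. by rewrite -big_split; apply: eq_bigr => i _; rewrite /= tnthD mulrDl. Qed.

Lemma dotRnZl r x y : dotRn (r *: x) y = r * dotRn x y.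
Proof. by rewrite mulr_sumr; apply: eq_bigr => i _; rewrite tnthZ mulrA. Qed.

Lemma dotRnDr x y z : dotRn x (y + z) = dotRn x y + dotRn x z.
Proof. by rewrite dotRnC dotRnDl !(dotRnC x). Qed.

Lemma dotRnZr r x y : dotRn x (r *: y) = r * dotRn x y.
Proof. by rewrite dotRnC dotRnZl dotRnC. Qed.

Lemma dotRnNl x y : dotRn (- x) y = - dotRn x y.
Proof. by rewrite -scaleN1r dotRnZl mulN1r. Qed.

Lemma dotRnNr x y : dotRn x (- y) = - dotRn x y.
Proof. by rewrite dotRnC dotRnNl dotRnC. Qed.

Lemma dotRn_ge0 x : 0 <= dotRn x x.
Proof. by apply: sumr_ge0 => i _; rewrite -expr2 sqr_ge0. Qed.

Lemma dotRn_eq0 x : dotRn x x = 0 -> x = 0.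
Proof.
move=> /eqP; rewrite psumr_eq0; last by move=> i _; rewrite -expr2 sqr_ge0.
move=> /allP x0; apply: eq_from_tnth => i; rewrite tnth0v.
by have := x0 i (mem_index_enum i); rewrite /= mulf_eq0 orbb => /eqP.
Qed.

Lemma enormE x : enorm x = Num.sqrt (dotRn x x).
Proof. by congr Num.sqrt; apply: eq_bigr => i _; rewrite expr2. Qed.

Lemma enorm_sqr x : enorm x ^+ 2 = dotRn x x.
Proof. by rewrite enormE sqr_sqrtr// dotRn_ge0. Qed.

Lemma enorm_ge0 x : 0 <= enorm x.
Proof. exact: sqrtr_ge0. Qed.

Lemma enormN x : enorm (- x) = enorm x.
Proof. by rewrite !enormE dotRnNl dotRnNr opprK. Qed.

Lemma enormZ r x : enorm (r *: x) = `|r| * enorm x.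
Proof.
by rewrite !enormE dotRnZl dotRnZr mulrA -expr2 sqrtrM ?sqr_ge0// sqrtr_sqr.
Qed.

Lemma dotRn_le_enorm x y : `|dotRn x y| <= enorm x * enorm y.
Proof.
rewrite -(ler_pXn2r (n := 2))// ?nnegrE ?mulr_ge0 ?enorm_ge0//.
rewrite exprMn !enorm_sqr real_normK ?num_real//.
have [y0|y0] := eqVneq (dotRn y y) 0.
  rewrite (dotRn_eq0 y0) -(scale0r (0 : Rn R n)) !dotRnZr.
  by rewrite !mul0r expr0n mulr0.
have yp : 0 < dotRn y y by rewrite lt_neqAle eq_sym y0 dotRn_ge0.
(* The squared length of (y.y) x - (x.y) y expands to (y.y) ((x.x) (y.y) - (x.y)^2), and y.y > 0. *)
have := dotRn_ge0 (dotRn y y *: x - dotRn x y *: y).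
rewrite !(dotRnDl, dotRnDr, dotRnNl, dotRnNr, dotRnZl, dotRnZr) (dotRnC y x).
set A := dotRn x x; set B := dotRn y y; set C := dotRn x y => h.
by rewrite -subr_ge0 -(pmulr_rge0 _ yp) -/B; apply: le_trans h _; lra.
Qed.

Lemma enormD x y : enorm (x + y) <= enorm x + enorm y.
Proof.
rewrite -(ler_pXn2r (n := 2))// ?nnegrE ?addr_ge0 ?enorm_ge0//.
rewrite enorm_sqr !(dotRnDl, dotRnDr) (dotRnC y x) sqrrD -!enorm_sqr.
by have := le_trans (ler_norm _) (dotRn_le_enorm x y); lra.
Qed.

Lemma tnth_le_enorm x i : `|tnth x i| <= enorm x.
Proof.
rewrite -sqrtr_sqr; apply: ler_wsqrtr.
by rewrite (bigD1 i)//= lerDl; apply: sumr_ge0 => j _; exact: sqr_ge0.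
Qed.

Lemma enorm_le_sum x : enorm x <= \sum_(i < n) `|tnth x i|.
Proof.
have s0 : 0 <= \sum_(i < n) `|tnth x i| by exact: sumr_ge0.
rewrite -(ler_pXn2r (n := 2))// ?nnegrE ?enorm_ge0//.
rewrite enorm_sqr expr2 mulr_suml; apply: ler_sum => i _.
apply: (@le_trans _ _ (`|tnth x i| * `|tnth x i|)); first by rewrite -normrM ler_norm.
rewrite ler_wpM2l// (bigD1 i)//= lerDl; exact: sumr_ge0.
Qed.

(** The Householder reflection in the hyperplane orthogonal to a. For a = 0 the quotient is 0 and
    the map is the identity, so the properties below hold for every a. *)
Definition reflectRn a x : Rn R n := x - (2 * dotRn a x / dotRn a a) *: a.

Lemma reflectRnD a : {morph reflectRn a : x y / x + y}.
Proof.
move=> x y; rewrite /reflectRn dotRnDr mulrDr mulrDl scalerDl opprD.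
by rewrite addrACA.
Qed.

Lemma reflectRnN a x : reflectRn a (- x) = - reflectRn a x.
Proof. by rewrite /reflectRn dotRnNr mulrN mulNr scaleNr opprD. Qed.

Lemma reflectRnK a : involutive (reflectRn a).
Proof.
move=> x; rewrite /reflectRn dotRnDr dotRnNr dotRnZr -addrA -opprD -scalerDl.
have [a0|a0] := eqVneq (dotRn a a) 0.
  by rewrite a0 invr0 !mulr0 addr0 scale0r subr0.
by rewrite [X in X *: a](_ : _ = 0) ?scale0r ?subr0//; field.
Qed.

Lemma enorm_reflectRn a x : enorm (reflectRn a x) = enorm x.
Proof.
rewrite !enormE; congr Num.sqrt; rewrite /reflectRn.
rewrite !(dotRnDl, dotRnDr, dotRnNl, dotRnNr, dotRnZl, dotRnZr) (dotRnC x a).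
have [a0|a0] := eqVneq (dotRn a a) 0; last by field.
by rewrite a0 invr0; ring.
Qed.

Lemma reflectRn_swap x y : enorm x = enorm y -> reflectRn (x - y) x = y.
Proof.
move=> xy; have {}xy : dotRn x x = dotRn y y by rewrite -!enorm_sqr xy.
rewrite /reflectRn; set a := x - y.
(* Equal norms give a.a = 2 a.x, so the coefficient of a in the reflection is 1. *)
have aa : dotRn a a = 2 * dotRn a x.
  rewrite /a !(dotRnDl, dotRnDr, dotRnNl, dotRnNr) (dotRnC y x) -xy; ring.
have [a0|a0] := eqVneq (dotRn a a) 0.
  have : a = 0 by exact: dotRn_eq0.
  by move=> a0'; rewrite a0' scaler0 subr0; apply/eqP; rewrite -subr_eq0 -/a a0'.
by rewrite -aa divff// scale1r /a opprB addrCA subrr addr0.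
Qed.

Lemma measurable_reflectRn a : measurable_fun setT (reflectRn a).
Proof.
apply: measurable_subRn => //; apply: measurable_scaleRn => //.
by apply: measurable_funM => //; apply: measurable_funM => //; exact: measurable_dotRn.
Qed.

End Rn_norm.

(** * Volumes of cubes and balls; dilations and isometries *)

Section Rn_change_of_variable.
Context {R : realType}.
Local Open Scope ereal_scope.

(** Tonelli, one coordinate at a time. It yields the volume of cubes, the integrability of exp
    (-|x|_1) and the mass of the product of Cauchy kernels. *)
Lemma ge0_integral_prod_tnth (phi : R -> R) (c : R) n :
  measurable_fun setT phi -> (forall t, 0 <= phi t)%R ->
  \int[lebesgue_measure]_t (phi t)%:E = c%:E ->
  \int[lebesgue_Rn n]_x (\prod_(i < n) phi (tnth x i))%:E = (c ^+ n)%:E.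
Proof.
move=> mphi phi0 phic.
have mprod k : measurable_fun setT (fun x : Rn R k => (\prod_(i < k) phi (tnth x i))%:E).
  apply/measurable_EFinP; apply: measurable_prod => i _.
  by apply: measurableT_comp => //; exact: measurable_tnth.
have prod0 k (x : Rn R k) : (0 <= \prod_(i < k) phi (tnth x i))%R by exact: prodr_ge0.
elim: n => [|n ih].
  rewrite /= integral_dirac//; last exact: mprod.
  by rewrite diracT mul1e big_ord0.
rewrite ge0_integral_cons//; last by move=> x; rewrite lee_fin.
transitivity (\int[lebesgue_measure]_t ((phi t)%:E * (c ^+ n)%:E)).
  apply: eq_integral => t _.
  under eq_integral => x _.
    rewrite big_ord_recl tnth_cons_Rn0 EFinM.
    under eq_bigr do rewrite tnth_cons_RnS.
    over.
  rewrite /= ge0_integralZl ?lee_fin ?ih//; first exact: mprod.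
  by move=> x _; rewrite lee_fin; exact: prod0.
have mphi' : measurable_fun setT (fun t => (phi t)%:E) by exact/measurable_EFinP.
have phi0' t : 0 <= (phi t)%:E by rewrite lee_fin.
have cn0 : 0 <= (c ^+ n)%:E.
  by rewrite lee_fin exprn_ge0// -lee_fin -phic integral_ge0.
rewrite ge0_integralZr//.
by rewrite phic -EFinM exprS.
Qed.

Definition cubeRn (n : nat) (r : R) : set (Rn R n) := [set x | forall i, `|tnth x i| < r]%R.

Lemma indic_cubeRn n (r : R) (x : Rn R n) :
  \1_(@cubeRn n r) x = (\prod_(i < n) \1_(`](- r), r[%classic : set R) (tnth x i))%R :> R.
Proof.
rewrite indicE; have [/set_mem xr|xr] := boolP (x \in @cubeRn n r).
  rewrite big1// => i _; rewrite indicE mem_set//=.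
  by rewrite in_itv/= -ltr_norml; exact: xr.
have /existsNP[i xi] : ~ forall i, (`|tnth x i| < r)%R.
  by move=> xr'; move: xr; rewrite mem_set.
rewrite (bigD1 i)//= indicE memNset ?mul0r//=.
by rewrite in_itv/= -ltr_norml.
Qed.

Lemma measurable_cubeRn n (r : R) : measurable (@cubeRn n r).
Proof.
apply/(measurable_indicP R).
rewrite (_ : \1_(@cubeRn n r) = fun x => (\prod_(i < n) \1_(`](- r), r[%classic : set R) (tnth x i))%R); last first.
  by apply/funext => x; exact: indic_cubeRn.
apply: measurable_prod => i _; apply: measurableT_comp; last exact: measurable_tnth.
exact: measurable_indic.
Qed.

Lemma lebesgue_cubeRn n (r : R) : (0 < r)%R -> lebesgue_Rn n (@cubeRn n r) = ((2 * r) ^+ n)%:E.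
Proof.
move=> r0; have mc := @measurable_cubeRn n r.
have := integral_indic (lebesgue_Rn n) measurableT mc.
rewrite setIT => <-; under eq_integral do rewrite indic_cubeRn.
apply: ge0_integral_prod_tnth; first exact: measurable_indic.
  by move=> t; rewrite indicE.
rewrite integral_indic// setIT; apply: etrans (lebesgue_measure_itv _) _.
rewrite /= lte_fin ifT -?EFinB; last lra.
by congr EFin; ring.
Qed.

(** [ge0_integral_additive] with g the indicator of the unit cube: the integrals of g and of its
    dilate are known cube volumes, and the Jacobian r^-n is their quotient. *)
Lemma ge0_integral_dilation n (r : R) (f : Rn R n -> \bar R) : (0 < r)%R ->
  measurable_fun setT f -> (forall x, 0 <= f x) ->
  \int[lebesgue_Rn n]_x f (r *: x)%R = ((r^-1) ^+ n)%:E * \int[lebesgue_Rn n]_x f x.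
Proof.
move=> r0 mf f0; pose g (x : Rn R n) := (\1_(@cubeRn n 1%R) x)%:E : \bar R.
have mT : measurable_fun setT (fun x : Rn R n => r *: x)%R by exact: measurable_scaleRn.
have mg : measurable_fun setT g.
  by apply/measurable_EFinP; exact: (measurable_indic (@measurable_cubeRn n 1%R)).
have g0 x : 0 <= g x by rewrite lee_fin.
have := @ge0_integral_additive _ _ _ (fun x : Rn R n => r^-1 *: x)%R f g mT _ _ mf f0 mg g0.
have -> : \int[lebesgue_Rn n]_x g x = (2 ^+ n)%:E.
  rewrite /g integral_indic//; last exact: measurable_cubeRn.
  by rewrite setIT; apply: etrans (lebesgue_cubeRn n ltr01) _; rewrite mulr1.
have -> : \int[lebesgue_Rn n]_y g (- (r *: y))%R = ((2 * r^-1) ^+ n)%:E.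
  have mc := @measurable_cubeRn n r^-1; have ri : (0 < r^-1)%R by rewrite invr_gt0.
  rewrite -(lebesgue_cubeRn n ri).
  have := integral_indic (lebesgue_Rn n) measurableT mc; rewrite setIT => <-.
  apply: eq_integral => y _; congr EFin; rewrite !indicE; congr (nat_of_bool _)%:R.
  apply/idP/idP => /set_mem h; apply/mem_set => i; have := h i.
    by rewrite /= tnthN tnthZ normrN normrM gtr0_norm// => ?; rewrite -[ltRHS]mulr1 ltr_pdivlMl.
  by rewrite /= tnthN tnthZ normrN normrM gtr0_norm// -[ltRHS]mulr1 ltr_pdivlMl.
move=> /(_ (scalerDr r))/(_ (fun x => _)) h.
have {h}/(congr1 (fun z => ((2 ^+ n)^-1)%:E * z)) : (2 ^+ n)%:E * \int[lebesgue_Rn n]_y f (r *: y)%R =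
     \int[lebesgue_Rn n]_x f x * ((2 * r^-1) ^+ n)%:E.
  by apply: h => x; rewrite scalerA divff ?scale1r// gt_eqF.
have n0 : ((2:R) ^+ n != 0)%R by rewrite expf_neq0.
rewrite muleA -EFinM mulVf// mul1e => ->.
rewrite (muleC (\int[_]_x _)) muleA -EFinM exprMn mulrA mulVf// mul1r//.
Qed.

Definition ballRn n (r : R) : set (Rn R n) := [set x | enorm x < r]%R.
Arguments ballRn : clear implicits.

Lemma measurable_ballRn n (r : R) : measurable (ballRn n r).
Proof.
rewrite -[X in measurable X]setTI.
apply: (measurable_fun_ltr (f := @enorm R n) (g := cst r)) => //.
exact: measurable_enorm.
Qed.

Lemma measurable_indic_ballRn n (r : R) :
  measurable_fun setT (\1_(ballRn n r) : Rn R n -> R).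
Proof. exact: (measurable_indic (@measurable_ballRn n r)). Qed.

Lemma indic_ballRnE n (r : R) x : \1_(ballRn n r) x = (enorm x < r)%R%:R :> R.
Proof.
by rewrite indicE; congr (nat_of_bool _)%:R; apply/idP/idP => [/set_mem//|h]; apply/mem_set.
Qed.

Lemma lebesgue_ballRn_gt0 n (r : R) : (0 < r)%R -> 0 < lebesgue_Rn n (ballRn n r).
Proof.
(* A cube of half side r / (n + 1) fits into the ball because |x| is at most the sum of the n
   coordinates in absolute value. *)
move=> r0; pose a := (r / n.+1%:R)%R.
have a0 : (0 < a)%R by rewrite divr_gt0.
apply: (@lt_le_trans _ _ (lebesgue_Rn n (@cubeRn n a))).
  by rewrite lebesgue_cubeRn// lte_fin exprn_gt0// mulr_gt0.
apply: le_measure; rewrite ?inE; [exact: measurable_cubeRn|exact: measurable_ballRn|].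
move=> x xa; apply: le_lt_trans (enorm_le_sum x) _.
apply: (@le_lt_trans _ _ (\sum_(i < n) a)%R).
  by apply: ler_sum => i _; exact/ltW/xa.
rewrite sumr_const card_ord -mulr_natr /a mulrAC -mulrA gtr_pMr//.
by rewrite ltr_pdivrMr// mul1r ltr_nat.
Qed.

Lemma lebesgue_ballRn_lty n (r : R) : lebesgue_Rn n (ballRn n r) < +oo.
Proof.
have r0 : (0 < `|r| + 1)%R by rewrite ltr_wpDl.
apply: (@le_lt_trans _ _ (lebesgue_Rn n (@cubeRn n (`|r| + 1)%R))); last first.
  by rewrite lebesgue_cubeRn// ltry.
apply: le_measure; rewrite ?inE; [exact: measurable_ballRn|exact: measurable_cubeRn|].
move=> x xr i; apply: le_lt_trans (tnth_le_enorm x i) _.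
by apply: (lt_trans xr); apply: le_lt_trans (ler_norm r) _; rewrite ltrDl.
Qed.

Definition vol_ball n : R := fine (lebesgue_Rn n (ballRn n 1%R)).

Lemma vol_ball_gt0 n : (0 < vol_ball n)%R.
Proof. by apply: fine_gt0; rewrite lebesgue_ballRn_gt0 ?lebesgue_ballRn_lty. Qed.

Lemma lebesgue_ballRn n (r : R) : (0 < r)%R ->
  lebesgue_Rn n (ballRn n r) = (vol_ball n * r ^+ n)%:E.
Proof.
move=> r0; have ri : (0 < r^-1)%R by rewrite invr_gt0.
have mb t := @measurable_ballRn n t.
have := @ge0_integral_dilation n _ (EFin \o \1_(ballRn n 1%R)) ri.
have i1 t : \int[lebesgue_Rn n]_x (EFin \o \1_(ballRn n t)) x = lebesgue_Rn n (ballRn n t).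
  by have := integral_indic (lebesgue_Rn n) measurableT (mb t); rewrite setIT => <-.
rewrite i1 invrK => h.
rewrite mulrC EFinM fineK; last by rewrite ge0_fin_numE ?lebesgue_ballRn_lty.
rewrite -h//; last 2 first.
- by apply/measurable_EFinP; exact: measurable_indic_ballRn.
- by move=> x; rewrite lee_fin.
rewrite -i1; apply: eq_integral => x _ /=; congr EFin; rewrite !indicE.
congr (nat_of_bool _)%:R; apply/idP/idP => /set_mem xr; apply/mem_set; move: xr.
  by rewrite /ballRn/= enormZ gtr0_norm// ltr_pdivrMl// mulr1.
by rewrite /ballRn/= enormZ gtr0_norm// ltr_pdivrMl// mulr1.
Qed.

Lemma ge0_integral_isometry n (T S : Rn R n -> Rn R n) (f : Rn R n -> \bar R) :
  measurable_fun setT T -> {morph T : x y / (x + y)%R} -> cancel S T ->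
  (forall x, enorm (T x) = enorm x) ->
  measurable_fun setT f -> (forall x, 0 <= f x) ->
  \int[lebesgue_Rn n]_x f (T x) = \int[lebesgue_Rn n]_x f x.
Proof.
move=> mT TD ST Tn mf f0; pose g (x : Rn R n) := (\1_(ballRn n 1%R) x)%:E : \bar R.
have mg : measurable_fun setT g by apply/measurable_EFinP; exact: measurable_indic_ballRn.
have g0 x : 0 <= g x by rewrite lee_fin.
have := ge0_integral_additive mT TD ST mf f0 mg g0.
have -> : \int[lebesgue_Rn n]_y g (- T y)%R = \int[lebesgue_Rn n]_y g y.
  by apply: eq_integral => y _; rewrite /g !indic_ballRnE enormN Tn.
have -> : \int[lebesgue_Rn n]_y g y = (vol_ball n)%:E.
  rewrite /g integral_indic//; last exact: measurable_ballRn.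
  by rewrite setIT; apply: etrans (lebesgue_ballRn n ltr01) _; rewrite expr1n mulr1.
have v0 : (vol_ball n != 0)%R by rewrite gt_eqF ?vol_ball_gt0.
move=> /(congr1 (fun z => ((vol_ball n)^-1)%:E * z)).
by rewrite (muleC (\int[_]_x f x)) !muleA -!EFinM mulVf// !mul1e.
Qed.

Lemma ge0_integral_opp n (f : Rn R n -> \bar R) :
  measurable_fun setT f -> (forall x, 0 <= f x) ->
  \int[lebesgue_Rn n]_x f (- x)%R = \int[lebesgue_Rn n]_x f x.
Proof.
apply: (ge0_integral_isometry (S := -%R)); [exact: measurable_oppRn|exact: opprD|exact: opprK|exact: enormN].
Qed.

Lemma ge0_integral_reflect n a (f : Rn R n -> \bar R) :
  measurable_fun setT f -> (forall x, 0 <= f x) ->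
  \int[lebesgue_Rn n]_x f (reflectRn a x) = \int[lebesgue_Rn n]_x f x.
Proof.
apply: (ge0_integral_isometry (S := reflectRn a)).
- exact: measurable_reflectRn.
- exact: reflectRnD.
- exact: reflectRnK.
- exact: enorm_reflectRn.
Qed.

End Rn_change_of_variable.
Arguments ballRn {R} n r.

(** * Automation of measurability *)

Lemma measurable_indic_ballRn_comp (R : realType) n (r : R) d (T : measurableType d)
    (f : T -> Rn R n) : measurable_fun setT f ->
  measurable_fun setT (fun t => \1_(ballRn n r) (f t) : R).
Proof. exact: (measurableT_comp (measurable_indic (@measurable_ballRn R n r))). Qed.

Lemma measurable_normr_comp (R : realType) d (T : measurableType d) (f : T -> R) :
  measurable_fun setT f -> measurable_fun setT (fun t => `|f t|).
Proof. by move=> mf; exact: measurableT_comp. Qed.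

Lemma measurable_powR_comp (R : realType) d (T : measurableType d) (c : R) (f : T -> R) :
  measurable_fun setT f -> measurable_fun setT (fun t => f t `^ c).
Proof. exact: (measurableT_comp (measurable_powR c)). Qed.

Lemma measurable_cos_comp (R : realType) d (T : measurableType d) (f : T -> R) :
  measurable_fun setT f -> measurable_fun setT (fun t => cos (f t)).
Proof. by apply: measurableT_comp; apply: continuous_measurable_fun; exact: continuous_cos. Qed.

Lemma measurable_sin_comp (R : realType) d (T : measurableType d) (f : T -> R) :
  measurable_fun setT f -> measurable_fun setT (fun t => sin (f t)).
Proof. by apply: measurableT_comp; apply: continuous_measurable_fun; exact: continuous_sin. Qed.

Lemma measurable_expR_comp (R : realType) d (T : measurableType d) (f : T -> R) :
  measurable_fun setT f -> measurable_fun setT (fun t => expR (f t)).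
Proof. by apply: measurableT_comp; exact: measurable_expR. Qed.

(** Recursion on the syntax of the function. What no closure property covers is looked up among the
    hypotheses, families of measurable functions included. *)
Ltac meas :=
  lazymatch goal with
  | |- _ -> _ => move=> ?; meas
  | |- measurable_fun _ (fun _ => ?c) => exact: measurable_cst
  | |- measurable_fun _ (fun x => x) => exact: measurable_id
  | |- measurable_fun _ (?f \o ?g) => change (measurable_fun setT (fun x => f (g x))); meas
  | |- measurable_fun _ (fun x => (EFin \o ?f) (@?g x)) =>
      change (measurable_fun setT (fun x => EFin (f (g x)))); meas
  | |- measurable_fun _ (fun x => EFin (@?f x)) => apply/measurable_EFinP; change (measurable_fun setT f); meas
  | |- measurable_fun _ (fun x => fst (@?f x)) =>
      first [exact: measurable_fst | apply: (@measurableT_comp _ _ _ _ _ _ fst); [exact: measurable_fst | meas]]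
  | |- measurable_fun _ (fun x => snd (@?f x)) =>
      first [exact: measurable_snd | apply: (@measurableT_comp _ _ _ _ _ _ snd); [exact: measurable_snd | meas]]
  | |- measurable_fun _ (fun x => tnth (@?f x) ?i) =>
      apply: (@measurableT_comp _ _ _ _ _ _ (fun z => tnth z i)); [exact: measurable_tnth | meas]
  | |- measurable_fun _ (fun x => enorm (@?f x)) => apply: (measurable_enorm (f := f)); meas
  | |- measurable_fun _ (fun x => dotRn (@?f x) (@?g x)) => apply: (measurable_dotRn (f := f) (g := g)); meas
  | |- measurable_fun _ (fun x => GRing.exp (@?f x) ?n) => apply: (measurable_funX n (f := f)); meas
  | |- measurable_fun _ (fun x => GRing.scale (@?a x) (@?f x)) => apply: (measurable_scaleRn (a := a) (f := f)); meas
  | |- measurable_fun _ (fun x => GRing.mul (@?f x) (@?g x)) => apply: (measurable_funM (f := f) (g := g)); meas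
  | |- measurable_fun _ (fun x => Algebra.add (@?f x) (@?g x)) =>
      first [apply: (measurable_funD (f := f) (g := g)) | apply: (measurable_addRn (f := f) (g := g)) | apply: (emeasurable_funD (f := f) (g := g))]; meas
  | |- measurable_fun _ (fun x => Algebra.opp (@?f x)) =>
      first [apply: (measurable_funN (f := f)) | apply: (measurable_oppRn (f := f))]; meas
  | |- measurable_fun _ (fun x => mule (@?f x) (@?g x)) => apply: (emeasurable_funM (f := f) (g := g)); meas
  | |- measurable_fun _ (fun x => adde (@?f x) (@?g x)) => apply: (emeasurable_funD (f := f) (g := g)); meas
  | |- measurable_fun _ (fun x => \1_(ballRn ?n ?r) (@?g x)) =>
      apply: (@measurable_indic_ballRn_comp _ n r _ _ g); meas
  | |- measurable_fun _ (fun x => Num.norm (@?f x)) =>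
      apply: (measurable_normr_comp (f := f)); meas
  | |- measurable_fun _ (fun x => powR (@?f x) ?c) =>
      apply: (measurable_powR_comp c (f := f)); meas
  | |- measurable_fun _ (fun x => cos (@?f x)) => apply: (measurable_cos_comp (f := f)); meas
  | |- measurable_fun _ (fun x => sin (@?f x)) => apply: (measurable_sin_comp (f := f)); meas
  | |- measurable_fun _ (fun x => expR (@?f x)) => apply: (measurable_expR_comp (f := f)); meas
  | |- measurable_fun _ (fun x => bigop _ _ _) =>
      first [apply: measurable_sum | apply: measurable_prod]; meas
  | |- measurable_fun _ (@enorm ?R ?n) => exact: (@measurable_enorm R n _ _ id (@measurable_id _ _ _))
  | H : measurable_fun setT ?u |- measurable_fun _ ?u => exact H
  | H : forall i, measurable_fun setT (?u i) |- measurable_fun _ (?u _) => exact: H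
  | |- measurable_fun _ (fun x => ?u (@?g x)) =>
      match goal with
      | H : measurable_fun setT ?v |- _ => unify u v; apply: (measurableT_comp (f := u) (g := g) H); meas
      | H : forall i, measurable_fun setT (?v i) |- _ =>
          apply: (measurableT_comp (f := u) (g := g) (H _)); meas
      end
  end.

(** * Square-integrable functions and ball averages *)

Section square_integrable.
Context d (T : measurableType d) (R : realType) (mu : {measure set T -> \bar R}).
Implicit Types (D : set T) (f g : T -> R).
Local Open Scope ereal_scope.

Definition sqint f : \bar R := \int[mu]_x (f x ^+ 2)%:E.

Definition L2 f := measurable_fun setT f /\ sqint f < +oo.

Lemma sqint_ge0 f : 0 <= sqint f.
Proof. by apply: integral_ge0 => x _; rewrite lee_fin sqr_ge0. Qed.

(** On a set of finite measure, |f| <= 1 + f^2 gives integrability. *)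
Lemma integrable_sqr_on D f : measurable D -> mu D < +oo ->
  measurable_fun D f -> \int[mu]_(x in D) (f x ^+ 2)%:E < +oo ->
  mu.-integrable D (EFin \o f).
Proof.
move=> mD Dfin mf f2; apply/integrableP; split; first exact/measurable_EFinP.
apply: (@le_lt_trans _ _ (\int[mu]_(x in D) (1 + (f x ^+ 2)%:E))).
  apply: ge0_le_integral => //=.
  - by apply/measurable_EFinP; exact: measurableT_comp.
  - apply: emeasurable_funD => //; apply/measurable_EFinP.
    exact: measurable_funX.
  - move=> x _; rewrite -EFinD lee_fin.
    by have := sqr_ge0 (`|f x| - 1)%R; rewrite -(real_normK (num_real (f x))); nra.
rewrite ge0_integralD//=.
- by rewrite integral_cst// mul1e lte_add_pinfty.
- by move=> x _; rewrite lee_fin sqr_ge0.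
- by apply/measurable_EFinP; exact: measurable_funX.
Qed.

(** Jensen's inequality for the square, obtained by integrating 2 a f - a^2 <= f^2 with a the mean
    of f. If the right side is infinite, there is nothing to prove. *)
Lemma sqr_mean_le D f (v : R) : measurable D -> mu D = v%:E -> (0 < v)%R ->
  measurable_fun D f ->
  (((v^-1 * Rintegral mu D f) ^+ 2)%:E <= (v^-1)%:E * \int[mu]_(x in D) (f x ^+ 2)%:E).
Proof.
move=> mD Dv v0 mf.
have [foo|] := ltP (\int[mu]_(x in D) (f x ^+ 2)%:E) +oo; last first.
  by rewrite leye_eq => /eqP ->; rewrite gt0_muley ?leey// lte_fin invr_gt0.
have Dfin : mu D < +oo by rewrite Dv ltry.
have fi := integrable_sqr_on mD Dfin mf foo.
set a := (v^-1 * _)%R.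
have intf : \int[mu]_(x in D) (f x)%:E = (v * a)%:E.
  by rewrite /a mulrA divff ?gt_eqF// mul1r /Rintegral fineK// integrable_fin_num.
have ci (k : R) : mu.-integrable D (EFin \o cst k).
  apply: measurable_bounded_integrable => //; exists `|k|%R; split => // M kM x _ /=.
  exact: ltW.
have : \int[mu]_(x in D) ((2 * a)%:E * (f x)%:E - (a ^+ 2)%:E) <= \int[mu]_(x in D) (f x ^+ 2)%:E.
  apply: le_integral => //.
  - by apply: integrableB => //; [exact: integrableZl|exact: ci].
  - apply/integrableP; split; first by apply/measurable_EFinP; exact: measurable_funX.
    by under eq_integral do rewrite gee0_abs ?lee_fin ?sqr_ge0//.
  - by move=> x _; rewrite -EFinM -EFinB lee_fin; have := sqr_ge0 (f x - a)%R; nra.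
rewrite integralB//; last 2 first.
- exact: integrableZl.
- exact: ci.
rewrite integralZl// intf integral_cst// Dv -!EFinM -EFinB => h.
rewrite -(@lee_pmul2l _ v%:E)// ?lte_fin// muleA -!EFinM divff ?gt_eqF// mul1e.
by apply: le_trans h; rewrite lee_fin; nra.
Qed.

Lemma sqintD f g : L2 f -> L2 g ->
  sqint (fun x => (f x + g x)%R) <= 2%:E * sqint f + 2%:E * sqint g.
Proof.
move=> [mf _] [mg _].
rewrite /sqint -!ge0_integralZl//; [|meas|by move=> x _; rewrite lee_fin sqr_ge0|meas|by move=> x _; rewrite lee_fin sqr_ge0].
rewrite -ge0_integralD//; [|by move=> x _; rewrite -EFinM lee_fin mulr_ge0// sqr_ge0|apply: measurable_funeM; meas|by move=> x _; rewrite -EFinM lee_fin mulr_ge0// sqr_ge0|apply: measurable_funeM; meas].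
apply: ge0_le_integral => //.
- by move=> x _; rewrite lee_fin sqr_ge0.
- meas.
- by apply: emeasurable_funD; apply: measurable_funeM; meas.
- by move=> x _; rewrite -!EFinM -EFinD lee_fin; have := sqr_ge0 (f x - g x)%R; nra.
Qed.

Lemma sqintZ (c : R) f : L2 f -> sqint (fun x => (c * f x)%R) = (c ^+ 2)%:E * sqint f.
Proof.
move=> [mf _]; rewrite /sqint -ge0_integralZl//; last 3 first.
- meas.
- by move=> x _; rewrite lee_fin sqr_ge0.
- by rewrite lee_fin sqr_ge0.
by apply: eq_integral => x _; rewrite exprMn EFinM.
Qed.

Lemma L2D f g : L2 f -> L2 g -> L2 (fun x => (f x + g x)%R).
Proof.
move=> Lf Lg; split; first by case: Lf Lg => mf _ [mg _]; meas.
apply: le_lt_trans (sqintD Lf Lg) _.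
by apply: lte_add_pinfty; rewrite lte_mul_pinfty// ?(proj2 Lf) ?(proj2 Lg).
Qed.

Lemma L2Z (c : R) f : L2 f -> L2 (fun x => (c * f x)%R).
Proof.
move=> Lf; split; first by case: Lf => mf _; meas.
by rewrite sqintZ// lte_mul_pinfty// ?lee_fin ?sqr_ge0// (proj2 Lf).
Qed.

Lemma L2N f : L2 f -> L2 (fun x => (- f x)%R).
Proof.
move=> /(L2Z (-1)); congr (L2 _); apply/funext => x; exact: mulN1r.
Qed.

Lemma L2B f g : L2 f -> L2 g -> L2 (fun x => (f x - g x)%R).
Proof. by move=> Lf Lg; apply: L2D => //; exact: L2N. Qed.

Lemma L2_0 : L2 (fun=> 0%R).
Proof.
split; first exact: measurable_cst.
by rewrite /sqint; under eq_integral do rewrite expr0n; rewrite integral0.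
Qed.

Lemma L2_sum (I : Type) (s : seq I) (F : I -> T -> R) :
  (forall i, L2 (F i)) -> L2 (fun x => \sum_(i <- s) F i x)%R.
Proof.
move=> h; elim: s => [|i s ih].
  by under eq_fun do rewrite big_nil; exact: L2_0.
by under eq_fun do rewrite big_cons; exact: L2D.
Qed.

End square_integrable.

(** * Integrals depending on a parameter, and Fubini's theorem for real-valued integrals *)

Section Rintegral_param.
Context d1 d2 (X : measurableType d1) (Y : measurableType d2) (R : realType).
Variables (m2 : {sigma_finite_measure set Y -> \bar R}).
Local Open Scope ereal_scope.

(** No integrability is assumed: Tonelli is applied to the positive and the negative part, so ball
    averages of any measurable function are measurable. *)
Lemma measurable_integral_param (f : X * Y -> \bar R) : measurable_fun setT f ->
  measurable_fun setT (fun x => \int[m2]_y f (x, y)).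
Proof.
move=> mf.
rewrite (_ : (fun x => _) = (fun x => \int[m2]_y f^\+ (x, y) - \int[m2]_y f^\- (x, y))); last first.
  apply/funext => x; rewrite integralE.
  by congr (_ - _); apply: eq_integral => y _; rewrite (funepos_comp, funeneg_comp).
apply: emeasurable_funB.
- by apply: (measurable_fun_fubini_tonelli_F (f^\+)) => //; exact: measurable_funepos.
- by apply: (measurable_fun_fubini_tonelli_F (f^\-)) => //; exact: measurable_funeneg.
Qed.

Lemma measurable_Rintegral_param (f : X -> Y -> R) (D : set Y) : measurable D ->
  measurable_fun setT (fun p : X * Y => f p.1 p.2) ->
  measurable_fun setT (fun x => Rintegral m2 D (f x)).
Proof.
move=> mD mf.
apply: (@measurableT_comp _ _ _ _ _ _ (@fine R)); first exact: fine_measurable.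
rewrite (_ : (fun x => _) = (fun x => \int[m2]_y (\1_D y * f x y)%:E)); last first.
  apply/funext => x; rewrite integral_mkcond; apply: eq_integral => y _.
  rewrite /patch indicE; case: ifPn => _; by rewrite ?mul1r ?mul0r.
apply: (measurable_integral_param (f := fun p => (\1_D p.2 * f p.1 p.2)%:E)).
apply/measurable_EFinP; apply: measurable_funM => //.
apply: measurableT_comp => //; exact: measurable_indic.
Qed.

End Rintegral_param.

Lemma integral_indic_mkcond d (T : measurableType d) (R : realType)
    (mu : {measure set T -> \bar R}) (D : set T) (f : T -> R) :
  (\int[mu]_(x in D) (f x)%:E = \int[mu]_x (\1_D x * f x)%:E)%E.
Proof.
rewrite integral_mkcond; apply: eq_integral => x _.
by rewrite /patch indicE; case: ifPn => _; rewrite ?mul1r ?mul0r.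
Qed.

Lemma Rintegral_indic_mkcond d (T : measurableType d) (R : realType)
    (mu : {measure set T -> \bar R}) (D : set T) (f : T -> R) :
  Rintegral mu D f = Rintegral mu setT (fun x => \1_D x * f x).
Proof. by rewrite /Rintegral integral_indic_mkcond. Qed.

Section Rfubini.
Context d1 d2 (X : measurableType d1) (Y : measurableType d2) (R : realType).
Variables (m1 : {sigma_finite_measure set X -> \bar R}).
Variables (m2 : {sigma_finite_measure set Y -> \bar R}).

Lemma Rintegral_fubini (f : X -> Y -> R) :
  measurable_fun setT (fun p : X * Y => f p.1 p.2) ->
  (\int[m1]_x \int[m2]_y `|f x y|%:E < +oo)%E ->
  Rintegral m1 setT (fun x => Rintegral m2 setT (f x)) =
  Rintegral m2 setT (fun y => Rintegral m1 setT (f^~ y)).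
Proof.
move=> mf foo; pose F (p : X * Y) := (f p.1 p.2)%:E.
have mF : measurable_fun setT F by exact/measurable_EFinP.
have iF : (m1 \x m2)%E.-integrable setT F by apply/(integrable12ltyP m1 m2 mF).
have mF' : measurable_fun setT (fun p : Y * X => F (p.2, p.1)).
  by apply: (measurableT_comp mF); exact: measurable_swap.
(* The inner integral is finite only for almost every x; taking [fine] changes the outer integrand
   on a null set. *)
have e1 : (\int[m1]_x (fine (\int[m2]_y F (x, y)))%:E = \int[m1]_x \int[m2]_y F (x, y))%E.
  apply: ae_eq_integral => //.
  - apply/measurable_EFinP; apply: measurableT_comp; first exact: fine_measurable.
    exact: measurable_integral_param.
  - exact: measurable_integral_param.
  - have [N [mN N0 hN]] := ae_integrable1 iF.
    exists N; split => // x /= h; apply: hN => /= ix; apply: h => _.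
    by rewrite fineK// integrable_fin_num.
have e2 : (\int[m2]_y (fine (\int[m1]_x F (x, y)))%:E = \int[m2]_y \int[m1]_x F (x, y))%E.
  apply: ae_eq_integral => //.
  - apply/measurable_EFinP; apply: measurableT_comp; first exact: fine_measurable.
    exact: (@measurable_integral_param _ _ _ _ _ m1 (fun p => F (p.2, p.1)) mF').
  - exact: (@measurable_integral_param _ _ _ _ _ m1 (fun p => F (p.2, p.1)) mF').
  - have [N [mN N0 hN]] := ae_integrable2 iF.
    exists N; split => // x /= h; apply: hN => /= ix; apply: h => _.
    by rewrite fineK// integrable_fin_num.
by rewrite /Rintegral; congr fine; rewrite e1 e2; exact: Fubini.
Qed.

End Rfubini.

Section ball_average.
Context {R : realType} {n : nat}.
Local Notation V := (Rn R n).
Local Notation mu := (lebesgue_Rn n : {sigma_finite_measure set V -> \bar R}).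
Implicit Types (u v : V -> R) (x y z : V) (r k l : R).

Definition vball r : R := vol_ball n * r ^+ n.

Lemma vball_gt0 r : 0 < r -> 0 < vball r.
Proof. by move=> r0; rewrite mulr_gt0 ?vol_ball_gt0 ?exprn_gt0. Qed.

(** The mean of u over the ball of radius k r around x. With the scale k inside, the means for k =
    1..m come from one integration over y and assemble into the mean of a finite difference. *)
Definition ballavg r k u x : R :=
  (vball r)^-1 * Rintegral mu (ballRn n r) (fun y => u (x + k *: y)).

Local Open Scope ereal_scope.

Lemma sqint_shift u (a : V) : measurable_fun setT u ->
  sqint mu (fun x => u (x + a)%R) = sqint mu u.
Proof.
move=> mu_; apply: (ge0_integral_shift a (f := fun x => (u x ^+ 2)%:E)); first by meas.
by move=> x; rewrite lee_fin sqr_ge0.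
Qed.

Lemma L2_shift u (a : V) : L2 mu u -> L2 mu (fun x => u (x + a)%R).
Proof. by move=> [mu_ u2]; split; [meas|rewrite sqint_shift]. Qed.

Lemma integral_affine_ball_le (f : V -> R) r k x : (0 < k)%R -> measurable_fun setT f ->
  (forall x, 0 <= f x)%R ->
  \int[mu]_(y in ballRn n r) (f (x + k *: y)%R)%:E <= (k^-1 ^+ n)%:E * \int[mu]_y (f y)%:E.
Proof.
move=> k0 mf f0; rewrite -(ge0_integral_shift x (f := fun z => (f z)%:E)); [|by meas|by []].
have mg : measurable_fun setT (fun z : V => (f (z + x)%R)%:E) by meas.
rewrite -(ge0_integral_dilation k0 mg); last by move=> y; rewrite lee_fin.
under eq_integral do rewrite addrC.
apply: ge0_subset_integral => //; [exact: measurable_ballRn|by meas|].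
by move=> y _; rewrite lee_fin.
Qed.

Lemma ballavg_integrable r k u x : (0 < k)%R -> L2 mu u ->
  mu.-integrable (ballRn n r) (EFin \o (fun y => u (x + k *: y)%R)).
Proof.
move=> k0 [mu_ u2]; apply: integrable_sqr_on.
- exact: measurable_ballRn.
- exact: lebesgue_ballRn_lty.
- by apply: measurable_funTS; meas.
apply: le_lt_trans (integral_affine_ball_le r x k0 (f := fun z => (u z ^+ 2)%R) _ _) _.
- by meas.
- by move=> y; rewrite sqr_ge0.
by rewrite lte_mul_pinfty// lee_fin exprn_ge0// invr_ge0 ltW.
Qed.

(** Jensen's inequality for each x, then Tonelli. Applied to translates of u it bounds ball averages
    on L^2; applied to finite differences it bounds u - A_r u. *)
Lemma sqint_ball_mean_le (F : V -> V -> R) r (M : \bar R) : (0 < r)%R ->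
  measurable_fun setT (fun p : V * V => F p.1 p.2) -> 0 <= M ->
  (forall y, ballRn n r y -> sqint mu (F^~ y) <= M) ->
  sqint mu (fun x => (vball r)^-1 * Rintegral mu (ballRn n r) (F x))%R <= M.
Proof.
move=> r0 mF M0 FM.
have mB := @measurable_ballRn R n r.
have vr := vball_gt0 r0.
have mF1 x : measurable_fun setT (F x) by exact: (measurable_fun_pair2 x mF).
have mF2 y : measurable_fun setT (F^~ y) by exact: (measurable_fun_pair1 y mF).
have mH : measurable_fun setT (fun p : V * V => (\1_(ballRn n r) p.2 * F p.1 p.2 ^+ 2)%:E).
  by apply/measurable_EFinP; apply: measurable_funM; [meas|exact: measurable_funX].
have H0 (p : V * V) : 0 <= (\1_(ballRn n r) p.2 * F p.1 p.2 ^+ 2)%:E.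
  by rewrite lee_fin mulr_ge0// sqr_ge0.
apply: (@le_trans _ _ (\int[mu]_x ((vball r)^-1%:E * \int[mu]_y (\1_(ballRn n r) y * F x y ^+ 2)%:E))).
  apply: ge0_le_integral => //.
  - by move=> x _; rewrite lee_fin sqr_ge0.
  - apply/measurable_EFinP; apply: measurable_funX; apply: measurable_funM => //.
    exact: measurable_Rintegral_param.
  - by apply: measurable_funeM; exact: (measurable_fun_fubini_tonelli_F _ mH).
  - move=> x _; rewrite -integral_indic_mkcond; apply: sqr_mean_le => //.
    + exact: lebesgue_ballRn.
    + exact: measurable_funTS.
rewrite ge0_integralZl//; last 3 first.
- exact: (measurable_fun_fubini_tonelli_F _ mH).
- by move=> x _; apply: integral_ge0 => y _; exact: (H0 (x, y)).
- by rewrite lee_fin invr_ge0 ltW.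
rewrite (fubini_tonelli _ mH)//=.
apply: (@le_trans _ _ ((vball r)^-1%:E * \int[mu]_y ((\1_(ballRn n r) y)%:E * M))).
  apply: lee_wpmul2l; first by rewrite lee_fin invr_ge0 ltW.
  apply: ge0_le_integral => //.
  - by move=> y _; apply: integral_ge0 => x _; exact: (H0 (x, y)).
  - exact: (measurable_fun_fubini_tonelli_G _ mH).
  - apply: emeasurable_funM => //; meas.
  - move=> y _; under eq_integral do rewrite EFinM.
    rewrite ge0_integralZl//; last 2 first.
    + by apply/measurable_EFinP; exact: measurable_funX.
    + by move=> x _; rewrite lee_fin sqr_ge0.
    rewrite indic_ballRnE; case: ltP => yr; last by rewrite !mul0e.
    by rewrite !mul1e; exact: FM.
rewrite ge0_integralZr//; last by meas.
have -> : \int[mu]_y (\1_(ballRn n r) y)%:E = (vball r)%:E.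
  by rewrite integral_indic// setIT; exact: lebesgue_ballRn.
by rewrite muleA -EFinM mulVf ?gt_eqF// mul1e.
Qed.

Lemma ballavg_sqr_le r k u x : (0 < r)%R -> measurable_fun setT u ->
  ((ballavg r k u x) ^+ 2)%:E <=
  (vball r)^-1%:E * \int[mu]_(y in ballRn n r) (u (x + k *: y)%R ^+ 2)%:E.
Proof.
move=> r0 mu_; apply: sqr_mean_le.
- exact: measurable_ballRn.
- exact: lebesgue_ballRn.
- exact: vball_gt0.
- by apply: measurable_funTS; meas.
Qed.

Lemma measurable_ballavg r k u : measurable_fun setT u -> measurable_fun setT (ballavg r k u).
Proof.
move=> mu_; apply: measurable_funM => //.
apply: (@measurable_Rintegral_param _ _ _ _ _ _ (fun x y => u (x + k *: y)%R)); first exact: measurable_ballRn.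
by meas.
Qed.

Lemma sqint_ballavg r k u : (0 < r)%R -> measurable_fun setT u ->
  sqint mu (ballavg r k u) <= sqint mu u.
Proof.
move=> r0 mu_; apply: (sqint_ball_mean_le (F := fun x y => u (x + k *: y)%R)) => //.
- by meas.
- exact: sqint_ge0.
- by move=> y _; rewrite sqint_shift.
Qed.

Lemma L2_ballavg r k u : (0 < r)%R -> L2 mu u -> L2 mu (ballavg r k u).
Proof.
move=> r0 [mu_ u2]; split; first exact: measurable_ballavg.
exact: le_lt_trans (sqint_ballavg _ r0 mu_) u2.
Qed.

Lemma ballavgD r k u v x : (0 < k)%R -> L2 mu u -> L2 mu v ->
  ballavg r k (fun x => u x + v x)%R x = (ballavg r k u x + ballavg r k v x)%R.
Proof.
move=> k0 Lu Lv; rewrite /ballavg RintegralD; [exact: mulrDr|exact: measurable_ballRn|..].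
- exact: ballavg_integrable.
- exact: ballavg_integrable.
Qed.

Lemma ballavgZ r k (c : R) u x : (0 < k)%R -> L2 mu u ->
  ballavg r k (fun x => c * u x)%R x = (c * ballavg r k u x)%R.
Proof.
move=> k0 Lu; rewrite /ballavg RintegralZl; [exact: mulrCA|exact: measurable_ballRn|].
exact: ballavg_integrable.
Qed.

Lemma ballavg_sum r k (I : Type) (s : seq I) (F : I -> V -> R) x : (0 < k)%R ->
  (forall i, L2 mu (F i)) ->
  ballavg r k (fun x => \sum_(i <- s) F i x)%R x = (\sum_(i <- s) ballavg r k (F i) x)%R.
Proof.
move=> k0 LF; elim: s => [|i s ih].
  rewrite big_nil /ballavg; under eq_Rintegral do rewrite big_nil.
  by rewrite Rintegral_cst ?mul0r ?mulr0//; exact: measurable_ballRn.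
rewrite big_cons -ih -ballavgD//; last exact: L2_sum.
by congr (ballavg r k _ x); apply/funext => y; rewrite big_cons.
Qed.

(** Fubini on the product of the two balls. As u is only square integrable, integrability over the
    product comes from |u| <= 1 + u^2, whose integral in z is bounded uniformly in y. *)
Lemma ballavgC r (s : R) k l u x : (0 < r)%R -> (0 < s)%R -> (0 < k)%R -> (0 < l)%R -> L2 mu u ->
  ballavg r k (ballavg s l u) x = ballavg s l (ballavg r k u) x.
Proof.
move=> r0 s0 k0 l0 Lu.
have mB t := @measurable_ballRn R n t.
have mu_ := Lu.1.
suff E : Rintegral mu (ballRn n r) (fun y => Rintegral mu (ballRn n s) (fun z => u (x + k *: y + l *: z)%R)) =
  Rintegral mu (ballRn n s) (fun z => Rintegral mu (ballRn n r) (fun y => u (x + l *: z + k *: y)%R)).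
  have h (a b e f : R) w : (0 < a)%R -> (0 < b)%R -> (0 < e)%R -> (0 < f)%R ->
    ballavg a e (ballavg b f u) w = ((vball a)^-1 * ((vball b)^-1 *
      Rintegral mu (ballRn n a) (fun y => Rintegral mu (ballRn n b) (fun z => u (w + e *: y + f *: z)%R))))%R.
    move=> a0 b0 e0 f0; rewrite {1}/ballavg; congr (_ * _)%R.
    rewrite -RintegralZl; [by []|exact: mB|].
    have := @ballavg_integrable a e (fun y => Rintegral mu (ballRn n b) (fun z => u (y + f *: z)%R)) w e0.
    apply; have := L2Z (vball b) (L2_ballavg f b0 Lu); congr (L2 _ _).
    apply/funext => y; rewrite /ballavg; set I1 := Rintegral _ _ _.
    have vb : vball b != 0%R by rewrite gt_eqF ?vball_gt0.
    by rewrite mulrA divff ?vb; [exact: mul1r|].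
  rewrite (h _ _ _ _ _ r0 s0 k0 l0) (h _ _ _ _ _ s0 r0 l0 k0) E.
  set I1 := Rintegral _ _ _; exact: mulrCA.
under eq_Rintegral do rewrite Rintegral_indic_mkcond.
rewrite Rintegral_indic_mkcond.
under [RHS]eq_Rintegral do rewrite Rintegral_indic_mkcond.
rewrite [RHS]Rintegral_indic_mkcond.
pose f (y z : V) : R := (\1_(ballRn n r) y * (\1_(ballRn n s) z * u (x + k *: y + l *: z)))%R.
have mf : measurable_fun setT (fun p : V * V => f p.1 p.2) by rewrite /f; meas.
have B01 (t : R) y : (0 <= \1_(ballRn n t) y :> R)%R by rewrite indic_ballRnE.
have int1 (t : R) (w : V) (h : V -> R) : Rintegral mu setT (fun z => \1_(ballRn n t) w * h z)%R =
   (\1_(ballRn n t) w * Rintegral mu setT h)%R.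
  rewrite indic_ballRnE; case: ltP => _.
    by rewrite mul1r; apply: eq_Rintegral => z _; rewrite mul1r.
  by rewrite mul0r; under eq_Rintegral do rewrite mul0r; rewrite Rintegral_cst// mul0r.
transitivity (Rintegral mu setT (fun y => Rintegral mu setT (f y))).
  by apply: eq_Rintegral => y _; rewrite int1.
rewrite Rintegral_fubini//.
  apply: eq_Rintegral => z _; rewrite -int1; apply: eq_Rintegral => y _.
  by rewrite /f mulrCA addrAC.
have C0 : (l^-1 ^+ n)%:E * \int[mu]_y (u y ^+ 2)%:E < +oo.
  by rewrite lte_mul_pinfty ?(proj2 Lu)// lee_fin exprn_ge0// invr_ge0 ltW.
pose C := (vball s)%:E + (l^-1 ^+ n)%:E * \int[mu]_y (u y ^+ 2)%:E.
have Cge : 0 <= C.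
  rewrite adde_ge0// ?lee_fin ?(ltW (vball_gt0 _))// mule_ge0 ?sqint_ge0//.
  by rewrite lee_fin exprn_ge0// invr_ge0 ltW.
apply: (@le_lt_trans _ _ (\int[mu]_y ((\1_(ballRn n r) y)%:E * C))).
  have mf' : measurable_fun setT (fun p : V * V => `|f p.1 p.2|%:E).
    by apply/measurable_EFinP; exact: measurableT_comp.
  apply: ge0_le_integral => //.
  - by move=> y _; apply: integral_ge0.
  - exact: (measurable_fun_fubini_tonelli_F _ mf').
  - by apply: emeasurable_funM => //; meas.
  move=> y _; under eq_integral do rewrite normrM EFinM.
  rewrite ge0_integralZl//; last first.
    by apply/measurable_EFinP; apply: measurableT_comp => //; meas.
  rewrite ger0_norm//; apply: lee_wpmul2l; first by rewrite lee_fin.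
  apply: (@le_trans _ _ (\int[mu]_z ((\1_(ballRn n s) z)%:E + (\1_(ballRn n s) z * (u (x + k *: y + l *: z)) ^+ 2)%:E))).
    apply: ge0_le_integral => //.
    - by apply/measurable_EFinP; apply: measurableT_comp => //; meas.
    - by meas.
    - move=> z _; rewrite -EFinD lee_fin normrM ger0_norm// -[X in (_ <= X + _)%R]mulr1 -mulrDr.
      apply: ler_wpM2l => //; set a := u _.
      by have := sqr_ge0 (`|a| - 1)%R; rewrite -(real_normK (num_real a)); nra.
  rewrite ge0_integralD//; last 3 first.
  - by meas.
  - by move=> z _; rewrite lee_fin mulr_ge0// sqr_ge0.
  - by meas.
  apply: leeD.
    rewrite le_eqVlt; apply/orP; left; apply/eqP; rewrite integral_indic// setIT.
    exact: lebesgue_ballRn.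
  rewrite -integral_indic_mkcond; apply: (integral_affine_ball_le _ _ l0 (f := fun z => (u z ^+ 2)%R)); first by meas.
  by move=> z; rewrite sqr_ge0.
rewrite ge0_integralZr//; last by meas.
have -> : \int[mu]_y (\1_(ballRn n r) y)%:E = (vball r)%:E.
  by rewrite integral_indic// setIT; exact: lebesgue_ballRn.
by rewrite lte_mul_pinfty// ?lee_fin ?(ltW (vball_gt0 _))// lte_add_pinfty// ltry.
Qed.

End ball_average.

(** * Radial decay of ball averages *)

Section radial_bound.
Context {R : realType} {n : nat}.
Local Notation V := (Rn R n).
Local Notation mu := (lebesgue_Rn n : {sigma_finite_measure set V -> \bar R}).
Implicit Types (u v h : V -> R) (x y z a : V) (r k l : R).
Local Open Scope ereal_scope.

Lemma integral_reflect a (f : V -> \bar R) : measurable_fun setT f ->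
  \int[mu]_x f (reflectRn a x) = \int[mu]_x f x.
Proof.
move=> mf; rewrite integralE [RHS]integralE; congr (_ - _).
- rewrite -(ge0_integral_reflect a (f := f^\+))//; last exact: measurable_funepos.
  by apply: eq_integral => x _; rewrite funepos_comp.
- rewrite -(ge0_integral_reflect a (f := f^\-))//; last exact: measurable_funeneg.
  by apply: eq_integral => x _; rewrite funeneg_comp.
Qed.

(** The form in which radial symmetry enters the real estimates. The exceptional null set may depend
    on a, as befits classes modulo equality almost everywhere. *)
Definition reflect_invariant u :=
  forall a, {ae mu, forall x, u (reflectRn a x) = u x}.

(** The centre x sits in the integrand and not in the domain of integration, so that the integrand
    is jointly measurable in (x, z) and Tonelli applies. *)
Definition local_mass r h x := \int[mu]_z ((enorm (z - x) < r)%R%:R * h z ^+ 2)%:E.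

Lemma measurable_enorm_lt d (T : measurableType d) (f : T -> V) r :
  measurable_fun setT f -> measurable_fun setT (fun t => (enorm (f t) < r)%R%:R : R).
Proof.
move=> mf; rewrite (_ : (fun _ => _) = fun t => \1_(ballRn n r) (f t) : R); first by meas.
by apply/funext => t; rewrite indic_ballRnE.
Qed.

Lemma local_mass_reflect r h a x : measurable_fun setT h -> reflect_invariant h ->
  local_mass r h (reflectRn a x) = local_mass r h x.
Proof.
move=> mh hinv; rewrite /local_mass.
have mE w : measurable_fun setT (fun z => ((enorm (z - w) < r)%R%:R * h z ^+ 2)%:E).
  apply/measurable_EFinP; apply: measurable_funM; last by meas.
  by apply: measurable_enorm_lt; meas.
rewrite -(integral_reflect a)//.
apply: ae_eq_integral => //.
- by apply: (measurableT_comp (mE _)); exact: measurable_reflectRn.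
- have [N [mN N0 hN]] := hinv a.
  exists N; split => // z /= hz; apply: hN => /= e; apply: hz => _.
  rewrite e; congr ((_ < _)%R%:R * _)%:E.
  by rewrite -[in RHS](enorm_reflectRn a) reflectRnD reflectRnN.
Qed.

Lemma local_mass_le_sqint r h x : measurable_fun setT h -> local_mass r h x <= sqint mu h.
Proof.
move=> mh; apply: ge0_le_integral => //.
- by move=> z _; rewrite lee_fin mulr_ge0// sqr_ge0.
- apply/measurable_EFinP; apply: measurable_funM; last by meas.
  by apply: measurable_enorm_lt; meas.
- by meas.
- by move=> z _; rewrite lee_fin ler_piMl// ?sqr_ge0//; case: (_ < _)%R.
Qed.

(** By Tonelli, each mass element h z ^ 2 is counted with the measure of the set of centres within r
    of z, at most the volume of a ball of radius r. *)
Lemma integral_local_mass_le (A : set V) r h : (0 < r)%R -> measurable A -> measurable_fun setT h ->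
  \int[mu]_(z in A) local_mass r h z <= (@vball R n r)%:E * sqint mu h.
Proof.
move=> r0 mA mh.
have mH : measurable_fun setT (fun p : V * V => ((enorm (p.2 - p.1) < r)%R%:R * h p.2 ^+ 2)%:E).
  apply/measurable_EFinP; apply: measurable_funM; last by meas.
  by apply: measurable_enorm_lt; meas.
have H0 (p : V * V) : 0 <= ((enorm (p.2 - p.1) < r)%R%:R * h p.2 ^+ 2)%:E.
  by rewrite lee_fin mulr_ge0// sqr_ge0.
have mF : measurable_fun setT (local_mass r h).
  exact: (measurable_fun_fubini_tonelli_F (m2 := mu) _ mH H0).
apply: (@le_trans _ _ (\int[mu]_z local_mass r h z)).
  apply: ge0_subset_integral => //.
  by move=> z _; apply: integral_ge0 => w _; exact: (H0 (z, w)).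
rewrite /local_mass (fubini_tonelli _ mH H0)/=.
rewrite -ge0_integralZl//; last 3 first.
- by meas.
- by move=> z _; rewrite lee_fin sqr_ge0.
- by rewrite lee_fin ltW// vball_gt0.
apply: ge0_le_integral => //.
- by move=> z _; apply: integral_ge0 => w _; exact: (H0 (w, z)).
- exact: (measurable_fun_fubini_tonelli_G _ mH).
- by apply: measurable_funeM; meas.
move=> z _; under eq_integral do rewrite EFinM.
rewrite ge0_integralZr//; [|by apply/measurable_EFinP; apply: measurable_enorm_lt; meas
  |by rewrite lee_fin sqr_ge0].
apply: lee_wpmul2r; first by rewrite lee_fin sqr_ge0.
rewrite -(lebesgue_ballRn n r0) -[X in _ <= lebesgue_Rn n X]setIT -integral_indic//; last exact: measurable_ballRn.
rewrite -(ge0_integral_shift z)//; last by apply/measurable_EFinP; apply: measurable_enorm_lt; meas.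
rewrite le_eqVlt; apply/orP; left; apply/eqP; apply: eq_integral => w _.
by rewrite indic_ballRnE -enormN opprB addrK.
Qed.

(** Since (rho + r)^(n-1) >= rho^(n-1), one has (rho + r)^n - rho^n >= r rho^(n-1). The power n - 1
    of all radial bounds originates here. *)
Lemma annulus_volume_ge rho r : (0 < n)%N -> (0 < rho)%R -> (0 < r)%R ->
  measurable [set z : V | (rho <= enorm z < rho + r)%R] /\
  (vol_ball n * (r * rho ^+ n.-1))%:E <= mu [set z : V | (rho <= enorm z < rho + r)%R].
Proof.
move=> n0 rho0 r0; set A := [set z | _].
have AE : A = ballRn n (rho + r) `\` ballRn n rho.
  apply/seteqP; split => z /=; rewrite /ballRn/=.
    by move=> /andP[h1 h2]; split => //; apply/negP; rewrite -leNgt.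
  by move=> [h1 /negP]; rewrite -leNgt => h2; apply/andP.
have mA : measurable A by rewrite AE; apply: measurableD; exact: measurable_ballRn.
split => //.
have : mu (ballRn n (rho + r)%R) = mu (ballRn n rho) + mu A.
  rewrite -measureU//; last 2 first.
  - exact: measurable_ballRn.
  - by rewrite AE setDIK.
  rewrite AE setDUK// => z; rewrite /ballRn/= => zr.
  by apply: lt_trans zr _; rewrite ltrDl.
rewrite (lebesgue_ballRn n (addr_gt0 rho0 r0)) (lebesgue_ballRn n rho0) => e.
have Afin : mu A \is a fin_num.
  rewrite ge0_fin_numE//; apply: le_lt_trans (lebesgue_ballRn_lty n (rho + r)%R).
  by apply: le_measure; rewrite ?inE//; [exact: measurable_ballRn|rewrite AE; exact: subDsetl].
move: e; rewrite -(fineK Afin) -EFinD => -[e]; rewrite lee_fin.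
suff : (vol_ball n * (r * rho ^+ n.-1) <= vol_ball n * (rho + r) ^+ n - vol_ball n * rho ^+ n :> R)%R.
  by rewrite e; lra.
rewrite -mulrBr ler_pM2l ?vol_ball_gt0//.
have E (t : R) : (t ^+ n = t * t ^+ n.-1)%R by rewrite -exprS prednK.
rewrite !E; have : (rho ^+ n.-1 <= (rho + r) ^+ n.-1)%R by rewrite lerXn2r ?nnegrE ?addr_ge0 ?ltW// ltrDl.
by nra.
Qed.

(* A reflection invariant h has the same local mass at all points of a sphere, so the
   local mass at x is at most its mean over an annulus through x of width r. *)
Lemma local_mass_radial r h x (M : R) : (0 < n)%N -> (0 < r)%R -> (r <= enorm x)%R ->
  measurable_fun setT h -> reflect_invariant h -> sqint mu h <= M%:E ->
  local_mass r h x * (enorm x ^+ n.-1)%:E <= (2 ^+ n * r ^+ n.-1 * M)%:E.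
Proof.
move=> n0 r0 rx mh hinv hM.
have rho0 : (0 < enorm x)%R by exact: lt_le_trans rx.
have [mA Avol] := annulus_volume_ge n0 rho0 r0; set A := [set z | _] in mA Avol.
have lm0 : 0 <= local_mass r h x.
  by apply: integral_ge0 => z _; rewrite lee_fin mulr_ge0// sqr_ge0.
have key z : A z -> local_mass r h x <= local_mass (2 * r)%R h z.
  move=> /andP[xz zx]; have z0 : (0 < enorm z)%R by exact: lt_le_trans xz.
  (* The radial projection of z to the sphere through x. As |x' - z| = |z| - |x| < r, the ball of
     radius r around x' lies in the ball of radius 2 r around z; the reflection along x - x' carries
     x to x'. *)
  pose x' := ((enorm x / enorm z) *: z)%R.
  have x'E : enorm x' = enorm x.
    by rewrite enormZ ger0_norm ?divr_ge0 ?enorm_ge0// mulfVK// gt_eqF.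
  have zx' : (enorm (x' - z) < r)%R.
    rewrite /x' -[X in (_ - X)%R]scale1r -scalerBl enormZ.
    have -> : (enorm x / enorm z - 1 = (enorm x - enorm z) / enorm z)%R by field; rewrite gt_eqF.
    rewrite normrM normfV (ger0_norm (enorm_ge0 z)) mulfVK ?gt_eqF//.
    by rewrite ler0_norm ?subr_le0//; lra.
  rewrite -(local_mass_reflect r (x - x')%R x mh hinv) reflectRn_swap//.
  have mE (e : R) (w : V) : measurable_fun setT (fun z => ((enorm (z - w) < e)%R%:R * h z ^+ 2)%:E).
    apply/measurable_EFinP; apply: measurable_funM; last by meas.
    by apply: measurable_enorm_lt; meas.
  apply: ge0_le_integral => //.
  - by move=> w _; rewrite lee_fin mulr_ge0// sqr_ge0.
  - move=> w _; rewrite lee_fin ler_wpM2r ?sqr_ge0// ler_nat.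
    case: (ltP (enorm (w - x')%R)) => // wx'; suff -> : (enorm (w - z) < 2 * r)%R by [].
    have -> : (w - z = (w - x') + (x' - z))%R by rewrite addrA subrK.
    by apply: le_lt_trans (enormD _ _) _; lra.
have h1 : local_mass r h x * mu A <= (@vball R n (2 * r))%:E * sqint mu h.
  apply: le_trans (integral_local_mass_le _ mA mh); last by rewrite mulr_gt0.
  rewrite -integral_cst//; apply: ge0_le_integral => //.
  - have mH : measurable_fun setT (fun p : V * V => ((enorm (p.2 - p.1) < 2 * r)%R%:R * h p.2 ^+ 2)%:E).
      apply/measurable_EFinP; apply: measurable_funM; last by meas.
      by apply: measurable_enorm_lt; meas.
    apply: measurable_funTS; apply: (measurable_fun_fubini_tonelli_F _ mH) => p.
    by rewrite lee_fin mulr_ge0// sqr_ge0.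
have h2 : local_mass r h x * (vol_ball n * (r * enorm x ^+ n.-1))%:E <= (@vball R n (2 * r))%:E * M%:E.
  apply: le_trans (lee_wpmul2l lm0 Avol) _; apply: le_trans h1 _.
  by apply: lee_wpmul2l => //; rewrite lee_fin ltW// vball_gt0// mulr_gt0.
have v0 := vol_ball_gt0 (R := R) n.
rewrite -(@lee_pmul2l _ (vol_ball n * r)%:E)// ?lte_fin ?mulr_gt0//.
have -> : (vol_ball n * r)%:E * (local_mass r h x * (enorm x ^+ n.-1)%:E) =
    local_mass r h x * (vol_ball n * (r * enorm x ^+ n.-1))%:E.
  by rewrite muleCA -EFinM mulrA.
apply: le_trans h2 _.
rewrite -!EFinM lee_fin /vball le_eqVlt; apply/orP; left; apply/eqP.
have E (t : R) : (t ^+ n = t * t ^+ n.-1)%R by rewrite -exprS prednK.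
by rewrite !E exprMn; ring.
Qed.

Lemma ballavg_le_local_mass r k h x : (0 < r)%R -> (0 < k)%R -> measurable_fun setT h ->
  ((ballavg r k h x) ^+ 2)%:E <= (@vball R n (k * r))^-1%:E * local_mass (k * r) h x.
Proof.
move=> r0 k0 mh; apply: le_trans (ballavg_sqr_le k x r0 mh) _.
rewrite integral_indic_mkcond /local_mass.
pose g w : \bar R := ((enorm w < k * r)%R%:R * h (w + x)%R ^+ 2)%:E.
have mg : measurable_fun setT g.
  apply/measurable_EFinP; apply: measurable_funM; last by meas.
  by apply: measurable_enorm_lt; meas.
have -> : \int[mu]_y (\1_(ballRn n r) y * h (x + k *: y)%R ^+ 2)%:E = \int[mu]_y g (k *: y)%R.
  apply: eq_integral => y _; rewrite /g indic_ballRnE enormZ gtr0_norm// addrC.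
  by rewrite ltr_pM2l.
have -> : \int[mu]_z ((enorm (z - x) < k * r)%R%:R * h z ^+ 2)%:E = \int[mu]_y g y.
  rewrite -(ge0_integral_shift (- x)%R (f := g))//.
    by apply: eq_integral => y _; rewrite /g subrK.
  by move=> y; rewrite lee_fin mulr_ge0// sqr_ge0.
rewrite ge0_integral_dilation//; last by move=> y; rewrite lee_fin mulr_ge0// sqr_ge0.
rewrite muleA -EFinM /vball exprMn exprVn.
rewrite (_ : (_ * _)%R = (vol_ball n * (k ^+ n * r ^+ n))^-1%R)//.
by rewrite !invfM; ring.
Qed.

End radial_bound.

Section sqint_more.
Context d (T : measurableType d) (R : realType) (mu : {measure set T -> \bar R}).
Local Open Scope ereal_scope.

Lemma sqint_sum_le (I : Type) (s : seq I) (F : I -> T -> R) :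
  (forall i, L2 mu (F i)) ->
  sqint mu (fun x => \sum_(i <- s) F i x)%R <=
  (2 ^+ size s)%:E * \sum_(i <- s) sqint mu (F i).
Proof.
move=> LF; elim: s => [|i s ih] /=.
  rewrite big_nil mule0 /sqint.
  under eq_integral do rewrite big_nil expr0n.
  by rewrite integral0.
under [X in sqint _ X]eq_fun do rewrite big_cons.
apply: le_trans (sqintD (LF i) (L2_sum s LF)) _.
have S0 : 0 <= \sum_(j <- s) sqint mu (F j) by apply: sume_ge0 => j _; exact: sqint_ge0.
rewrite big_cons (ge0_muleDr _ (sqint_ge0 mu (F i)) S0).
apply: leeD.
  apply: lee_wpmul2r; first exact: sqint_ge0.
  by rewrite lee_fin -[leLHS]expr1 ler_weXn2l// ler1n.
rewrite exprS EFinM -muleA; exact: lee_wpmul2l.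
Qed.

Lemma integrable_sum_fun D (I : Type) (s : seq I) (F : I -> T -> R) :
  measurable D -> (forall i, mu.-integrable D (EFin \o F i)) ->
  mu.-integrable D (EFin \o (fun x => \sum_(i <- s) F i x)%R).
Proof.
move=> mD iF; elim: s => [|i s ih].
  rewrite (_ : _ \o _ = cst 0); first exact: integrable0.
  by apply/funext => x /=; rewrite big_nil.
rewrite (_ : _ \o _ = (EFin \o F i) \+ (EFin \o (fun x => \sum_(i <- s) F i x)%R)).
  exact: integrableD.
by apply/funext => x /=; rewrite big_cons EFinD.
Qed.

Lemma Rintegral_sum D (I : Type) (s : seq I) (F : I -> T -> R) :
  measurable D -> (forall i, mu.-integrable D (EFin \o F i)) ->
  Rintegral mu D (fun x => \sum_(i <- s) F i x)%R = (\sum_(i <- s) Rintegral mu D (F i))%R.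
Proof.
move=> mD iF; elim: s => [|i s ih].
  rewrite big_nil; under eq_Rintegral do rewrite big_nil.
  by rewrite Rintegral_cst// mul0r.
rewrite big_cons -ih -RintegralD//; last exact: integrable_sum_fun.
by under eq_Rintegral do rewrite big_cons.
Qed.

End sqint_more.

(** * Approximation by ball averages *)

Section finite_difference.
Context {R : realType} {n : nat}.
Local Notation V := (Rn R n).
Local Notation mu := (lebesgue_Rn n : {sigma_finite_measure set V -> \bar R}).
Implicit Types (u v h : V -> R) (x y z a : V) (r k l : R) (m : nat).

Fixpoint fdiff m y u : V -> R :=
  if m is m'.+1 then fun x => fdiff m' y u (x + y) - fdiff m' y u x else u.

(** With the translation by y in the role of the indeterminate, the m-th difference is (X - 1)^m,
    and the recursion of [fdiff] is multiplication by X - 1. *)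
Definition dcoef m i : R := (('X - 1) ^+ m : {poly R})`_i.

Lemma fdiffE m y u x :
  fdiff m y u x = \sum_(i < m.+1) dcoef m i * u (x + i%:R *: y).
Proof.
elim: m x => [|m ih] x /=.
  by rewrite big_ord1 /dcoef expr0 coef1 mul1r scale0r addr0.
rewrite !ih.
have cE i : dcoef m.+1 i = (if i is j.+1 then dcoef m j else 0) - dcoef m i.
  by rewrite /dcoef exprSr mulrBr mulr1 coefB coefMX; case: i.
have c0 : dcoef m m.+1 = 0.
  rewrite /dcoef nth_default// -[1]/(1%:P) size_exp_XsubC//.
under [RHS]eq_bigr do rewrite cE mulrBl.
rewrite big_split/= sumrN; congr (_ - _); last first.
  by rewrite [in RHS]big_ord_recr/= c0 mul0r addr0.
rewrite [RHS]big_ord_recl/= mul0r add0r; apply: eq_bigr => i _.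
rewrite -addrA -[X in X + _ *: _]scale1r -scalerDl add0n /bump leq0n natrD.
by [].
Qed.

Lemma dcoef0 m : dcoef m 0 = (-1) ^+ m.
Proof. by rewrite /dcoef -horner_coef0 horner_exp !hornerE. Qed.

Lemma L2_fdiff m y u : L2 mu u -> L2 mu (fdiff m y u).
Proof. by move=> Lu; elim: m => //= m ih; apply: L2B => //; exact: L2_shift. Qed.

Lemma fdiffB m y u v x : fdiff m y (fun x => u x - v x) x = fdiff m y u x - fdiff m y v x.
Proof. by elim: m x => //= m ih x; rewrite !ih; ring. Qed.

(* The weights for which sub_smoothE holds. *)
Definition scoef m (i : nat) : R := - (-1) ^+ m * dcoef m i.+1.

(** The operator A_r. The index i stands for the scale i + 1: the term of scale 0 in the m-th
    difference is u itself. *)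
Definition smooth m r u x : R :=
  \sum_(i < m) scoef m i * ballavg r i.+1%:R u x.

Lemma L2_smooth m r u : 0 < r -> L2 mu u -> L2 mu (smooth m r u).
Proof. by move=> r0 Lu; apply: L2_sum => i; apply: L2Z; exact: L2_ballavg. Qed.

Lemma measurable_smooth m r u : measurable_fun setT u -> measurable_fun setT (smooth m r u).
Proof.
move=> mu_; apply: measurable_sum => i.
by apply: measurable_funM => //; exact: measurable_ballavg.
Qed.

Lemma smoothB m r u v x : L2 mu u -> L2 mu v ->
  smooth m r (fun x => u x - v x) x = smooth m r u x - smooth m r v x.
Proof.
move=> Lu Lv; rewrite /smooth -sumrB; apply: eq_bigr => i _.
rewrite -mulrBr ballavgD//; last exact: L2N.
congr (_ * (_ + _)); under [in LHS]eq_fun do rewrite -mulN1r.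
by rewrite ballavgZ// mulN1r.
Qed.

Lemma smoothC m r r' u x : 0 < r -> 0 < r' -> L2 mu u ->
  smooth m r (smooth m r' u) x = smooth m r' (smooth m r u) x.
Proof.
move=> r0 r'0 Lu.
have E (a b : R) : 0 < a -> 0 < b -> smooth m a (smooth m b u) x =
    \sum_(i < m) \sum_(j < m) scoef m i * scoef m j * ballavg a i.+1%:R (ballavg b j.+1%:R u) x.
  move=> a0 b0; apply: eq_bigr => i _.
  rewrite ballavg_sum//; last by move=> j; apply: L2Z; exact: L2_ballavg.
  rewrite mulr_sumr; apply: eq_bigr => j _.
  by rewrite ballavgZ ?mulrA//; exact: L2_ballavg.
rewrite (E r r' r0 r'0) (E r' r r'0 r0) exchange_big/=.
apply: eq_bigr => i _; apply: eq_bigr => j _.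
by rewrite (ballavgC x r0 r'0 (ltr0Sn R j) (ltr0Sn R i) Lu) [scoef m j * _]mulrC.
Qed.

(** In the m-th difference the term without translation is (-1)^m u x, constant in y; every other
    term has a ball average as its mean. The sign in [scoef] compensates for (-1)^m. *)
Lemma sub_smoothE m r u x : 0 < r -> L2 mu u ->
  u x - smooth m r u x =
  (-1) ^+ m * ((@vball R n r)^-1 * Rintegral mu (ballRn n r) (fun y => fdiff m y u x)).
Proof.
move=> r0 Lu; have mB := @measurable_ballRn R n r.
have v0 : @vball R n r != 0 by rewrite gt_eqF// vball_gt0.
pose F (i : 'I_m) (y : V) := dcoef m i.+1 * u (x + i.+1%:R *: y).
have iF i : mu.-integrable (ballRn n r) (EFin \o F i).
  have := integrableZl mB (dcoef m i.+1) (ballavg_integrable r x (ltr0Sn R i) Lu).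
  by apply: eq_integrable => // y _; rewrite /= EFinM.
have -> : Rintegral mu (ballRn n r) (fun y => fdiff m y u x) =
    (-1) ^+ m * u x * @vball R n r + \sum_(i < m) Rintegral mu (ballRn n r) (F i).
  transitivity (Rintegral mu (ballRn n r) (fun y => (-1) ^+ m * u x + \sum_(i < m) F i y)).
    apply: eq_Rintegral => y _; rewrite fdiffE big_ord_recl/= scale0r addr0 dcoef0.
    by [].
  rewrite RintegralD//; last 2 first.
  - apply: measurable_bounded_integrable => //; first exact: lebesgue_ballRn_lty.
    by exists `|(-1) ^+ m * u x|; split => // M hM z _ /=; exact: ltW.
  - exact: integrable_sum_fun.
  rewrite Rintegral_sum// Rintegral_cst//; congr (_ * _ + _).
  by apply: (congr1 fine (lebesgue_ballRn n r0)).
have FE i : Rintegral mu (ballRn n r) (F i) = dcoef m i.+1 * (@vball R n r * ballavg r i.+1%:R u x).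
  rewrite RintegralZl//; last exact: ballavg_integrable.
  congr (_ * _); rewrite /ballavg; set I := Rintegral _ _ _.
  by rewrite mulrA divff// mul1r.
under eq_bigr do rewrite FE.
rewrite /smooth /scoef.
rewrite -sumrN !mulrDr; congr (_ + _).
  by rewrite [_ * @vball R n r]mulrC mulKf// mulrA -expr2 sqrr_sign mul1r.
rewrite !mulr_sumr; apply: eq_bigr => i _.
set b := ballavg _ _ _ _; rewrite !mulNr opprK -mulrA; congr (_ * _).
by rewrite [in RHS]mulrCA mulKf.
Qed.

Local Open Scope ereal_scope.

Lemma sqint_sub_smooth m r u (M : \bar R) : (0 < r)%R -> L2 mu u -> 0 <= M ->
  (forall y, (enorm y < r)%R -> sqint mu (fdiff m y u) <= M) ->
  sqint mu (fun x => u x - smooth m r u x)%R <= M.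
Proof.
move=> r0 Lu M0 hM.
have mu_ := Lu.1.
have mF (k : nat) : measurable_fun setT (fun p : V * V => fdiff k p.2 u p.1).
  rewrite (_ : (fun _ => _) = fun p : V * V => \sum_(i < k.+1) (dcoef k i * u (p.1 + i%:R *: p.2))%R)%R.
    by apply: measurable_sum => i; meas.
  by apply/funext => p; rewrite fdiffE.
apply: le_trans (sqint_ball_mean_le (F := fun x y => fdiff m y u x) r0 (mF m) M0 hM).
rewrite /sqint le_eqVlt; apply/orP; left; apply/eqP; apply: eq_integral => x _.
by rewrite sub_smoothE// exprMn sqrr_sign mul1r.
Qed.

Lemma sqint_smooth_le m : exists2 C : R, (0 <= C)%R &
  forall r u, (0 < r)%R -> L2 mu u -> sqint mu (smooth m r u) <= C%:E * sqint mu u.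
Proof.
exists (2 ^+ m * \sum_(i < m) scoef m i ^+ 2)%R.
  by rewrite mulr_ge0// sumr_ge0// => i _; exact: sqr_ge0.
move=> r u r0 Lu; have LF (i : 'I_m) := L2Z (scoef m i) (L2_ballavg i.+1%:R r0 Lu).
apply: le_trans (sqint_sum_le _ LF) _.
rewrite /index_enum -enumT size_enum_ord EFinM -muleA; apply: lee_wpmul2l; first by rewrite lee_fin.
rewrite -sumEFin ge0_sume_distrl; last by move=> i _; rewrite lee_fin sqr_ge0.
apply: lee_sum => i _; rewrite sqintZ; last exact: L2_ballavg.
by apply: lee_wpmul2l; [rewrite lee_fin sqr_ge0|apply: sqint_ballavg => //; exact: Lu.1].
Qed.

Lemma ballavg_sup r k h x (M : R) : (0 < r)%R -> (1 <= k)%R ->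
  measurable_fun setT h -> sqint mu h <= M%:E ->
  (ballavg r k h x ^+ 2 <= (vol_ball n)^-1 * (r ^+ n)^-1 * M)%R.
Proof.
move=> r0 k1 mh hM; have k0 : (0 < k)%R by exact: lt_le_trans k1.
have v0 := vol_ball_gt0 (R := R) n.
have M0 : (0 <= M)%R by rewrite -lee_fin; exact: le_trans (sqint_ge0 mu h) hM.
rewrite -lee_fin; apply: le_trans (ballavg_le_local_mass x r0 k0 mh) _.
rewrite [in leRHS]EFinM; apply: lee_pmul.
- by rewrite lee_fin invr_ge0 ltW// vball_gt0// mulr_gt0.
- by apply: integral_ge0 => z _; rewrite lee_fin mulr_ge0// sqr_ge0.
- rewrite lee_fin -invfM lef_pV2 ?posrE ?mulr_gt0 ?exprn_gt0 ?mulr_gt0//.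
  by rewrite /vball ler_pM2l// lerXn2r ?nnegrE ?mulr_ge0 ?(ltW r0) ?(ltW k0)// ler_peMl// ltW.
- exact: le_trans (local_mass_le_sqint _ x mh) hM.
Qed.

Lemma ballavg_radial r k h x (M : R) : (0 < n)%N -> (0 < r)%R -> (1 <= k)%R ->
  measurable_fun setT h -> reflect_invariant h -> sqint mu h <= M%:E ->
  (ballavg r k h x ^+ 2 * enorm x ^+ n.-1 <= 2 ^+ n * (vol_ball n)^-1 * r^-1 * M)%R.
Proof.
move=> n0 r0 k1 mh hinv hM; have k0 : (0 < k)%R by exact: lt_le_trans k1.
have v0 := vol_ball_gt0 (R := R) n.
have M0 : (0 <= M)%R by rewrite -lee_fin; exact: le_trans (sqint_ge0 mu h) hM.
have kr0 : (0 < k * r)%R by rewrite mulr_gt0.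
have lm0 : 0 <= local_mass (k * r)%R h x.
  by apply: integral_ge0 => z _; rewrite lee_fin mulr_ge0// sqr_ge0.
have key : local_mass (k * r)%R h x * (enorm x ^+ n.-1)%:E <= (2 ^+ n * (k * r) ^+ n.-1 * M)%:E.
  (* The annulus argument needs k r <= |x|. Nearer to the origin the total mass suffices, because
     |x|^(n-1) <= (k r)^(n-1). *)
  have [xr|xr] := leP (k * r)%R (enorm x); first exact: local_mass_radial.
  rewrite muleC [in leRHS]EFinM; apply: lee_pmul => //.
  - by rewrite lee_fin exprn_ge0// enorm_ge0.
  - rewrite lee_fin -[leLHS]mul1r; apply: ler_pM => //.
    + by rewrite exprn_ge0// enorm_ge0.
    + by rewrite exprn_ege1// ler1n.
    + by rewrite lerXn2r ?nnegrE ?enorm_ge0 ?ltW.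
  - exact: le_trans (local_mass_le_sqint _ x mh) hM.
rewrite -lee_fin EFinM.
apply: (@le_trans _ _ ((@vball R n (k * r))^-1%:E * local_mass (k * r)%R h x * (enorm x ^+ n.-1)%:E)).
  apply: lee_wpmul2r; first by rewrite lee_fin exprn_ge0// enorm_ge0.
  exact: ballavg_le_local_mass.
rewrite -muleA; apply: le_trans (lee_wpmul2l _ key) _.
  by rewrite lee_fin invr_ge0 ltW// vball_gt0.
rewrite -EFinM lee_fin /vball -[in X in (_ * X)^-1%R](prednK n0) exprS.
have E0 : ((k * r) ^+ n.-1 != 0)%R by rewrite expf_neq0// gt_eqF.
rewrite (_ : (_ * (_ * M))%R = 2 ^+ n * (vol_ball n)^-1 * (k * r)^-1 * M)%R; last first.
  by field; rewrite ?E0 ?gt_eqF.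
apply: ler_wpM2r => //; apply: ler_wpM2l; first by rewrite mulr_ge0// ?invr_ge0 ?ltW// exprn_gt0.
by rewrite lef_pV2 ?posrE// ler_peMl// ltW.
Qed.

Lemma smooth_sqr_le m r h x (K : R) : (0 <= K)%R ->
  (forall k, (1 <= k)%R -> (ballavg r k h x ^+ 2 <= K)%R) ->
  (smooth m r h x ^+ 2 <= (\sum_(i < m) `|scoef m i|) ^+ 2 * K)%R.
Proof.
move=> K0 hK.
have h1 : (`|smooth m r h x| <= (\sum_(i < m) `|scoef m i|) * Num.sqrt K)%R.
  apply: le_trans (ler_norm_sum _ _ _) _; rewrite mulr_suml; apply: ler_sum => i _.
  rewrite normrM; apply: ler_wpM2l => //.
  by rewrite -sqrtr_sqr; apply: ler_wsqrtr; apply: hK; rewrite ler1n.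
rewrite -(real_normK (num_real _)) -[in leRHS](sqr_sqrtr K0) -exprMn.
by rewrite lerXn2r// ?nnegrE// mulr_ge0 ?sqrtr_ge0// sumr_ge0.
Qed.

(** A radial lemma of Strauss type for A_r h: both bounds use only the L^2 norm of h, the loss of
    derivatives being paid by the powers r^-n and r^-1. *)
Lemma smooth_bounds m : (0 < n)%N -> exists2 C : R, (0 <= C)%R &
  forall r h (M : R), (0 < r)%R -> measurable_fun setT h -> sqint mu h <= M%:E ->
    (forall x, smooth m r h x ^+ 2 <= C * (r ^+ n)^-1 * M)%R /\
    (reflect_invariant h ->
      forall x, smooth m r h x ^+ 2 * enorm x ^+ n.-1 <= C * r^-1 * M)%R.
Proof.
move=> n0; pose S := ((\sum_(i < m) `|scoef m i|) ^+ 2 : R)%R.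
have v0 := vol_ball_gt0 (R := R) n.
exists (S * (2 ^+ n * (vol_ball n)^-1))%R.
  by rewrite mulr_ge0 ?sqr_ge0// mulr_ge0// invr_ge0 ltW.
move=> r h M r0 mh hM.
have M0 : (0 <= M)%R by rewrite -lee_fin; exact: le_trans (sqint_ge0 mu h) hM.
split=> [x|hinv x].
  have K0 : (0 <= 2 ^+ n * (vol_ball n)^-1 * (r ^+ n)^-1 * M)%R.
    by rewrite !mulr_ge0// ?invr_ge0 ?exprn_ge0 ?(ltW r0) ?(ltW v0).
  have := @smooth_sqr_le m r h x _ K0; rewrite -/S !mulrA; apply => k k1.
  apply: le_trans (ballavg_sup x r0 k1 mh hM) _.
  rewrite -!mulrA ler_peMl// ?exprn_ege1 ?ler1n//.
  by rewrite !mulr_ge0// ?invr_ge0 ?exprn_ge0 ?(ltW r0) ?(ltW v0).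
have [x0|x0] := eqVneq (enorm x ^+ n.-1)%R 0%R.
  by rewrite x0 mulr0 !mulr_ge0 ?exprn_ge0 ?sumr_ge0 ?invr_ge0 ?(ltW r0) ?(ltW v0).
have xp : (0 < enorm x ^+ n.-1)%R by rewrite lt_neqAle eq_sym x0/=; exact/exprn_ge0/enorm_ge0.
have K0 : (0 <= 2 ^+ n * (vol_ball n)^-1 * r^-1 * M / enorm x ^+ n.-1)%R.
  by rewrite !mulr_ge0// ?invr_ge0 ?exprn_ge0 ?(ltW r0) ?(ltW v0) ?enorm_ge0.
rewrite -ler_pdivlMr//.
have := @smooth_sqr_le m r h x _ K0; rewrite -/S !mulrA; apply => k k1.
by rewrite ler_pdivlMr//; exact: ballavg_radial.
Qed.

End finite_difference.

Lemma geometric_sum_le (R : realType) (x : R) (k : nat) : 0 <= x < 1 ->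
  \sum_(0 <= i < k) x ^+ i <= (1 - x)^-1.
Proof.
move=> /andP[x0 x1]; have d0 : 0 < 1 - x by lra.
rewrite -[leRHS]div1r ler_pdivlMr// mulrC.
rewrite big_mkord -opprB mulNr -subrX1 opprB.
by rewrite gerBl exprn_ge0.
Qed.

Lemma nneseries_geometric_lty (R : realType) (z x : R) : 0 <= z -> 0 <= x < 1 ->
  (\sum_(0 <= i <oo) (z * x ^+ i)%:E < +oo)%E.
Proof.
move=> z0 x01; have x0 : 0 <= x by case/andP: x01.
apply: (@le_lt_trans _ _ (z * (1 - x)^-1)%:E); last exact: ltry.
apply: lime_le; first by apply: is_cvg_nneseries => i _ _; rewrite lee_fin mulr_ge0// exprn_ge0.
apply: nearW => k; rewrite sumEFin lee_fin -mulr_sumr ler_wpM2l//.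
exact: geometric_sum_le.
Qed.

Lemma dyadic_scale (R : realType) (t : R) : 0 < t < 1 ->
  exists k, 2^-1 ^+ k.+1 <= t < 2^-1 ^+ k.
Proof.
move=> /andP[t0 t1].
have h : exists k, 2^-1 ^+ k.+1 <= t.
  have /cvgrPdist_lt/(_ t t0)[k _ hk] : (fun k => (2^-1 : R) ^+ k) @ \oo --> (0:R).
    by apply: cvg_expr; rewrite ger0_norm ?invr_ge0// invf_lt1// ltr1n.
  exists k; have := hk k.+1 (leqnSn k) => /=.
  by rewrite sub0r normrN ger0_norm ?exprn_ge0 ?invr_ge0// => /ltW.
case: (ex_minnP h) => k hk kmin; exists k; rewrite hk/=.
case: k hk kmin => [|k] hk kmin; first by rewrite expr0.
by rewrite ltNge; apply/negP => /kmin; rewrite ltnn.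
Qed.

Lemma le0_ger_powR (R : realType) (r t e : R) : 0 < r -> r <= t -> e <= 0 ->
  t `^ e <= r `^ e.
Proof.
move=> r0 rt e0; have t0 : 0 < t by exact: lt_le_trans rt.
rewrite -(opprK e) (powRN t (- e)) (powRN r (- e)) lef_pV2 ?posrE ?powR_gt0//.
by apply: ge0_ler_powR => //; rewrite ?nnegrE ?oppr_ge0 ?(ltW r0) ?(ltW t0).
Qed.

(** * Power weights *)

Section weights.
Context {R : realType} {n : nat}.
Local Notation V := (Rn R n).
Local Notation mu := (lebesgue_Rn n : {sigma_finite_measure set V -> \bar R}).
Implicit Types (f : V -> R) (c q r : R).
Local Open Scope ereal_scope.

(** For c < 0 the ball is cut into dyadic shells. On the shell where |x| is between 2^-(k+1) and
    2^-k, the weight is at most a^(k+1) with a = 2^-c; against the volume of the ball of radius 2^-k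
    this gives a geometric series of ratio 2^-(n+c) < 1. *)
Lemma weight_ball1_lty c : (- n%:R < c)%R ->
  \int[mu]_(x in ballRn n 1%R) (enorm x `^ c)%:E < +oo.
Proof.
move=> nc; have mB r := @measurable_ballRn R n r.
have mw : measurable_fun setT (fun x : V => (enorm x `^ c)%:E).
  by meas.
have [c0|c0] := leP 0%R c.
  apply: (@le_lt_trans _ _ (\int[mu]_(x in ballRn n 1%R) 1)).
    apply: ge0_le_integral => //; first by move=> x _; rewrite lee_fin powR_ge0.
    - exact: measurable_funTS.
    - move=> x x1; have <- : (1 `^ c = 1 :> R)%R by rewrite powR1.
      rewrite lee_fin; apply: ge0_ler_powR => //; rewrite ?nnegrE ?enorm_ge0//.
      exact: ltW.
  by rewrite integral_cst// mul1e lebesgue_ballRn_lty.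
pose b : R := (2^-1 `^ (- c))%R.
have b0 : (0 < b)%R by rewrite powR_gt0// invr_gt0.
pose a : R := b^-1%R.
pose g (k : nat) (x : V) : \bar R := (a ^+ k.+1 * \1_(ballRn n (2^-1 ^+ k)%R) x)%:E.
have a0 : (0 < a)%R by rewrite invr_gt0.
have g0 k x : 0 <= g k x by rewrite lee_fin indic_ballRnE mulr_ge0 ?exprn_ge0 ?ler0n ?(ltW a0).
have mg k : measurable_fun setT (g k) by rewrite /g; meas.
apply: (@le_lt_trans _ _ (\int[mu]_x \sum_(0 <= k <oo) g k x)).
  rewrite integral_indic_mkcond.
  have mG : measurable_fun setT (fun x => \sum_(0 <= k <oo) g k x).
    by apply: ge0_emeasurable_sum.
  apply: ge0_le_integral => //.
  - by move=> x _; rewrite lee_fin mulr_ge0 ?powR_ge0// indic_ballRnE.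
  - by meas.
  move=> x _; rewrite indic_ballRnE.
  have G0 : 0 <= \sum_(0 <= k <oo) g k x by apply: nneseries_ge0 => k _ _.
  have [x1|_] := ltP (enorm x) 1%R; last by rewrite mul0r.
  (* At the origin the weight has the value 0, because [powR] sends 0 to 0 for a nonzero
     exponent. *)
  rewrite mul1r; have [x0|x0] := eqVneq (enorm x) 0%R.
    by rewrite x0 powR0// lt_eqF.
  have xp : (0 < enorm x)%R by rewrite lt_neqAle eq_sym x0 enorm_ge0.
  have [|k /andP[k1 k2]] := @dyadic_scale R (enorm x); first by rewrite xp.
  apply: (@le_trans _ _ (g k x)).
    rewrite /g indic_ballRnE k2 mulr1 lee_fin.
    rewrite /a exprVn -(opprK c) (powRN _ (- c)) lef_pV2 ?posrE ?powR_gt0 ?exprn_gt0//.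
    rewrite /b -powR_mulrn ?powR_ge0// -powRrM mulrC powRrM powR_mulrn ?invr_ge0//.
    apply: ge0_ler_powR => //; rewrite ?nnegrE ?exprn_ge0 ?invr_ge0 ?ltW// oppr_gt0//.
  by apply: le_trans (nneseries_lim_ge k.+1 _) => //; rewrite big_nat_recr//= leeDr// sume_ge0.
rewrite integral_nneseries//.
have h2 : (0 < (2^-1 : R))%R by rewrite invr_gt0.
rewrite (eq_eseriesr (g := fun k => ((a * vol_ball n) * (a * 2^-1 ^+ n) ^+ k)%:E)); last first.
  move=> k _; rewrite /g; under eq_integral do rewrite EFinM.
  rewrite ge0_integralZl; [|by []|by meas|by move=> x _; rewrite lee_fin indic_ballRnE
    |by rewrite lee_fin exprn_ge0 ?(ltW a0)].
  rewrite integral_indic// setIT.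
  have := lebesgue_ballRn n (exprn_gt0 k h2) => /= ->.
  by rewrite -EFinM; congr EFin; rewrite exprS exprMn -!exprM [(n * k)%N]mulnC; ring.
apply: nneseries_geometric_lty; first by rewrite mulr_ge0 ?ltW// vol_ball_gt0.
rewrite mulr_ge0 ?exprn_ge0 ?ltW//=.
rewrite /a mulrC ltr_pdivrMr// mul1r -powR_mulrn ?ltW//.
have -> : (n%:R = - c + (n%:R + c) :> R)%R by ring.
rewrite powRD; last by apply/implyP => _; rewrite gt_eqF.
rewrite gtr_pMr ?powR_gt0//; apply: (@lt_le_trans _ _ (1 `^ (n%:R + c))%R); last by rewrite powR1.
apply: gt0_ltr_powR; rewrite ?nnegrE ?(ltW h2)//; first by lra.
by rewrite invf_lt1// ltr1n.
Qed.

Lemma weight_ball_scale c r : (0 < r)%R ->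
  \int[mu]_(x in ballRn n r) (enorm x `^ c)%:E =
  (r `^ (n%:R + c))%:E * \int[mu]_(x in ballRn n 1%R) (enorm x `^ c)%:E.
Proof.
move=> r0.
rewrite (integral_indic_mkcond _ (ballRn n r)) (integral_indic_mkcond _ (ballRn n 1%R)).
have mg t : measurable_fun setT (fun x : V => (\1_(ballRn n t) x * enorm x `^ c)%:E).
  by meas.
have g0 t x : 0 <= (\1_(ballRn n t) x * enorm x `^ c)%:E :> \bar R.
  by rewrite lee_fin mulr_ge0 ?powR_ge0// indic_ballRnE.
have := ge0_integral_dilation r0 (mg r) (g0 r).
have -> : \int[lebesgue_Rn n]_x (\1_(ballRn n r) (r *: x)%R * enorm (r *: x)%R `^ c)%:E =
   (r `^ c)%:E * \int[mu]_x (\1_(ballRn n 1%R) x * enorm x `^ c)%:E.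
  rewrite -ge0_integralZl//; last by rewrite lee_fin powR_ge0.
  apply: eq_integral => x _; rewrite -EFinM; congr EFin.
  rewrite !indic_ballRnE enormZ gtr0_norm// powRM ?enorm_ge0 ?ltW//.
  by rewrite -[X in (_ < X)%R]mulr1 ltr_pM2l//; ring.
move=> /(congr1 (fun z => (r ^+ n)%:E * z)).
rewrite !muleA -!EFinM exprVn mulfV ?expf_neq0 ?gt_eqF// mul1e => <-.
congr (_%:E * _); rewrite powRD; last by apply/implyP => _; rewrite gt_eqF.
by rewrite powR_mulrn// ltW.
Qed.

Definition wint q c f := \int[mu]_x (`|f x| `^ q * enorm x `^ c)%:E.

Lemma wint_inner q c f r (A : R) : (0 < q)%R -> (0 < r)%R -> (0 <= A)%R ->
  measurable_fun setT f -> (forall x, f x ^+ 2 <= A)%R ->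
  \int[mu]_(x in ballRn n r) (`|f x| `^ q * enorm x `^ c)%:E <=
  (A `^ (q / 2) * r `^ (n%:R + c))%:E * \int[mu]_(x in ballRn n 1%R) (enorm x `^ c)%:E.
Proof.
move=> q0 r0 A0 mf fA.
have mw : measurable_fun setT (fun x : V => (enorm x `^ c)%:E).
  by meas.
have mB := @measurable_ballRn R n r.
rewrite EFinM -muleA -(weight_ball_scale c r0).
rewrite -ge0_integralZl; [|by []|exact: measurable_funTS
  |by move=> x _; rewrite lee_fin powR_ge0|by rewrite lee_fin powR_ge0].
apply: ge0_le_integral => //.
- by move=> x _; rewrite lee_fin mulr_ge0// powR_ge0.
- by apply: measurable_funTS; meas.
- by apply: measurable_funeM; exact: measurable_funTS.
move=> x _; rewrite -EFinM lee_fin ler_wpM2r ?powR_ge0//.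
have -> : (`|f x| `^ q = (f x ^+ 2) `^ (q / 2))%R.
  by rewrite -(real_normK (num_real (f x))) -powR_mulrn// -powRrM; congr (_ `^ _)%R; field.
by apply: ge0_ler_powR; rewrite ?nnegrE ?sqr_ge0// divr_ge0// ltW.
Qed.

(** Write |f|^q = f^2 (f^2)^((q-2)/2) and bound the second factor by the radial decay. The total
    power of |x| is then c - (n-1)(q-2)/2 < 0, so it is largest at |x| = r, and the remaining f^2
    integrates to at most E. *)
Lemma wint_outer q c f r (B E : R) : (2 < q)%R -> (c < (n%:R - 1) * (q - 2) / 2)%R ->
  (0 < n)%N -> (0 < r)%R -> (0 <= B)%R ->
  measurable_fun setT f -> (forall x, f x ^+ 2 * enorm x ^+ n.-1 <= B)%R ->
  sqint mu f <= E%:E ->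
  \int[mu]_(x in ~` ballRn n r) (`|f x| `^ q * enorm x `^ c)%:E <=
  (B `^ ((q - 2) / 2) * r `^ (c - (n%:R - 1) * (q - 2) / 2) * E)%:E.
Proof.
move=> q2 cl n0 r0 B0 mf fB fE.
have mB : measurable (~` ballRn n r) by apply: measurableC; exact: measurable_ballRn.
set e := (c - _)%R; have e0 : (e < 0)%R by rewrite /e; lra.
pose K := (B `^ ((q - 2) / 2) * r `^ e)%R.
have K0 : (0 <= K)%R by rewrite mulr_ge0 ?powR_ge0.
rewrite -/K EFinM; apply: (@le_trans _ _ (K%:E * sqint mu f)); last first.
  by apply: lee_wpmul2l => //; rewrite lee_fin.
rewrite /sqint -ge0_integralZl//; [|by meas|by move=> x _; rewrite lee_fin sqr_ge0].
apply: (@le_trans _ _ (\int[mu]_(x in ~` ballRn n r) (K%:E * (f x ^+ 2)%:E))); last first.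
  apply: ge0_subset_integral => //.
  - by apply: measurable_funeM; meas.
  - by move=> x _; rewrite -EFinM lee_fin mulr_ge0 ?sqr_ge0.
apply: ge0_le_integral => //.
- by move=> x _; rewrite lee_fin mulr_ge0// powR_ge0.
- by apply: measurable_funTS; meas.
- by apply: measurable_funeM; apply: measurable_funTS; meas.
move=> x /negP; rewrite -leNgt => xr; rewrite -EFinM lee_fin.
have x0 : (0 < enorm x)%R by exact: lt_le_trans xr.
have xn : (enorm x ^+ n.-1 = enorm x `^ (n%:R - 1))%R.
  by rewrite -powR_mulrn ?ltW//; congr (_ `^ _)%R; rewrite -[in RHS](prednK n0) -natr1 addrK.
have -> : (`|f x| `^ q = f x ^+ 2 * (f x ^+ 2) `^ ((q - 2) / 2))%R.
  rewrite -(real_normK (num_real (f x))) -powR_mulrn// -powRrM.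
  have [->|fx0] := eqVneq `|f x|%R 0%R.
    by rewrite !powR0 ?mul0r ?gt_eqF//; lra.
  rewrite -powRD; last by rewrite fx0 implybT.
  by congr (_ `^ _)%R; field.
rewrite -mulrA [leRHS]mulrC ler_wpM2l ?sqr_ge0//.
apply: (@le_trans _ _ ((B / enorm x `^ (n%:R - 1)) `^ ((q - 2) / 2) * enorm x `^ c)%R).
  apply: ler_wpM2r; first exact: powR_ge0.
  apply: ge0_ler_powR; rewrite ?nnegrE ?sqr_ge0 ?divr_ge0 ?powR_ge0//; first lra.
  by rewrite ler_pdivlMr ?powR_gt0// -xn.
rewrite powRM ?invr_ge0 ?powR_ge0// /K -mulrA; apply: ler_wpM2l; first exact: powR_ge0.
rewrite -powRN -powRrM -powRD; last by apply/implyP => _; rewrite gt_eqF.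
have -> : (- (n%:R - 1) * ((q - 2) / 2) + c = e)%R by rewrite /e; field.
exact: (le0_ger_powR r0 xr (ltW e0)).
Qed.

End weights.

Lemma measurable_limn_einf d (T : measurableType d) (R : realType) (f : nat -> T -> \bar R) :
  (forall k, measurable_fun setT (f k)) -> measurable_fun setT (fun x => limn_einf (f ^~ x)).
Proof.
move=> mf; rewrite (_ : (fun _ => _) = (fun x => - limn_esup (fun k => - f k x))%E); last first.
  apply/funext => x; rewrite -limn_einfN; congr limn_einf.
  by apply/funext => k /=; rewrite oppeK.
apply: measurableT_comp => //; apply: measurable_fun_limn_esup => k.
exact: measurableT_comp.
Qed.

Lemma continuous_normr_powR (R : realType) (q : R) : 0 < q ->
  continuous (fun t : R => `|t| `^ q).
Proof.
move=> q0 t; have [->|t0] := eqVneq t 0.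
  rewrite /continuous_at normr0 powR0 ?gt_eqF//; apply/cvgrPdist_lt => e e0.
  near=> z; rewrite sub0r normrN ger0_norm ?powR_ge0//.
  have ee : e = (e `^ q^-1) `^ q by rewrite -powRrM mulVf ?gt_eqF// powRr1// ltW.
  rewrite ee; apply: gt0_ltr_powR; rewrite ?nnegrE ?powR_ge0//.
  rewrite -[z]subr0 distrC; near: z.
  by apply/nbhs_ballP; exists (e `^ q^-1) => //=; exact: powR_gt0.
apply: (@cvg_trans _ (expR (q * ln `|z|) @[z --> t])).
  apply: near_eq_cvg; near=> z.
  have z0 : z != 0.
    near: z; apply/nbhs_ballP; exists `|t|; rewrite /= ?normr_gt0// => z; rewrite /ball/=.
    by apply: contraTneq => ->; rewrite subr0 ltxx.
  by rewrite /powR normr_eq0 (negbTE z0).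
rewrite /powR normr_eq0 (negbTE t0).
have lt : ln `|z| @[z --> t] --> ln `|t|.
  have h : {for `|t|, continuous (@ln R)} by apply: continuous_ln; rewrite normr_gt0.
  exact: (cvg_comp (fun z : R => `|z|) (@ln R) (@norm_continuous _ R t) h).
exact: (cvg_comp _ _ (cvgM (cvg_cst q) lt) (continuous_expR (x := q * ln `|t|))).
Unshelve. all: by end_near. Qed.

Lemma powR_exprAC (R : realType) (b q : R) k : 0 <= b -> (b ^+ k) `^ q = (b `^ q) ^+ k.
Proof.
by move=> b0; rewrite -(powR_mulrn k (powR_ge0 b q)) -(powR_mulrn k b0) -!powRrM mulrC.
Qed.

(** * Convergence in L^q *)

Section Lq_complete.
Context d (T : measurableType d) (R : realType) (mu : {measure set T -> \bar R}).
Variable q : R.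
Hypothesis q1 : 1 <= q.
Implicit Types (f g : T -> R).
Local Notation nq f := ('N[mu]_q%:E[EFin \o f])%E.
Local Open Scope ereal_scope.

Let q0 : (0 < q)%R. Proof. exact: lt_le_trans q1. Qed.

(** Norms serve the triangle inequality, integrals of q-th powers serve pointwise estimates and
    limit theorems; this equivalence moves between them. *)
Lemma Lnorm_lePr f (M : R) : (0 <= M)%R ->
  (nq f <= M%:E) = (\int[mu]_x (`|f x| `^ q)%:E <= (M `^ q)%:E).
Proof.
move=> M0; have -> : \int[mu]_x (`|f x| `^ q)%:E = nq f `^ q.
  by rewrite powR_Lnorm ?gt_eqF//; apply: eq_integral => x _.
have i0 (x : \bar R) : 0 <= x -> x \in `[0, +oo] by move=> x0; rewrite in_itv/= x0 leey.
apply/idP/idP => h.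
  rewrite -poweR_EFin; apply: gt0_ler_poweR => //; first exact: ltW.
  - by rewrite i0// Lnorm_ge0.
  - by rewrite i0.
have := gt0_ler_poweR (r := q^-1) _ (i0 _ (poweR_ge0 (nq f) q)) (i0 (M `^ q)%:E _) h.
rewrite poweR_EFin -poweRrM -powRrM divff ?gt_eqF// poweRe1 ?Lnorm_ge0// powRr1//.
by apply; [rewrite invr_ge0 ltW|rewrite lee_fin powR_ge0].
Qed.

Lemma LnormB_sym f g : nq (fun x => f x - g x)%R = nq (fun x => g x - f x)%R.
Proof.
rewrite -oppe_Lnorm; congr Lnorm; apply/funext => x /=.
by rewrite opprB.
Qed.

Lemma Lnorm_telescope (F : nat -> T -> R) (J L : nat) : (J <= L)%N ->
  (forall k, measurable_fun setT (F k)) ->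
  nq (fun x => F L x - F J x)%R <= \sum_(J <= j < L) nq (fun x => F j.+1 x - F j x)%R.
Proof.
move=> JL mF; elim: L JL => [|L ih].
  rewrite leqn0 => /eqP ->; rewrite big_geq//.
  rewrite (_ : EFin \o _ = cst 0) ?Lnorm0 ?eqe ?gt_eqF//.
  by apply/funext => x /=; rewrite subrr.
rewrite leq_eqVlt => /predU1P[<-|JL].
  rewrite big_geq// (_ : EFin \o _ = cst 0) ?Lnorm0 ?eqe ?gt_eqF//.
  by apply/funext => x /=; rewrite subrr.
rewrite big_nat_recr//= addeC; apply: le_trans (leeD (lexx _) (ih JL)).
apply: le_trans _ (minkowski_EFin mu _ _ q1); last 2 first.
- exact: measurable_funB.
- exact: measurable_funB.
rewrite le_eqVlt; apply/orP; left; apply/eqP; congr Lnorm; apply/funext => x /=.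
by congr EFin; ring.
Qed.

(** The sum of the f k has a finite integral, hence is finite almost everywhere. This serves the
    completeness of L^q and the pointwise convergence of the regularisations of u. *)
Lemma ae_cvg_series (f : nat -> T -> R) : (forall k, measurable_fun setT (f k)) ->
  (forall k x, 0 <= f k x)%R -> \sum_(0 <= k <oo) \int[mu]_x (f k x)%:E < +oo ->
  {ae mu, forall x, cvgn (series (f ^~ x))}.
Proof.
move=> mf f0 foo.
have mS : measurable_fun setT (fun x => \sum_(0 <= k <oo) (f k x)%:E).
  by apply: ge0_emeasurable_sum => [k x _ _|k _]; [rewrite lee_fin|exact/measurable_EFinP].
have S0 x : 0 <= \sum_(0 <= k <oo) (f k x)%:E.
  by apply: nneseries_ge0 => k _ _; rewrite lee_fin.
have : mu.-integrable setT (fun x => \sum_(0 <= k <oo) (f k x)%:E).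
  apply/integrableP; split => //.
  under eq_integral do rewrite gee0_abs//.
  rewrite integral_nneseries//.
  - by move=> k; exact/measurable_EFinP.
  - by move=> k x _; rewrite lee_fin.
move=> /(integrable_ae measurableT)[N [mN N0 hN]].
exists N; split => // x /= h; apply: hN => /= /(_ Logic.I) hx; apply: h.
apply: nnseries_is_cvg => //.
by rewrite -ge0_fin_numE.
Qed.

(** Fatou's lemma for the q-th powers along the tail k >= J. A bound on norms thus passes to an
    almost everywhere limit with no convergence in norm known beforehand. *)
Lemma Lnorm_fatou (F : nat -> T -> R) f (M : R) (J : nat) : (0 <= M)%R ->
  (forall k, measurable_fun setT (F k)) -> measurable_fun setT f ->
  {ae mu, forall x, F k x @[k --> \oo] --> f x} ->
  (forall k, (J <= k)%N -> nq (F k) <= M%:E) -> nq f <= M%:E.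
Proof.
move=> M0 mF mf Ff FM; rewrite Lnorm_lePr//.
pose G k x : \bar R := (`|F (k + J)%N x| `^ q)%:E.
have mG k : measurable_fun setT (G k) by rewrite /G; meas.
have G0 k x : setT x -> 0 <= G k x by rewrite lee_fin powR_ge0.
have mE : measurable_fun setT (fun x => limn_einf (G ^~ x)) by exact: measurable_limn_einf.
have -> : \int[mu]_x (`|f x| `^ q)%:E = \int[mu]_x limn_einf (G ^~ x).
  apply: ae_eq_integral => //; first by meas.
  have [N [mN N0 hN]] := Ff.
  exists N; split => // x /= h; apply: hN => /= hx; apply: h => _.
  have : G k x @[k --> \oo] --> (`|f x| `^ q)%:E.
    apply/fine_cvgP; split; first exact: nearW.
    have hJ : F (k + J)%N x @[k --> \oo] --> f x by rewrite (cvg_shiftn J (F ^~ x)).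
    exact: (cvg_comp _ _ hJ (continuous_normr_powR q0 (x := f x))).
  by move=> /cvg_limn_einf_sup[-> _].
apply: le_trans (fatou mu measurableT mG G0) _.
rewrite limn_einf_lim; apply: lime_le; first exact: is_cvg_einfs.
apply: nearW => k; apply: (@le_trans _ _ (\int[mu]_x G k x)).
  by apply: ereal_inf_lbound; exists k => //=.
by rewrite /G -Lnorm_lePr// FM// leq_addl.
Qed.

Lemma Lq_complete (F : nat -> T -> R) :
  (forall k, measurable_fun setT (F k)) ->
  (forall k, nq (fun x => F k.+1 x - F k x)%R <= (2^-1 ^+ k)%:E) ->
  exists2 G : T -> R, measurable_fun setT G &
    forall k, nq (fun x => F k x - G x)%R <= (2 * 2^-1 ^+ k)%:E.
Proof.
move=> mF Fc.
(* The ratio 4/3 lies strictly between 1 and 2: against norms 2^-k the integrals of g k still decay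
   like (2/3)^(q k), while a bound on g k x makes the increments O((3/4)^k), hence summable. *)
pose g k x := ((`|F k.+1 x - F k x| * (4/3) ^+ k) `^ q)%R.
have mg k : measurable_fun setT (g k) by rewrite /g; meas.
have g0 k x : (0 <= g k x)%R by exact: powR_ge0.
pose r : R := ((2/3) `^ q)%R.
have r01 : (0 <= r < 1)%R.
  rewrite powR_ge0/=; apply: (@lt_le_trans _ _ (1 `^ q)%R); last by rewrite powR1.
  by apply: gt0_ltr_powR; rewrite ?nnegrE//; lra.
have intg k : \int[mu]_x (g k x)%:E <= (1 * r ^+ k)%:E.
  rewrite /g; under eq_integral do rewrite powRM ?exprn_ge0// mulrC EFinM.
  rewrite ge0_integralZl; [|by []|by meas|by move=> x _; rewrite lee_fin powR_ge0|by rewrite lee_fin powR_ge0].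
  have := Fc k; rewrite Lnorm_lePr ?exprn_ge0// => h.
  apply: le_trans (lee_wpmul2l _ h) _; first by rewrite lee_fin powR_ge0.
  rewrite -EFinM lee_fin mul1r -powRM ?exprn_ge0// -exprMn.
  rewrite (_ : (4 / 3 * 2^-1 = 2 / 3 :> R)%R); last by field.
  by rewrite powR_exprAC// divr_ge0.
have gs : \sum_(0 <= k <oo) \int[mu]_x (g k x)%:E < +oo.
  apply: le_lt_trans (nneseries_geometric_lty ler01 r01).
  apply: lee_nneseries => k _; last exact: intg.
  by move=> _; apply: integral_ge0 => x _; rewrite lee_fin.
have [N [mN N0 hN]] := ae_cvg_series mg g0 gs.
have Fcvg x : ~ N x -> cvgn (F ^~ x).
  move=> Nx; have gx : cvgn (series (g ^~ x)) by apply: contrapT => h; apply: Nx; exact: hN.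
  have [S S0 gS] : exists2 S : R, (0 <= S)%R & forall k, (g k x <= S)%R.
    have gnd : nondecreasing_seq (series (g ^~ x)).
      by apply/nondecreasing_seqP => k; rewrite seriesSr lerDl.
    exists (limn (series (g ^~ x))) => [|k].
      by apply: le_trans (nondecreasing_cvgn_le gnd gx 0); rewrite seriesEnat /= big_geq.
    apply: le_trans (nondecreasing_cvgn_le gnd gx k.+1).
    by rewrite seriesSr lerDr seriesEnat/= sumr_ge0.
  pose dd k := (F k.+1 x - F k x)%R.
  have dS k : (`|dd k| <= S `^ q^-1 * (3/4) ^+ k)%R.
    have h4 : (0 < (4/3 : R) ^+ k)%R by apply: exprn_gt0; lra.
    have -> : ((3/4 : R) ^+ k = ((4/3) ^+ k)^-1)%R.
      by rewrite -exprVn; congr (_ ^+ _)%R; field.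
    rewrite ler_pdivlMr//.
    have a0 : (0 <= `|dd k| * (4 / 3) ^+ k)%R by rewrite mulr_ge0// ltW.
    have q1' : (q * q^-1 = 1)%R by rewrite divff ?gt_eqF.
    rewrite -[leLHS](powRr1 a0) -[X in powR _ X]q1' powRrM.
    by apply: ge0_ler_powR; rewrite ?invr_ge0 ?nnegrE ?(ltW q0)//; exact: gS.
  have cdd : cvgn (series dd).
    apply: normed_cvg; apply: (series_le_cvg (v_ := geometric (S `^ q^-1) (3/4))) => //.
    - by move=> k; exact: normr_ge0.
    - by move=> k /=; rewrite mulr_ge0 ?powR_ge0// exprn_ge0//; lra.
    - by apply: is_cvg_geometric_series; rewrite ger0_norm; lra.
  have FE : F ^~ x = (fun k => F 0%N x + series dd k)%R.
    by apply/funext => k; exact: (eq_sum_telescope (F ^~ x) k).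
  by rewrite FE; apply: is_cvgD => //; exact: is_cvg_cst.
(* The upper limit is measurable everywhere and agrees with the limit off N; on N, [fine] supplies
   some real value. *)
pose G x := fine (limn_esup (fun k => (F k x)%:E)).
have FG x : ~ N x -> F k x @[k --> \oo] --> G x.
  move=> /Fcvg/cvg_ex[l Fl].
  have /cvg_limn_einf_sup[_ e] : (F k x)%:E @[k --> \oo] --> l%:E.
    by apply/fine_cvgP; split; [exact: nearW|].
  by rewrite /G e.
have mG : measurable_fun setT G.
  apply: measurableT_comp; first exact: fine_measurable.
  by apply: measurable_fun_limn_esup => k; apply/measurable_EFinP.
exists G => // k; rewrite LnormB_sym.
apply: (@Lnorm_fatou (fun L x => F L x - F k x)%R _ _ k).
- by rewrite mulr_ge0// exprn_ge0.
- by move=> L; exact: measurable_funB.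
- exact: measurable_funB.
- exists N; split => // x /= h; apply: contrapT => Nx; apply: h.
  by apply: cvgB; [exact: FG|exact: cvg_cst].
move=> L kL; apply: le_trans (Lnorm_telescope kL mF) _.
apply: (@le_trans _ _ (\sum_(k <= j < L) (2^-1 ^+ j)%:E)).
  by apply: lee_sum => j _; exact: Fc.
rewrite sumEFin lee_fin -{1}[k]add0n big_addn.
under eq_bigr do rewrite exprD.
rewrite -mulr_suml ler_wpM2r ?exprn_ge0//.
apply: le_trans (geometric_sum_le _ _) _; first by lra.
by rewrite le_eqVlt; apply/orP; left; apply/eqP; field.
Qed.

End Lq_complete.

Section smooth_reflect.
Context {R : realType} {n : nat}.
Local Notation V := (Rn R n).
Local Notation mu := (lebesgue_Rn n : {sigma_finite_measure set V -> \bar R}).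
Implicit Types (u v h : V -> R) (x y z a : V) (r k : R).

Lemma reflectRnZ a k x : reflectRn a (k *: x) = k *: reflectRn a x.
Proof. rewrite /reflectRn dotRnZr scalerBr scalerA.
by set d := dotRn a x; set e := dotRn a a; rewrite (_ : 2 * (k * d) / e = k * (2 * d / e)) //; ring. Qed.

Local Open Scope ereal_scope.

Lemma negligible_affine (N : set V) x k : (0 < k)%R -> measurable N -> mu N = 0 ->
  measurable [set y | N (x + k *: y)%R] /\ mu [set y | N (x + k *: y)%R] = 0.
Proof.
move=> k0 mN N0; set A := [set y | _].
have maff : measurable_fun setT (fun y : V => x + k *: y)%R by meas.
have mA : measurable A by rewrite -[A]setTI; exact: maff.
split => //.
have m1 : measurable_fun setT (fun y : V => (\1_N y)%:E : \bar R).
  by apply/measurable_EFinP; exact: measurable_indic.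
have m2 : measurable_fun setT (fun y : V => (\1_N (y + x)%R)%:E : \bar R).
  by apply: (measurableT_comp m1); meas.
have := integral_indic mu measurableT mA; rewrite setIT => <-.
have -> : \int[mu]_y (\1_A y)%:E = \int[mu]_y (fun y => (\1_N (y + x)%R)%:E) (k *: y)%R.
  by apply: eq_integral => y _; rewrite !indicE addrC.
rewrite (ge0_integral_dilation k0 m2); last by move=> y; rewrite lee_fin.
rewrite (ge0_integral_shift x m1); last by move=> y; rewrite lee_fin.
by rewrite integral_indic// setIT [X in _ * X]N0 mule0.
Qed.

(** The ball is invariant under reflections, so the reflection moves inside the mean. For every x
    the exceptional set of u becomes a null set in the variable y, and the identity holds at every
    point. *)
Lemma ballavg_reflect r k u a x : (0 < k)%R -> measurable_fun setT u -> reflect_invariant u ->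
  ballavg r k u (reflectRn a x) = ballavg r k u x.
Proof.
move=> k0 mu_ uinv; rewrite /ballavg; congr (_ * _)%R; rewrite /Rintegral; congr fine.
rewrite 2!(integral_indic_mkcond _ (ballRn n r)).
have mg w : measurable_fun setT (fun y : V => (\1_(ballRn n r) y * u (w + k *: y)%R)%:E).
  by meas.
rewrite -(integral_reflect a (mg _)).
apply: ae_eq_integral => //.
- by apply: (measurableT_comp (mg _)); exact: measurable_reflectRn.
- have [N [mN N0 hN]] := uinv a.
  have [mA A0] := negligible_affine x k0 mN N0.
  exists [set y | N (x + k *: y)%R]; split => // y /= h; apply: hN => /= e; apply: h => _.
  by rewrite -reflectRnZ -reflectRnD e !indic_ballRnE enorm_reflectRn.
Qed.

Lemma smooth_reflect m r u : measurable_fun setT u -> reflect_invariant u ->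
  reflect_invariant (smooth m r u).
Proof.
move=> mu_ uinv a; apply: aeW => x; apply: eq_bigr => i _.
by rewrite ballavg_reflect.
Qed.

Lemma reflect_invariantB u v : reflect_invariant u -> reflect_invariant v ->
  reflect_invariant (fun x => u x - v x)%R.
Proof. by move=> hu hv a; apply: filterS2 (hu a) (hv a) => x -> ->. Qed.

End smooth_reflect.

Lemma sqintD_le d (T : measurableType d) (R : realType) (mu : {measure set T -> \bar R})
    (f g : T -> R) (A B : R) : L2 mu f -> L2 mu g ->
  (sqint mu f <= A%:E -> sqint mu g <= B%:E ->
  sqint mu (fun x => f x + g x)%R <= (2 * A + 2 * B)%:E)%E.
Proof.
move=> Lf Lg fA gB; apply: le_trans (sqintD Lf Lg) _.
have h (h : T -> R) (C : R) : (sqint mu h <= C%:E -> 2%:E * sqint mu h <= (2 * C)%:E)%E.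
  by rewrite EFinM; exact: lee_wpmul2l.
by rewrite (EFinD (2 * A)); apply: leeD; exact: h.
Qed.

Lemma sqintN d (T : measurableType d) (R : realType) (mu : {measure set T -> \bar R})
    (f : T -> R) : sqint mu (fun x => - f x) = sqint mu f.
Proof. by apply: eq_integral => x _; rewrite sqrrN. Qed.

Lemma sqintB_le d (T : measurableType d) (R : realType) (mu : {measure set T -> \bar R})
    (f g : T -> R) (A : R) : L2 mu f -> L2 mu g ->
  (sqint mu f <= A%:E -> sqint mu g <= A%:E ->
  sqint mu (fun x => f x - g x)%R <= (4 * A)%:E)%E.
Proof.
move=> Lf Lg fA gA; rewrite -sqintN in gA.
by apply: le_trans (sqintD_le Lf (L2N Lg) fA gA) _; rewrite lee_fin; lra.
Qed.

(** * Weighted estimates *)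

Section weighted_pieces.
Context {R : realType} {n : nat}.
Local Notation V := (Rn R n).
Local Notation mu := (lebesgue_Rn n : {sigma_finite_measure set V -> \bar R}).
Implicit Types (u v h f : V -> R) (x y z a : V) (r k K : R).
Variables (m : nat) (s q c : R).
Hypotheses (n_gt0 : (0 < n)%N) (s_gt0 : 0 < s) (q_gt2 : 2 < q).
Hypotheses (c_gtN : - n%:R < c) (c_lt : c < (n%:R - 1) * (q - 2) / 2).

Local Open Scope ereal_scope.

(* Real-valued stand-in for the radial functions of H^s with squared norm at most K:
   for m >= s, differences of order m play the role of the fractional Laplacian. *)
Definition Hclass K u :=
  [/\ L2 mu u, sqint mu u <= K%:E,
      (forall y, sqint mu (fdiff m y u) <= (K * enorm y `^ (2 * s))%:E) &
      reflect_invariant u].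

(** A_r^2. The square is taken so that a difference of two such operators factors: one factor is
    small in L^2, the other gives pointwise bounds. *)
Definition smooth2 r u := smooth m r (smooth m r u).

Lemma HclassB K u v : Hclass K u -> Hclass K v -> Hclass (4 * K) (fun x => u x - v x)%R.
Proof.
move=> [Lu uK du ui] [Lv vK dv vi].
split.
- exact: L2B.
- exact: sqintB_le.
- move=> y; rewrite -mulrA (_ : fdiff m y _ = fun x => fdiff m y u x - fdiff m y v x)%R.
    by apply: sqintB_le => //; exact: L2_fdiff.
  by apply/funext => x; exact: fdiffB.
- exact: reflect_invariantB.
Qed.

Lemma Hclass_ge0 K u : Hclass K u -> (0 <= K)%R.
Proof. by move=> [_ uK _ _]; rewrite -lee_fin; exact: le_trans (sqint_ge0 mu u) uK. Qed.

Lemma Hclass_sub_smooth K u r : (0 < r)%R -> Hclass K u ->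
  sqint mu (fun x => u x - smooth m r u x)%R <= (K * r `^ (2 * s))%:E.
Proof.
move=> r0 Hu; have K0 := Hclass_ge0 Hu; have [Lu uK du ui] := Hu.
apply: sqint_sub_smooth => //; first by rewrite lee_fin mulr_ge0// powR_ge0.
move=> y yr; apply: le_trans (du y) _; rewrite lee_fin ler_wpM2l//.
apply: ge0_ler_powR; rewrite ?nnegrE ?enorm_ge0 ?(ltW r0) ?(ltW yr)//.
by rewrite mulr_ge0// ltW.
Qed.

(** The integral is cut at |x| = r, the scale of f. The inner part scales like r^(-n q/2) r^(n+c),
    the outer one like r^(-(q-2)/2) r^(c - (n-1)(q-2)/2), and the two exponents coincide. *)
Lemma wint_bound (C : R) : (0 <= C)%R -> exists2 C2 : R, (0 <= C2)%R &
  forall r K f, (0 < r)%R -> (0 <= K)%R -> measurable_fun setT f ->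
    (forall x, f x ^+ 2 <= C * (r ^+ n)^-1 * K)%R ->
    (forall x, f x ^+ 2 * enorm x ^+ n.-1 <= C * r^-1 * K)%R ->
    sqint mu f <= (C * K)%:E ->
    wint q c f <= (C2 * (K `^ (q / 2) * r `^ (n%:R + c - n%:R * (q / 2))))%:E.
Proof.
move=> C0; have Wfin := weight_ball1_lty c_gtN.
have W0 : 0 <= \int[mu]_(x in ballRn n 1%R) (enorm x `^ c)%:E.
  by apply: integral_ge0 => x _; rewrite lee_fin powR_ge0.
pose W := fine (\int[mu]_(x in ballRn n 1%R) (enorm x `^ c)%:E).
have WE : \int[mu]_(x in ballRn n 1%R) (enorm x `^ c)%:E = W%:E.
  by rewrite fineK// ge0_fin_numE.
have W0' : (0 <= W)%R by rewrite fine_ge0.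
exists (C `^ (q / 2) * W + C `^ ((q - 2) / 2) * C)%R.
  by rewrite addr_ge0// mulr_ge0// powR_ge0.
move=> r K f r0 K0 mf f1 f2 f3.
have mB := @measurable_ballRn R n r.
have q0 : (0 < q)%R by exact: lt_trans q_gt2.
have rn0 : (0 <= C * (r ^+ n)^-1 * K)%R.
  by rewrite !mulr_ge0// invr_ge0 exprn_ge0// ltW.
have r10 : (0 <= C * r^-1 * K)%R by rewrite !mulr_ge0// invr_ge0 ltW.
rewrite /wint -(setUv (ballRn n r)) ge0_integral_setU//; last 4 first.
- exact: measurableC.
- by rewrite setUv; meas.
- by move=> x _; rewrite lee_fin mulr_ge0// powR_ge0.
- by apply/disj_setPCl.
rewrite mulrDl EFinD; apply: leeD.
  apply: le_trans (wint_inner c q0 r0 rn0 mf f1) _.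
  rewrite WE -EFinM lee_fin le_eqVlt; apply/orP; left; apply/eqP.
  rewrite powRM ?mulr_ge0 ?invr_ge0 ?exprn_ge0 ?(ltW r0)//.
  rewrite powRM ?invr_ge0 ?exprn_ge0 ?(ltW r0)//.
  rewrite -powR_mulrn ?(ltW r0)// -powRN -powRrM.
  rewrite (_ : (n%:R + c - n%:R * (q / 2) = - n%:R * (q / 2) + (n%:R + c))%R); last by ring.
  rewrite [in RHS]powRD; last by apply/implyP => _; rewrite gt_eqF.
  by ring.
apply: le_trans (wint_outer q_gt2 c_lt n_gt0 r0 r10 mf f2 f3) _.
rewrite lee_fin le_eqVlt; apply/orP; left; apply/eqP.
rewrite powRM ?mulr_ge0 ?invr_ge0 ?(ltW r0)//.
rewrite powRM ?invr_ge0 ?(ltW r0)//.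
rewrite -(powR_inv1 (ltW r0)) -(powRrM r).
rewrite (_ : (n%:R + c - n%:R * (q / 2) = - 1 * ((q - 2) / 2) + (c - (n%:R - 1) * (q - 2) / 2))%R); last by field.
rewrite [in RHS]powRD; last by apply/implyP => _; rewrite gt_eqF.
rewrite (_ : (q / 2 = (q - 2) / 2 + 1)%R); last by field.
rewrite (@powRD _ K); last by apply/implyP; rewrite gt_eqF//; lra.
by rewrite powRr1//; ring.
Qed.

(* The piece of scale r has weighted integral O(r ^ gap); gap > 0 means q < 2^*_c. *)
Definition gap := (n%:R + c - (n%:R / 2 - s) * q)%R.

Lemma wint_piece : exists2 C : R, (0 <= C)%R &
  forall r K u, (0 < r)%R -> Hclass K u ->
    wint q c (fun x => smooth2 (r / 2) u x - smooth2 r u x)%R <=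
    (C * (K `^ (q / 2) * r `^ gap))%:E.
Proof.
have [C1 C10 hC1] := @smooth_bounds R n m n_gt0.
have [C2 C20 hC2] := sqint_smooth_le (n := n) (R := R) m.
(* One constant for three bounds: 2^n compensates for the radius r / 2 in place of r, and 4 comes
   from (a + b)^2 <= 2 a^2 + 2 b^2 applied to two terms. *)
pose C := (4 * 2 ^+ n * C1 + 4 * C2)%R.
have C0 : (0 <= C)%R by rewrite addr_ge0// mulr_ge0// mulr_ge0.
have [C3 C30 hC3] := wint_bound C0.
exists (C3 * 4 `^ (q / 2))%R; first by rewrite mulr_ge0// powR_ge0.
move=> r K u r0 Hu.
have K0 := Hclass_ge0 Hu; have [Lu uK du ui] := Hu.
have r20 : (0 < r / 2)%R by rewrite divr_gt0.
pose h x := (smooth m (r / 2) u x - smooth m r u x)%R.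
have LS t : (0 < t)%R -> L2 mu (smooth m t u) by move=> t0; exact: L2_smooth.
have Lh : L2 mu h by apply: L2B; exact: LS.
have hi : reflect_invariant h by apply: reflect_invariantB; apply: smooth_reflect => //; exact: Lu.1.
(* h is the difference of the approximation errors at the scales r and r / 2, each of squared norm
   at most K r^(2s). *)
pose k := (4 * K * r `^ (2 * s))%R.
have k0 : (0 <= k)%R by rewrite !mulr_ge0// powR_ge0.
have hk : sqint mu h <= k%:E.
  rewrite (_ : h = fun x => (u x - smooth m r u x) - (u x - smooth m (r / 2) u x))%R; last first.
    by apply/funext => x; rewrite /h; ring.
  have LB t : (0 < t)%R -> L2 mu (fun x => u x - smooth m t u x)%R.
    by move=> t0; apply: L2B => //; exact: LS.
  have e1 : sqint mu (fun x => u x - smooth m (r / 2) u x)%R <= (K * r `^ (2 * s))%:E.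
    apply: le_trans (Hclass_sub_smooth r20 Hu) _; rewrite lee_fin ler_wpM2l//.
    by apply: ge0_ler_powR; rewrite ?nnegrE ?mulr_ge0 ?(ltW r0) ?(ltW r20) ?(ltW s_gt0)//; lra.
  by rewrite /k -mulrA; exact: (sqintB_le (LB _ r0) (LB _ r20) (Hclass_sub_smooth r0 Hu) e1).
(* As A_(r/2) and A_r commute, the difference of their squares is (A_(r/2) + A_r) (A_(r/2) - A_r),
   and h is the second factor applied to u. *)
have DE : (fun x => smooth2 (r / 2) u x - smooth2 r u x)%R = (fun x => smooth m (r / 2) h x + smooth m r h x)%R.
  apply/funext => x; rewrite /smooth2 /h !smoothB//; do ?exact: LS.
  by rewrite (smoothC m x r0 r20 Lu) addrA subrK.
have [a1 /(_ hi) a2] := hC1 _ h k r20 Lh.1 hk.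
have [b1 /(_ hi) b2] := hC1 _ h k r0 Lh.1 hk.
have two (a b : R) : ((a + b) ^+ 2 <= 2 * a ^+ 2 + 2 * b ^+ 2)%R by have := sqr_ge0 (a - b)%R; nra.
have rn : (0 < r ^+ n)%R by exact: exprn_gt0.
have ri : (0 < (r ^+ n)^-1)%R by rewrite invr_gt0.
have p2 : (1 <= 2 ^+ n :> R)%R by rewrite exprn_ege1// ler1n.
have rE : ((r / 2) ^+ n)^-1%R = (2 ^+ n * (r ^+ n)^-1)%R.
  by rewrite expr_div_n invf_div.
have p22 : (2 <= 2 ^+ n :> R)%R by rewrite -[leLHS]expr1 ler_weXn2l// ler1n.
have m1 : measurable_fun setT (fun x => smooth m (r / 2) h x + smooth m r h x)%R.
  by apply: measurable_funD; apply: measurable_smooth; exact: Lh.1.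
have CkK : (0 <= C1 * k)%R by exact: mulr_ge0.
rewrite DE; apply: le_trans (hC3 r k _ r0 k0 m1 _ _ _) _.
- move=> x; apply: le_trans (two _ _) _.
  apply: (@le_trans _ _ (2 * (C1 * ((r / 2) ^+ n)^-1 * k) + 2 * (C1 * (r ^+ n)^-1 * k))%R).
    by apply: lerD; rewrite ler_pM2l.
  have t0 : (0 <= C1 * k * (r ^+ n)^-1)%R by rewrite mulr_ge0// ltW.
  have t1 : (0 <= C2 * k * (r ^+ n)^-1)%R by rewrite mulr_ge0 ?(ltW ri)// mulr_ge0.
  rewrite rE /C; nra.
- move=> x; have e0 : (0 <= enorm x ^+ n.-1)%R by rewrite exprn_ge0// enorm_ge0.
  apply: le_trans (ler_wpM2r e0 (two _ _)) _.
  apply: (@le_trans _ _ (2 * (C1 * (r / 2)^-1 * k) + 2 * (C1 * r^-1 * k))%R).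
    by rewrite mulrDl -2!(mulrA (2:R)%R); apply: lerD; rewrite ler_pM2l//.
  have t0 : (0 <= C1 * k * r^-1)%R by rewrite mulr_ge0// invr_ge0 ltW.
  have t1 : (0 <= C2 * k * r^-1)%R by rewrite mulr_ge0 ?invr_ge0 ?(ltW r0)// mulr_ge0.
  rewrite invf_div /C; nra.
- have c1 : sqint mu (smooth m (r / 2) h) <= (C2 * k)%:E.
    by apply: le_trans (hC2 _ _ r20 Lh) _; rewrite EFinM; exact: lee_wpmul2l.
  have c2 : sqint mu (smooth m r h) <= (C2 * k)%:E.
    by apply: le_trans (hC2 _ _ r0 Lh) _; rewrite EFinM; exact: lee_wpmul2l.
  apply: le_trans (sqintD_le (L2_smooth m r20 Lh) (L2_smooth m r0 Lh) c1 c2) _.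
  have t0 : (0 <= 2 ^+ n * (C1 * k))%R by rewrite mulr_ge0.
  by rewrite lee_fin /C; nra.
rewrite lee_fin le_eqVlt; apply/orP; left; apply/eqP.
rewrite /k powRM ?mulr_ge0 ?powR_ge0// powRM// -powRrM.
rewrite (_ : gap = 2 * s * (q / 2) + (n%:R + c - n%:R * (q / 2)))%R; last by rewrite /gap; field.
by rewrite (@powRD _ r (2 * s * (q / 2))); [ring|apply/implyP => _; rewrite gt_eqF].
Qed.

(** The coarsest scale r = 1, where the dyadic sum starts: boundedness is enough, and one factor A_1
    already gives the pointwise bounds. *)
Lemma wint_smooth2 : exists2 C : R, (0 <= C)%R &
  forall K u, Hclass K u -> wint q c (smooth2 1 u) <= (C * K `^ (q / 2))%:E.
Proof.
have [C1 C10 hC1] := @smooth_bounds R n m n_gt0.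
have [C2 C20 hC2] := sqint_smooth_le (n := n) (R := R) m.
pose C := (C1 * C2 + C2 * C2)%R.
have C0 : (0 <= C)%R by rewrite addr_ge0// mulr_ge0.
have [C3 C30 hC3] := wint_bound C0.
exists C3 => // K u Hu.
have K0 := Hclass_ge0 Hu; have [Lu uK du ui] := Hu.
have Lh : L2 mu (smooth m 1 u) by exact: L2_smooth.
have hi : reflect_invariant (smooth m 1 u) by apply: smooth_reflect => //; exact: Lu.1.
have hk : sqint mu (smooth m 1 u) <= (C2 * K)%:E.
  by apply: le_trans (hC2 _ _ ltr01 Lu) _; rewrite EFinM; exact: lee_wpmul2l.
have [a1 /(_ hi) a2] := hC1 1%R _ _ ltr01 Lh.1 hk.
have CK : (0 <= C2 * C2 * K)%R by rewrite !mulr_ge0.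
have CK1 : (0 <= C1 * C2 * K)%R by rewrite !mulr_ge0.
apply: le_trans (hC3 1%R K _ ltr01 K0 (measurable_smooth m 1 Lh.1) _ _ _) _.
- by move=> x; apply: le_trans (a1 x) _; rewrite expr1n invr1 !mulr1 /C; lra.
- by move=> x; apply: le_trans (a2 x) _; rewrite invr1 !mulr1 /C; lra.
- apply: le_trans (hC2 _ _ ltr01 Lh) _.
  apply: le_trans (lee_wpmul2l _ hk) _; first by rewrite lee_fin.
  by rewrite -EFinM lee_fin /C; lra.
by rewrite powR1 mulr1.
Qed.

End weighted_pieces.

(** * Summation of the dyadic pieces *)

Section embedding.
Context {R : realType} {n : nat}.
Local Notation V := (Rn R n).
Local Notation mu := (lebesgue_Rn n : {sigma_finite_measure set V -> \bar R}).
Implicit Types (u v h f : V -> R) (x y z a : V) (r K : R).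
Variables (m : nat) (s q c : R).
Hypotheses (n_gt0 : (0 < n)%N) (s_gt0 : 0 < s) (q_gt2 : 2 < q).
Hypotheses (c_gtN : - n%:R < c) (c_lt : c < (n%:R - 1) * (q - 2) / 2).
Hypothesis gap_gt0 : 0 < @gap R n s q c.

Local Open Scope ereal_scope.
Local Notation Hclass := (Hclass m s).
Local Notation smooth2 := (smooth2 m).

Let q_gt0 : (0 < q)%R. Proof. exact: lt_trans q_gt2. Qed.
Let q_ge1 : (1 <= q)%R. Proof. by apply: le_trans (ltW q_gt2); rewrite ler1n. Qed.

(* Absorbing the weight into the function turns the weighted norm into a plain L^q norm. *)
Definition wmul f x : R := (f x * enorm x `^ (c / q))%R.
Definition wnorm f := 'N[mu]_q%:E[EFin \o wmul f].

Lemma measurable_wmul f : measurable_fun setT f -> measurable_fun setT (wmul f).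
Proof. by move=> mf; rewrite /wmul; meas. Qed.

Lemma wmulB (f g : V -> R) : wmul (fun x => f x - g x)%R = (fun x => wmul f x - wmul g x)%R.
Proof. by apply/funext => x; rewrite /wmul mulrBl. Qed.

Lemma wmulD (f g : V -> R) : wmul (fun x => f x + g x)%R = (fun x => wmul f x + wmul g x)%R.
Proof. by apply/funext => x; rewrite /wmul mulrDl. Qed.

Lemma wint_wmul f : wint q c f = \int[mu]_x (`|wmul f x| `^ q)%:E.
Proof.
apply: eq_integral => x _; rewrite /wmul normrM (ger0_norm (powR_ge0 _ _)).
rewrite powRM; [|exact: normr_ge0|exact: powR_ge0].
by rewrite -(powRrM (enorm x)) mulfVK ?gt_eqF.
Qed.

Lemma wnorm_le f (M : R) : (0 <= M)%R -> (wnorm f <= M%:E) = (wint q c f <= (M `^ q)%:E).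
Proof. by move=> M0; rewrite wint_wmul -Lnorm_lePr. Qed.

Lemma wnormD (f g : V -> R) : measurable_fun setT f -> measurable_fun setT g ->
  wnorm (fun x => f x + g x)%R <= wnorm f + wnorm g.
Proof.
move=> mf mg; rewrite /wnorm wmulD.
exact: (minkowski_EFin mu (measurable_wmul mf) (measurable_wmul mg) q_ge1).
Qed.

Lemma wnormB (f g : V -> R) : measurable_fun setT f -> measurable_fun setT g ->
  wnorm (fun x => f x - g x)%R <= wnorm f + wnorm g.
Proof.
move=> mf mg; apply: le_trans (wnormD mf (measurable_funN mg)) _.
have -> : wnorm (fun x => - g x)%R = wnorm g by
  rewrite /wnorm -[RHS]oppe_Lnorm; congr Lnorm; apply/funext => x; rewrite /= /wmul mulNr.
exact: lexx.
Qed.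

(** u - A_r^2 u = (u - A_r u) + A_r (u - A_r u), and A_r is bounded on L^2 uniformly in r. *)
Lemma sqint_sub_smooth2 : exists2 C : R, (0 <= C)%R &
  forall K u r, (0 < r)%R -> Hclass K u ->
    sqint mu (fun x => u x - smooth2 r u x)%R <= (C * K * r `^ (2 * s))%:E.
Proof.
have [C2 C20 hC2] := @sqint_smooth_le R n m.
exists (2 + 2 * C2)%R; first by rewrite addr_ge0// mulr_ge0.
move=> K u r r0 Hu; have [Lu _ _ _] := Hu.
have LS := L2_smooth m r0 Lu.
have LB := L2B Lu LS.
have e1 := Hclass_sub_smooth s_gt0 r0 Hu.
have e2 : sqint mu (smooth m r (fun x => u x - smooth m r u x)%R) <= (C2 * (K * r `^ (2 * s)))%:E.
  by apply: le_trans (hC2 _ _ r0 LB) _; rewrite EFinM; exact: lee_wpmul2l.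
have -> : (fun x => u x - smooth2 r u x)%R =
    (fun x => (u x - smooth m r u x) + smooth m r (fun x => u x - smooth m r u x)%R x)%R.
  by apply/funext => x; rewrite smoothB// addrA subrK.
apply: le_trans (sqintD_le LB (L2_smooth m r0 LB) e1 e2) _.
by rewrite lee_fin le_eqVlt; apply/orP; left; apply/eqP; ring.
Qed.

(** At the scales 2^-k the squared L^2 errors form a geometric series, so the pointwise squared
    errors are summable almost everywhere. This is the convergence that Fatou's lemma needs in
    [wnorm_tail]. *)
Lemma smooth2_cvg_ae K u : Hclass K u ->
  {ae mu, forall x, smooth2 (2^-1 ^+ k)%R u x @[k --> \oo] --> u x}.
Proof.
move=> Hu; have [Lu _ _ _] := Hu; have K0 := Hclass_ge0 Hu.
have [C C0 hC] := sqint_sub_smooth2.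
pose f k x := ((u x - smooth2 (2^-1 ^+ k) u x) ^+ 2)%R.
have h2 k : (0 < (2^-1 : R) ^+ k)%R by rewrite exprn_gt0// invr_gt0.
have mS k : measurable_fun setT (smooth2 (2^-1 ^+ k)%R u).
  by apply: measurable_smooth; apply: measurable_smooth; exact: Lu.1.
have mu_ := Lu.1.
have mf k : measurable_fun setT (f k) by apply: measurable_funX; exact: measurable_funB.
have f0 k x : (0 <= f k x)%R by exact: sqr_ge0.
pose t : R := (2^-1 `^ (2 * s))%R.
have t01 : (0 <= t < 1)%R.
  rewrite powR_ge0/=; apply: (@lt_le_trans _ _ (1 `^ (2 * s))%R); last by rewrite powR1.
  by apply: gt0_ltr_powR; rewrite ?nnegrE ?mulr_gt0//; lra.
have fs : \sum_(0 <= k <oo) \int[mu]_x (f k x)%:E < +oo.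
  apply: le_lt_trans (nneseries_geometric_lty (mulr_ge0 C0 K0) t01).
  apply: lee_nneseries => k _.
    by move=> _; apply: integral_ge0 => x _; rewrite lee_fin.
  apply: le_trans (hC K u _ (h2 k) Hu) _.
  by rewrite /t -powR_exprAC// invr_ge0.
have [N [mN N0 hN]] := ae_cvg_series mf f0 fs.
exists N; split => // x /= h; apply: hN => /= fx; apply: h.
have := cvg_series_cvg_0 fx => /cvgrPdist_lt f0x.
apply/cvgrPdist_lt => e e0.
have e20 : (0 < e ^+ 2)%R by exact: exprn_gt0.
have := f0x _ e20; apply: filterS => k /=.
rewrite sub0r normrN ger0_norm// /f -(real_normK (num_real _)).
by rewrite ltr_pXn2r// nnegrE// ltW.
Qed.

(** The ratio of the geometric bounds for the pieces: the q-th root of r^gap at r = 1/2. *)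
Let th : R := (2^-1 `^ (@gap R n s q c / q))%R.

Lemma theta01 : (0 <= th < 1)%R.
Proof.
rewrite powR_ge0/=; apply: (@lt_le_trans _ _ (1 `^ (@gap R n s q c / q))%R); last by rewrite powR1.
by apply: gt0_ltr_powR; rewrite ?nnegrE ?divr_gt0//; lra.
Qed.

Lemma wnorm_piece : exists2 A : R, (0 <= A)%R &
  forall K u k, Hclass K u ->
    wnorm (fun x => smooth2 (2^-1 ^+ k.+1) u x - smooth2 (2^-1 ^+ k) u x)%R <=
    (A * K `^ 2^-1 * th ^+ k)%:E.
Proof.
have [C C0 hC] := wint_piece m n_gt0 s_gt0 q_gt2 c_gtN c_lt.
exists (C `^ q^-1)%R; first exact: powR_ge0.
have th0 : (0 <= th)%R by exact: powR_ge0.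
move=> K u k Hu; have K0 := Hclass_ge0 Hu.
rewrite wnorm_le ?mulr_ge0 ?powR_ge0 ?exprn_ge0//.
have r0 : (0 < (2^-1 : R) ^+ k)%R by rewrite exprn_gt0// invr_gt0.
have := hC _ K u r0 Hu; rewrite exprSr => /le_trans; apply.
rewrite lee_fin le_eqVlt; apply/orP; left; apply/eqP.
rewrite powRM ?mulr_ge0 ?powR_ge0 ?exprn_ge0// powRM ?powR_ge0//.
rewrite -powRrM mulVf ?gt_eqF// powRr1// -mulrA; congr (_ * (_ * _))%R.
  by rewrite -powRrM mulrC.
rewrite (powR_exprAC _ _ th0) /th -powRrM mulfVK ?gt_eqF//.
by rewrite powR_exprAC// invr_ge0.
Qed.

(** The pieces from J on are summed by Minkowski's inequality, and Fatou's lemma replaces the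
    partial sums by u. The case J = 0 together with the coarsest scale gives the imbedding. *)
Lemma wnorm_tail : exists2 A : R, (0 <= A)%R &
  forall K u J, Hclass K u ->
    wnorm (fun x => u x - smooth2 (2^-1 ^+ J) u x)%R <= (A * K `^ 2^-1 * th ^+ J)%:E.
Proof.
have [A A0 hA] := wnorm_piece.
have /andP[th0 th1] := theta01.
have d0 : (0 <= (1 - th)^-1)%R by rewrite invr_ge0 subr_ge0 ltW.
exists (A * (1 - th)^-1)%R; first exact: mulr_ge0.
move=> K u J Hu; have [Lu _ _ _] := Hu; have K0 := Hclass_ge0 Hu; have mu_ := Lu.1.
pose F k := wmul (smooth2 (2^-1 ^+ k)%R u).
have mF k : measurable_fun setT (F k).
  by apply: measurable_wmul; apply: measurable_smooth; exact: measurable_smooth.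
rewrite /wnorm wmulB.
apply: (@Lnorm_fatou _ _ _ _ _ q_ge1 (fun L x => F L x - F J x)%R _ _ J).
- by rewrite !mulr_ge0 ?powR_ge0 ?exprn_ge0.
- by move=> L; exact: measurable_funB.
- by apply: measurable_funB; [exact: measurable_wmul|exact: (mF J)].
- apply: filterS (smooth2_cvg_ae Hu) => x hx.
  apply: cvgB; last exact: cvg_cst.
  by apply: cvgM; [exact: hx|exact: cvg_cst].
move=> L JL; apply: le_trans (Lnorm_telescope mu q_ge1 JL mF) _.
apply: (@le_trans _ _ (\sum_(J <= j < L) (A * K `^ 2^-1 * th ^+ j)%:E)).
  by apply: lee_sum => j _; rewrite -wmulB; exact: hA.
rewrite sumEFin lee_fin -mulr_sumr -{1}[J]add0n big_addn.
under eq_bigr do rewrite exprD.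
rewrite -mulr_suml [leRHS](_ : _ = A * K `^ 2^-1 * ((1 - th)^-1 * th ^+ J))%R; last by ring.
apply: ler_wpM2l; first by rewrite mulr_ge0 ?powR_ge0.
by apply: ler_wpM2r; [exact: exprn_ge0|apply: geometric_sum_le; rewrite th0].
Qed.

Lemma wnorm_Hclass : exists2 A : R, (0 <= A)%R &
  forall K u, Hclass K u -> wnorm u <= (A * K `^ 2^-1)%:E.
Proof.
have [A A0 hA] := wnorm_tail.
have [C C0 hC] := @wint_smooth2 R n m s q c n_gt0 q_gt2 c_gtN c_lt.
exists (A + C `^ q^-1)%R; first by rewrite addr_ge0 ?powR_ge0.
move=> K u Hu; have [Lu _ _ _] := Hu; have K0 := Hclass_ge0 Hu; have mu_ := Lu.1.
have mS : measurable_fun setT (smooth2 1 u).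
  by apply: measurable_smooth; exact: measurable_smooth.
have -> : u = (fun x => (u x - smooth2 1 u x) + smooth2 1 u x)%R.
  by apply/funext => x; rewrite subrK.
apply: le_trans (wnormD _ mS) _; first exact: measurable_funB.
rewrite mulrDl EFinD; apply: leeD.
  by have := hA K u 0%N Hu; rewrite !expr0 mulr1.
rewrite wnorm_le ?mulr_ge0 ?powR_ge0//; apply: le_trans (hC _ _ Hu) _.
rewrite lee_fin powRM ?powR_ge0// -!powRrM mulVf ?gt_eqF// powRr1//.
by rewrite [(q / 2)%R]mulrC.
Qed.

End embedding.

(** * Compactness *)

(** The image ultrafilter has a cluster point in the compact interval [-M, M], and an ultrafilter
    converges to its cluster points. One ultrafilter serves all points and all tolerances, so
    diagonal extraction is deferred to the very end. *)
Lemma ultra_cauchy (R : realType) (U : set_system nat) (a : nat -> R) (M e : R) :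
  UltraFilter U -> (forall k, `|a k| <= M) -> 0 < e ->
  exists2 E, U E & forall k l, E k -> E l -> `|a k - a l| <= e.
Proof.
move=> UU aM e0; have UF : ProperFilter U by exact: ultra_proper.
have UaM : (a @ U) `[- M, M]%classic.
  rewrite /fmap/=; apply: (@filterS _ U _ setT); last exact: filterT.
  move=> k _.
  by rewrite /= in_itv/=; have /ler_normlP[h1 h2] := aM k; apply/andP; split; lra.
have [l [_ lcl]] := @segment_compact R (- M) M (a @ U) _ UaM.
have e20 : 0 < e / 2 by rewrite divr_gt0.
have [al|nal] := in_ultra_setVsetC [set k | `|l - a k| < e / 2] UU; last first.
  have UB : (a @ U) [set z | ~ (`|l - z| < e / 2)] by [].
  have lB : nbhs l [set z | `|l - z| < e / 2] by apply/nbhs_ballP; exists (e / 2).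
  by have [z [/= h1 h2]] := lcl _ _ UB lB.
exists [set k | `|l - a k| < e / 2] => //.
move=> i j /= hi hj; rewrite (_ : a i - a j = (l - a j) - (l - a i)); last by ring.
by apply: le_trans (ler_normB _ _) _; lra.
Qed.

Lemma sqr_le_split (R : realType) (a b t : R) :
  (a - b) ^+ 2 <= t / 4 -> b ^+ 2 <= t / 4 -> a ^+ 2 <= t.
Proof. by have := sqr_ge0 (a - 2 * b); rewrite !expr2; lra. Qed.

Lemma powR_decay (R : realType) (a e t : R) : 0 <= a -> e < 0 -> 0 < t ->
  exists2 r, 0 < r & a * r `^ e <= t.
Proof.
move=> a0 e0 t0; have a1 : 0 < a + 1 by exact: ltr_wpDl.
(* The solution of (a + 1) r^e = t; a itself might be 0. *)
exists (((a + 1) / t) `^ (- e^-1)); first by rewrite powR_gt0// divr_gt0.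
rewrite -powRrM mulNr mulVf ?lt_eqF// powR_inv1 ?divr_ge0 ?(ltW t0) ?(ltW a1)//.
by rewrite invf_div mulrCA ger_pMr// ler_pdivrMr// mul1r lerDl.
Qed.

Lemma powR_small (R : realType) (a e t : R) : 0 <= a -> 0 < e -> 0 < t ->
  exists2 r, 0 < r & a * r `^ e <= t.
Proof.
move=> a0 e0 t0; have a1 : 0 < a + 1 by exact: ltr_wpDl.
exists ((t / (a + 1)) `^ (e^-1)); first by rewrite powR_gt0// divr_gt0.
rewrite -powRrM mulVf ?gt_eqF// powRr1 ?divr_ge0 ?(ltW t0) ?(ltW a1)//.
by rewrite mulrCA ger_pMr// ler_pdivrMr// mul1r lerDl.
Qed.

(** The net is a grid of spacing d / (n + 1), shifted by N to have natural indices. Rounding each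
    coordinate down costs at most the spacing, hence less than d in total. *)
Lemma ballRn_net (R : realType) n (rho d : R) : 0 < d ->
  exists (I : finType) (p : I -> Rn R n),
    forall x, ballRn n rho x -> exists i, enorm (x - p i) < d.
Proof.
move=> d0; pose b : R := d / n.+1%:R.
have b0 : 0 < b by rewrite divr_gt0.
pose N := Num.bound (rho / b).
exists {ffun 'I_n -> 'I_(N + N).+1}, (fun g : {ffun 'I_n -> 'I_(N + N).+1} => [tuple b * ((g i)%:R - N%:R) | i < n]).
move=> x xr; pose t i := tnth x i / b + N%:R.
have t0 i : 0 <= t i < (N + N).+1%:R.
  have xi : `|tnth x i / b| <= N%:R.
    rewrite normrM normfV (gtr0_norm b0); apply: le_trans (ltW (archi_boundP _)); last first.
      by rewrite divr_ge0 ?(ltW b0)// (le_trans (enorm_ge0 x))// ltW.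
    by rewrite ler_pM2r ?invr_gt0//; apply: ltW; apply: le_lt_trans xr; exact: tnth_le_enorm.
  by move: xi; rewrite ler_norml /t -natr1 natrD => /andP[? ?]; lra.
have tr i : (Num.trunc (t i) < (N + N).+1)%N.
  have /andP[t0i t1i] := t0 i; have /andP[h _] := truncn_itv t0i.
  by rewrite -(ltr_nat R); exact: le_lt_trans t1i.
exists [ffun i => Ordinal (tr i)].
apply: le_lt_trans (enorm_le_sum _) _.
apply: (@le_lt_trans _ _ (\sum_(i < n) b)).
  apply: ler_sum => i _; rewrite tnthD tnthN tnth_mktuple ffunE/=.
  have /andP[t0i _] := t0 i; have /andP[h1 h2] := truncn_itv t0i.
  have -> : tnth x i - b * ((Num.trunc (t i))%:R - N%:R) = b * (t i - (Num.trunc (t i))%:R).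
    by rewrite /t; field; rewrite gt_eqF.
  rewrite ger0_norm; last by rewrite mulr_ge0 ?(ltW b0)// subr_ge0.
  by rewrite ger_pMr//; move: h2; rewrite -natr1; lra.
rewrite sumr_const card_ord -mulr_natr /b mulrAC -mulrA gtr_pMr//.
by rewrite ltr_pdivrMr// mul1r ltr_nat.
Qed.

Section compactness.
Context {R : realType} {n : nat}.
Local Notation V := (Rn R n).
Local Notation mu := (lebesgue_Rn n : {sigma_finite_measure set V -> \bar R}).
Implicit Types (u v h f w : V -> R) (x y z a : V) (r K : R).
Variables (m : nat) (s q c sg : R).
Hypotheses (n_gt0 : (0 < n)%N) (s_gt0 : 0 < s) (q_gt2 : 2 < q) (sg_gt0 : 0 < sg).
Hypotheses (c_gtN : - n%:R < c) (c_lt : c < (n%:R - 1) * (q - 2) / 2).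
Hypothesis gap_gt0 : 0 < @gap R n s q c.

Local Open Scope ereal_scope.
Local Notation Hclass := (Hclass m s).
Local Notation smooth2 := (smooth2 m).
Local Notation wnorm := (wnorm q c).

Let q_gt0 : (0 < q)%R. Proof. exact: lt_trans q_gt2. Qed.
Let q_ge1 : (1 <= q)%R. Proof. by apply: le_trans (ltW q_gt2); rewrite ler1n. Qed.

Lemma smooth_shift r u x y : smooth m r u (x + y)%R = smooth m r (fun z => u (z + y)%R) x.
Proof.
apply: eq_bigr => i _; congr (_ * (_ * _))%R.
by apply: eq_Rintegral => z _; rewrite addrAC.
Qed.

Lemma smooth2_shift r u x y : smooth2 r u (x + y)%R = smooth2 r (fun z => u (z + y)%R) x.
Proof.
rewrite /smooth2 smooth_shift; congr (smooth m r _ x).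
by apply/funext => z; exact: smooth_shift.
Qed.

Lemma smooth2B r u v x : (0 < r)%R -> L2 mu u -> L2 mu v ->
  smooth2 r (fun x => u x - v x)%R x = (smooth2 r u x - smooth2 r v x)%R.
Proof.
move=> r0 Lu Lv; rewrite /smooth2 -smoothB; [|exact: L2_smooth|exact: L2_smooth].
by congr (smooth m r _ x); apply/funext => z; exact: smoothB.
Qed.

(** Increments of A_r^2 w are values of A_r^2 at a difference of w. The uniform bound thus turns the
    L^2 modulus of continuity of w into equicontinuity. *)
Lemma smooth2_fdiff r w x y : (0 < r)%R -> L2 mu w ->
  (smooth2 r w y - smooth2 r w x = smooth2 r (fdiff 1 (y - x) w) x)%R.
Proof.
move=> r0 Lw; rewrite [RHS](smooth2B _ r0 (L2_shift (y - x)%R Lw) Lw).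
by rewrite -smooth2_shift (_ : x + (y - x) = y)%R// addrC subrK.
Qed.

Lemma smooth2_bounds r : (0 < r)%R -> exists2 C : R, (0 <= C)%R &
  forall h (M : R), L2 mu h -> sqint mu h <= M%:E ->
    [/\ forall x, (smooth2 r h x ^+ 2 <= C * M)%R,
        reflect_invariant h ->
          forall x, (smooth2 r h x ^+ 2 * enorm x ^+ n.-1 <= C * M)%R &
        sqint mu (smooth2 r h) <= (C * M)%:E].
Proof.
move=> r0; have [C1 C10 hC1] := @smooth_bounds R n m n_gt0.
have [C2 C20 hC2] := @sqint_smooth_le R n m.
have p1 : (0 <= C1 * (r ^+ n)^-1 * C2)%R by rewrite !mulr_ge0// invr_ge0 exprn_ge0// ltW.
have p2 : (0 <= C1 * r^-1 * C2)%R by rewrite !mulr_ge0// invr_ge0 ltW.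
have p3 : (0 <= C2 * C2)%R by rewrite mulr_ge0.
exists (C1 * (r ^+ n)^-1 * C2 + C1 * r^-1 * C2 + C2 * C2)%R.
  by rewrite !addr_ge0.
move=> h M Lh hM.
have M0 : (0 <= M)%R by rewrite -lee_fin; exact: le_trans (sqint_ge0 mu h) hM.
have Ls := L2_smooth m r0 Lh.
have e1 : sqint mu (smooth m r h) <= (C2 * M)%:E.
  by apply: le_trans (hC2 _ _ r0 Lh) _; rewrite EFinM; exact: lee_wpmul2l.
have [a1 a2] := hC1 r _ _ r0 Ls.1 e1.
split.
- move=> x; apply: le_trans (a1 x) _; rewrite mulrA ler_wpM2r//; lra.
- move=> hi x; apply: le_trans (a2 _ x) _; first exact: smooth_reflect Lh.1 hi.
  by rewrite mulrA ler_wpM2r//; lra.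
- apply: le_trans (hC2 _ _ r0 Ls) _; apply: le_trans (lee_wpmul2l _ e1) _; first by rewrite lee_fin.
  by rewrite -EFinM lee_fin mulrA ler_wpM2r//; lra.
Qed.

(** [Hclass] controls differences of order m, whereas equicontinuity needs first differences. Their
    exponent [sg] will be min (s, 1), since first differences see at most one derivative. *)
Definition equi K u := forall y, sqint mu (fdiff 1 y u) <= (K * enorm y `^ (2 * sg))%:E.

Lemma equiB K u v : L2 mu u -> L2 mu v -> equi K u -> equi K v ->
  equi (4 * K) (fun x => u x - v x)%R.
Proof.
move=> Lu Lv hu hv y; rewrite -mulrA (_ : fdiff 1 y _ = fun x => fdiff 1 y u x - fdiff 1 y v x)%R.
  by apply: sqintB_le (hu y) (hv y); exact: L2_fdiff.
by apply/funext => x; exact: fdiffB.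
Qed.

Lemma smooth2_precompact (U : set_system nat) (u : nat -> V -> R) K r (eps : R) :
  UltraFilter U -> (forall k, Hclass K (u k)) -> (forall k, equi K (u k)) ->
  (0 < r)%R -> (0 < eps)%R ->
  exists2 E, U E & forall k l, E k -> E l ->
    wnorm (smooth2 r (fun x => u k x - u l x)%R) <= eps%:E.
Proof.
move=> UU Hu eu r0 eps0; have UF : ProperFilter U := ultra_proper.
have K0 := Hclass_ge0 (Hu 0%N).
have Lu k : L2 mu (u k) by have [] := Hu k.
have uK k : sqint mu (u k) <= K%:E by have [] := Hu k.
have [C C0 hC] := smooth2_bounds r0.
have eta0 : (0 < eps `^ q / 2)%R by rewrite divr_gt0// powR_gt0.
pose M := (C * (4 * K))%R.
have M0 : (0 <= M)%R by rewrite !mulr_ge0.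
pose ee := (c - (n%:R - 1) * (q - 2) / 2)%R.
have ee0 : (ee < 0)%R by rewrite subr_lt0.
(* Outside the ball of radius rho the weighted integral is at most eps^q / 2. *)
have [rho rho0 hrho] := powR_decay (mulr_ge0 (powR_ge0 M ((q - 2) / 2)) M0) ee0 eta0.
pose W := fine (\int[mu]_(x in ballRn n 1%R) (enorm x `^ c)%:E).
have WE : \int[mu]_(x in ballRn n 1%R) (enorm x `^ c)%:E = W%:E.
  rewrite fineK// ge0_fin_numE; first exact: weight_ball1_lty c_gtN.
  by apply: integral_ge0 => x _; rewrite lee_fin powR_ge0.
have W0 : (0 <= W)%R.
  by rewrite fine_ge0//; apply: integral_ge0 => x _; rewrite lee_fin powR_ge0.
have q20 : (0 < q / 2)%R by rewrite divr_gt0.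
(* A is the level for f^2 on the ball of radius rho that makes the inner integral at most eps^q /
   2. *)
have [A A0 hA] := powR_small (mulr_ge0 (powR_ge0 rho (n%:R + c)) W0) q20 eta0.
have A40 : (0 < A / 4)%R by rewrite divr_gt0.
have sg2 : (0 < 2 * sg)%R by rewrite mulr_gt0.
(* Over a distance d, the square of the increment of f is at most A / 4; so is f^2 at the points of
   the net, and f^2 <= A follows on the ball. *)
have [d d0 hd] := powR_small M0 sg2 A40.
have [I [p hp]] := @ballRn_net R n rho d d0.
have [E UE hE] : exists2 E, U E & forall i k l, E k -> E l ->
    (`|smooth2 r (u k) (p i) - smooth2 r (u l) (p i)| <= Num.sqrt (A / 4))%R.
  have Ei i : exists E, U E /\ forall k l, E k -> E l ->
      (`|smooth2 r (u k) (p i) - smooth2 r (u l) (p i)| <= Num.sqrt (A / 4))%R.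
    have bd k : (`|smooth2 r (u k) (p i)| <= Num.sqrt (C * K))%R.
      rewrite -sqrtr_sqr; apply: ler_wsqrtr.
      by have [h _ _] := hC _ _ (Lu k) (uK k); exact: h.
    have s0 : (0 < Num.sqrt (A / 4))%R by rewrite sqrtr_gt0.
    by have [E UE hE] := ultra_cauchy UU bd s0; exists E.
  have [E hE] := choice Ei.
  exists [set k | forall i, E i k].
    by apply: (filter_forall (f := fun i k => E i k)) => i; exact: (hE i).1.
  by move=> i k l /(_ i) hk /(_ i) hl; exact: (hE i).2.
exists E => // k l Ek El.
pose w x := (u k x - u l x)%R.
have Hw : Hclass (4 * K) w by exact: HclassB.
have [Lw wK _ wi] := Hw.
have [b1 b2 b3] := hC _ _ Lw wK.
set f := smooth2 r _ in b1 b2 b3 *.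
have mf : measurable_fun setT f.
  by apply: measurable_smooth; apply: measurable_smooth; exact: Lw.1.
have fA x : ballRn n rho x -> (f x ^+ 2 <= A)%R.
  move=> /hp[i xi].
  have h1 : ((f x - f (p i)) ^+ 2 <= A / 4)%R.
    rewrite /f (smooth2_fdiff (p i) x r0 Lw).
    have [h _ _] := hC _ _ (L2_fdiff 1 (x - p i)%R Lw) (equiB (Lu k) (Lu l) (eu k) (eu l) (x - p i)%R).
    apply: le_trans (h _) _; apply: le_trans hd; rewrite mulrA ler_wpM2l//.
    by apply: ge0_ler_powR; rewrite ?nnegrE ?enorm_ge0 ?(ltW d0) ?(ltW xi) ?(ltW sg2).
  have h2 : (f (p i) ^+ 2 <= A / 4)%R.
    rewrite -[leRHS]sqr_sqrtr ?(ltW A40)// -(real_normK (num_real (f (p i)))).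
    rewrite lerXn2r ?nnegrE ?sqrtr_ge0//.
    by have := hE i k l Ek El; rewrite -smooth2B.
  exact: sqr_le_split h1 h2.
have mB := @measurable_ballRn R n rho.
rewrite wnorm_le ?(ltW eps0)//.
rewrite /wint -(setUv (ballRn n rho)) ge0_integral_setU//; last 4 first.
- exact: measurableC.
- by rewrite setUv; meas.
- by move=> x _; rewrite lee_fin mulr_ge0// powR_ge0.
- by apply/disj_setPCl.
rewrite (splitr (eps `^ q)) EFinD; apply: leeD.
  (* The inner estimate asks for a bound at all points, so f is cut off outside the ball. *)
  pose f1 x := (\1_(ballRn n rho) x * f x)%R.
  rewrite (_ : \int[mu]_(x in _) _ = \int[mu]_(x in ballRn n rho) (`|f1 x| `^ q * enorm x `^ c)%:E); last first.
    by apply: eq_integral => x /set_mem xr; rewrite /f1 indic_ballRnE xr mul1r.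
  have mf1 : measurable_fun setT f1 by rewrite /f1; meas.
  apply: le_trans (wint_inner c q_gt0 rho0 (ltW A0) mf1 _) _.
    move=> x; rewrite /f1 indic_ballRnE; case: ltP => xr; last by rewrite mul0r expr0n ltW.
    by rewrite mul1r; exact: fA.
  rewrite WE -EFinM lee_fin; apply: le_trans hA.
  by rewrite -mulrA mulrC.
apply: le_trans (wint_outer q_gt2 c_lt n_gt0 rho0 M0 mf (b2 wi) b3) _.
rewrite lee_fin; apply: le_trans hrho.
by rewrite mulrAC.
Qed.

(** A Cauchy condition along U: the tail beyond scale 2^-J takes one half of eps, uniformly on the
    class of differences with constant 4 K, and the regularised part takes the other half. *)
Lemma Hclass_precompact (U : set_system nat) (u : nat -> V -> R) K (eps : R) :
  UltraFilter U -> (forall k, Hclass K (u k)) -> (forall k, equi K (u k)) ->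
  (0 < eps)%R ->
  exists2 E, U E & forall k l, E k -> E l -> wnorm (fun x => u k x - u l x)%R <= eps%:E.
Proof.
move=> UU Hu eu eps0; have K0 := Hclass_ge0 (Hu 0%N).
have [A A0 hA] := wnorm_tail m n_gt0 s_gt0 q_gt2 c_gtN c_lt gap_gt0.
have e20 : (0 < eps / 2)%R by rewrite divr_gt0.
set th := (_ `^ _)%R in hA.
have /andP[th0 th1] : (0 <= th < 1)%R by exact: theta01.
pose B := (A * (4 * K) `^ 2^-1)%R.
have B0 : (0 <= B)%R by rewrite mulr_ge0 ?powR_ge0.
have [J hJ] : exists J, (B * th ^+ J <= eps / 2)%R.
  have t0 : (0 < eps / 2 / (B + 1))%R by rewrite divr_gt0// ltr_wpDl.
  have /cvgrPdist_lt/(_ _ t0)[J _ /(_ J (leqnn J))] : (fun k => th ^+ k)%R @ \oo --> (0:R)%R.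
    by apply: cvg_expr; rewrite ger0_norm.
  rewrite /= sub0r normrN ger0_norm ?exprn_ge0// => h; exists J.
  rewrite ltr_pdivlMr ?ltr_wpDl// in h.
  have := exprn_ge0 J th0; nra.
have r0 : (0 < (2^-1 : R) ^+ J)%R by rewrite exprn_gt0// invr_gt0.
have [E UE hE] := smooth2_precompact UU Hu eu r0 e20.
exists E => // k l Ek El.
have Hw : Hclass (4 * K) (fun x => u k x - u l x)%R by exact: HclassB.
have [Lw _ _ _] := Hw.
pose w x := (u k x - u l x)%R.
have mS : measurable_fun setT (smooth2 (2^-1 ^+ J)%R w).
  by apply: measurable_smooth; apply: measurable_smooth; exact: Lw.1.
rewrite (_ : (fun x => _) = (fun x => (w x - smooth2 (2^-1 ^+ J)%R w x) + smooth2 (2^-1 ^+ J)%R w x)%R); last first.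
  by apply/funext => x; rewrite subrK.
apply: le_trans (@wnormD R n q c q_gt2 (fun x => w x - smooth2 (2^-1 ^+ J) w x)%R _ _ mS) _.
  by apply: measurable_funB => //; exact: Lw.1.
rewrite (splitr eps) EFinD; apply: leeD; last exact: hE.
by apply: le_trans (hA _ _ J Hw) _; rewrite lee_fin.
Qed.

End compactness.

(** * The exponential kernel *)

Section exponential_kernel_1D.
Context {R : realType}.
Implicit Types t z : R.
Local Notation leb := (@lebesgue_measure R).

(** Adding 1 to the cosine makes the integrand nonnegative, so that the fundamental theorem of
    calculus on the half line applies. The case z = 0 is then subtracted. *)
Lemma integral_exp_cos1 z :
  (\int[leb]_t (expR (- `|t|) * (1 + cos (z * t)))%:E = (2 + 2 / (1 + z ^+ 2))%:E)%E.
Proof.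
have dp : 0 < 1 + z ^+ 2 by rewrite ltr_pwDl// sqr_ge0.
have d0 : 1 + z ^+ 2 != 0 by rewrite gt_eqF.
have c0 t : 0 <= 1 + cos (z * t) by have := cos_geN1 (z * t); lra.
have zc : continuous (fun t => z * t) by move=> t; apply: cvgM; [exact: cvg_cst|exact: cvg_id].
have cc : continuous (fun t => cos (z * t)).
  by move=> t; exact: (continuous_comp (zc t) (continuous_cos (x := z * t))).
have sc : continuous (fun t => sin (z * t)).
  by move=> t; exact: (continuous_comp (zc t) (continuous_sin (x := z * t))).
have ec : continuous (fun t : R => expR (- t)).
  have oc : continuous (fun t : R => - t) by move=> t; apply: cvgN; exact: cvg_id.
  by move=> t; exact: (continuous_comp (oc t) (continuous_expR (x := - t))).
rewrite ge0_symfun_integralT; last 3 first.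
- by move=> t; rewrite mulr_ge0// expR_ge0.
- move=> t; apply: cvgM; first by apply: (continuous_comp (norm_continuous (x := t)) (ec `|t|)).
  by apply: cvgD; [exact: cvg_cst|exact: cc].
- by move=> t /=; rewrite normrN mulrN cosN.
pose f t := expR (- t) * (1 + cos (z * t)).
(* The antiderivative of exp (-t) (1 + cos (z t)) that vanishes at +oo. *)
pose F t := expR (- t) * ((z * sin (z * t) - cos (z * t)) / (1 + z ^+ 2) - 1).
have cf : continuous f.
  by move=> t; apply: cvgM; [exact: ec|apply: cvgD; [exact: cvg_cst|exact: cc]].
have cF : continuous F.
  move=> t; apply: cvgM; [exact: ec|apply: cvgB; last exact: cvg_cst].
  apply: cvgM; last exact: cvg_cst.
  by apply: cvgB; [apply: cvgM; [exact: cvg_cst|exact: sc]|exact: cc].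
have dF t : is_derive t (1:R) F (f t).
  have h0 : is_derive t (1:R) (fun t => - t) (- 1).
    by apply: is_deriveN.
  have h1 : is_derive t (1:R) (fun t => expR (- t)) (- expR (- t)).
    by have := is_derive1_comp (is_derive_expR (- t)) h0; rewrite mulrN1.
  have hz : is_derive t (1:R) (fun t => z * t) z.
    by have := @is_deriveZ R _ _ id z t 1 1 (is_derive_id _ _); rewrite [X in is_derive _ _ _ X]mulr1.
  have h2 : is_derive t (1:R) (fun t => sin (z * t)) (cos (z * t) * z).
    exact: (is_derive1_comp (is_derive_sin (z * t)) hz).
  have h3 : is_derive t (1:R) (fun t => cos (z * t)) (- sin (z * t) * z).
    exact: (is_derive1_comp (is_derive_cos (z * t)) hz).
  have h4 := is_deriveB (is_deriveZ z h2) h3.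
  have h5 := is_deriveB (is_deriveZ (1 + z ^+ 2)^-1 h4) (is_derive_cst (1:R) t 1).
  have h6 := is_deriveM h1 h5.
  have -> : F = (fun t => expR (- t)) * ((1 + z ^+ 2)^-1 *: (z *: (fun t => sin (z * t)) - (fun t => cos (z * t))) - cst 1).
    by apply/funext => x; rewrite /F /= [_ / (1 + _)]mulrC.
  apply: is_derive_eq h6 _.
  change (expR (- t) * ((1 + z ^+ 2)^-1 * (z * (cos (z * t) * z) - - sin (z * t) * z) - 0) +
    ((1 + z ^+ 2)^-1 * (z * sin (z * t) - cos (z * t)) - 1) * - expR (- t) = f t).
  by rewrite /f; field; exact: d0.
have E : (\int[leb]_(x in [set x | (0 <= x)%R]) (expR (- `|x|) * (1 + cos (z * x)))%:E =
    \int[leb]_(x in `[0%R, +oo[) (f x)%:E)%E.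
  rewrite -set_itvcy; apply: eq_integral => t.
  by rewrite inE/= in_itv/= andbT => t0; rewrite /f ger0_norm.
rewrite E.
rewrite (@ge0_continuous_FTC2y _ f F 0 0).
- rewrite -EFinB -EFinM /F !(oppr0, expR0, mulr0, sin0, cos0, mul1r, sub0r); congr EFin; field.
  exact: d0.
- by move=> t _; rewrite mulr_ge0// expR_ge0.
- exact: continuous_subspaceT.
- pose B := (`|z| + 1) / (1 + z ^+ 2) + 1.
  have B0 : 0 <= B by rewrite addr_ge0// divr_ge0 ?(ltW dp)// addr_ge0.
  have FB t : `|F t| <= B * expR (- t).
    rewrite /F normrM ger0_norm ?expR_ge0// mulrC ler_wpM2r ?expR_ge0//.
    apply: le_trans (ler_normB _ _) _; rewrite normr1 lerD2r normrM normfV (gtr0_norm dp).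
    rewrite ler_wpM2r ?invr_ge0 ?(ltW dp)//.
    apply: le_trans (ler_normB _ _) _; apply: lerD; last by rewrite ler_norml cos_geN1 cos_le1.
    by rewrite normrM ler_piMr// ler_norml sin_geN1 sin_le1.
  have Be : B * expR (- t) @[t --> +oo] --> (0:R).
    by rewrite -(mulr0 B); apply: cvgM; [exact: cvg_cst|exact: cvgr_expR].
  apply: (@squeeze_cvgr _ _ _ _ (fun t => - (B * expR (- t))) (fun t => B * expR (- t))) => //.
  + by apply: nearW => t; rewrite -ler_norml.
  + by rewrite -oppr0; exact: cvgN.
- by move=> t _; have [] := dF t.
- by apply: cvg_at_right_filter; exact: cF.
- by move=> t _; rewrite derive1E; have [_ ->] := dF t.
Qed.

Lemma integral_exp : (\int[leb]_t (expR (- `|t|))%:E = 2%:E)%E.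
Proof.
have := integral_exp_cos1 0.
have -> : (\int[leb]_t (expR (- `|t|) * (1 + cos (0 * t)))%:E = 2%:E * \int[leb]_t (expR (- `|t|))%:E)%E.
  rewrite -ge0_integralZl; [|by []| |by move=> t _; rewrite lee_fin expR_ge0|by []]; last first.
    by apply/measurable_EFinP; apply: measurableT_comp => //; exact: measurableT_comp.
  by apply: eq_integral => t _; rewrite -EFinM mul0r cos0 mulrC.
move=> /(congr1 (fun x => (2^-1%:E * x)%E)).
rewrite muleA -!EFinM mulVf// mul1e => ->; congr EFin.
by rewrite expr0n/=; field.
Qed.

Lemma integrable_exp : leb.-integrable setT (EFin \o (fun t => expR (- `|t|))).
Proof.
apply/integrableP; split.
  by apply/measurable_EFinP; apply: measurableT_comp => //; exact: measurable_funN.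
under eq_integral do rewrite gee0_abs ?lee_fin ?expR_ge0//.
by rewrite integral_exp ltry.
Qed.

Lemma Rintegral_exp_cos z : Rintegral leb setT (fun t => expR (- `|t|) * cos (z * t)) = 2 / (1 + z ^+ 2).
Proof.
have me : measurable_fun setT (fun t : R => expR (- `|t|)).
  by apply: measurableT_comp => //; exact: measurable_funN.
have mc : measurable_fun setT (fun t : R => cos (z * t)) by meas.
have i2 : leb.-integrable setT (EFin \o (fun t => expR (- `|t|) * cos (z * t))).
  apply: le_integrable integrable_exp => //; first by apply/measurable_EFinP; exact: measurable_funM.
  move=> t _ /=; rewrite lee_fin normrM ler_piMr// ler_norml cos_geN1 cos_le1//.
have := congr1 fine (integral_exp_cos1 z) => /=.
under eq_integral do rewrite mulrDr mulr1.
rewrite -/(Rintegral leb setT (fun t => expR (- `|t|) + expR (- `|t|) * cos (z * t))).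
rewrite RintegralD//; last exact: integrable_exp.
have -> : Rintegral leb setT (fun t => expR (- `|t|)) = 2 by rewrite /Rintegral integral_exp.
lra.
Qed.

Lemma integral_oneDsqr : (\int[leb]_z (2 / (1 + z ^+ 2))%:E = (2 * pi)%:E)%E.
Proof.
have d0 z : 0 < 1 + z ^+ 2 by rewrite ltr_pwDl// sqr_ge0.
rewrite ge0_symfun_integralT; last 3 first.
- by move=> z; rewrite divr_ge0// ltW.
- move=> z; apply: cvgM; first exact: cvg_cst.
  exact: (@continuous_oneDsqrV R z).
- by move=> z /=; rewrite sqrrN.
rewrite -set_itvcy; under eq_integral do rewrite EFinM.
rewrite ge0_integralZl//; last 2 first.
- apply/measurable_EFinP; apply: measurable_funTS; apply: continuous_measurable_fun.
  exact: continuous_oneDsqrV.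
- by move=> z _; rewrite lee_fin invr_ge0 ltW.
by rewrite integral0y_oneDsqr -!EFinM; congr EFin; field.
Qed.

End exponential_kernel_1D.

(** * Signed integrals on R^n and the product of exponential kernels *)

Section Rintegral_change_of_variable.
Context d (T : measurableType d) (R : realType) (mu : {measure set T -> \bar R}).
Local Open Scope ereal_scope.

(** Changes of variables are known for nonnegative functions; through the positive and the negative
    part they extend to integrable ones. *)
Lemma Rintegral_change (phi : T -> T) (c : R) (f : T -> R) : (0 <= c)%R ->
  measurable_fun setT phi ->
  (forall g : T -> \bar R, measurable_fun setT g -> (forall x, 0 <= g x) ->
    \int[mu]_x g (phi x) = c%:E * \int[mu]_x g x) ->
  mu.-integrable setT (EFin \o f) ->
  mu.-integrable setT (EFin \o (f \o phi)) /\
  Rintegral mu setT (f \o phi) = (c * Rintegral mu setT f)%R.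
Proof.
move=> c0 mphi h fi; have /integrableP[mf foo] := fi.
have mfphi : measurable_fun setT (EFin \o (f \o phi)) by exact: measurableT_comp mf mphi.
have fphi : mu.-integrable setT (EFin \o (f \o phi)).
  apply/integrableP; split => //.
  rewrite (h (fun x => `|(f x)%:E|))//; last exact: measurableT_comp.
  by rewrite lte_mul_pinfty.
split=> //; rewrite /Rintegral integralE [in RHS]integralE.
have -> : \int[mu]_x (fun y => (EFin \o (f \o phi)) y)^\+ x = c%:E * \int[mu]_x (EFin \o f)^\+ x.
  rewrite -h//; [|exact: measurable_funepos].
  by apply: eq_integral => x _; rewrite !funeposE.
have -> : \int[mu]_x (fun y => (EFin \o (f \o phi)) y)^\- x = c%:E * \int[mu]_x (EFin \o f)^\- x.
  rewrite -h//; [|exact: measurable_funeneg].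
  by apply: eq_integral => x _; rewrite !funenegE.
have p := integrable_pos_fin_num measurableT fi.
have n := integrable_neg_fin_num measurableT fi.
rewrite -(fineK p) -(fineK n) -!EFinM -!EFinB /=.
by rewrite mulrBr.
Qed.

End Rintegral_change_of_variable.

Section Rintegral_Rn.
Context {R : realType}.
Local Notation mu n := (lebesgue_Rn n : {sigma_finite_measure set (Rn R n) -> \bar R}).
Local Notation I n f := (Rintegral (mu n) setT f).
Local Notation integrable n f := ((mu n).-integrable setT (EFin \o f)).

Lemma Rintegral_shift n (f : Rn R n -> R) (a : Rn R n) : integrable n f ->
  integrable n (fun x => f (x + a)) /\ I n (fun x => f (x + a)) = I n f.
Proof.
move=> fi; have [] := @Rintegral_change _ _ _ (mu n) (fun x => x + a) 1 f ler01 _ _ fi.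
- by meas.
- by move=> g mg g0; rewrite mul1e; exact: ge0_integral_shift.
- by rewrite mul1r.
Qed.

Lemma Rintegral_opp n (f : Rn R n -> R) : integrable n f -> I n (fun x => f (- x)) = I n f.
Proof.
move=> fi; have [] := @Rintegral_change _ _ _ (mu n) -%R 1 f ler01 _ _ fi.
- exact: measurable_oppRn.
- by move=> g mg g0; rewrite mul1e; exact: ge0_integral_opp.
- by rewrite mul1r.
Qed.

Lemma Rintegral_dilation n (f : Rn R n -> R) (t : R) : 0 < t -> integrable n f ->
  integrable n (fun x => f (t *: x)) /\ I n (fun x => f (t *: x)) = t^-1 ^+ n * I n f.
Proof.
move=> t0 fi; apply: (@Rintegral_change _ _ _ (mu n) (fun x => t *: x)) fi.
- by rewrite exprn_ge0// invr_ge0 ltW.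
- by meas.
- by move=> g mg g0; exact: ge0_integral_dilation.
Qed.

Lemma Rintegral_cons n (f : Rn R n.+1 -> R) : integrable n.+1 f ->
  I n.+1 f = Rintegral (@lebesgue_measure R) setT (fun t => I n (fun x => f (cons_Rn (t, x)))).
Proof.
move=> /integrableP[mf foo]; pose m2 := (@lebesgue_measure R \x mu n)%E.
have mc := @measurable_cons_Rn R n.
have mabs : measurable_fun setT (fun y : Rn R n.+1 => `|f y|%:E).
  by apply/measurable_EFinP; apply: measurableT_comp => //; exact/measurable_EFinP.
have iF : m2.-integrable setT (EFin \o (f \o @cons_Rn R n)).
  apply/integrableP; split; first exact: measurableT_comp mf mc.
  move: foo; rewrite /= /cons_measure.
  rewrite (@ge0_integral_pushforward _ _ _ _ _ (@cons_Rn R n))//.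
have -> : I n.+1 f = fine (\int[m2]_p (f (cons_Rn p))%:E)%E.
  by rewrite /Rintegral /= /cons_measure (integral_pushforward mc mf).
rewrite -(integral12_prod_meas1 iF) /Rintegral; congr fine.
have mF := measurable_int _ iF.
apply: ae_eq_integral => //.
- exact: measurable_integral_param.
- apply/measurable_EFinP; apply: measurableT_comp; first exact: fine_measurable.
  exact: (@measurable_integral_param _ _ _ _ _ (mu n) (EFin \o (f \o @cons_Rn R n)) mF).
- have [N [mN N0 hN]] := ae_integrable1 iF.
  exists N; split => // x /= h; apply: hN => /= ix; apply: h => _.
  by rewrite fineK// integrable_fin_num.
Qed.

Lemma integrable_mul_bounded n (f g : Rn R n -> R) (M : R) : integrable n f ->
  measurable_fun setT g -> (forall x, `|g x| <= M) -> integrable n (fun x => f x * g x).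
Proof.
move=> fi mg gM; have M0 : 0 <= M by apply: le_trans (gM 0); exact: normr_ge0.
have mf : measurable_fun setT f by apply/measurable_EFinP; exact: measurable_int fi.
have := integrableZl measurableT M fi; apply: le_integrable => //.
  by apply/measurable_EFinP; meas.
move=> x _ /=; rewrite lee_fin !normrM (ger0_norm M0) mulrC.
by rewrite ler_wpM2r.
Qed.

(** The l^1 norm is chosen because exp (-|x|_1) is a product over the coordinates, so that its
    Fourier transform reduces to dimension one. *)
Definition l1norm n (x : Rn R n) : R := \sum_(i < n) `|tnth x i|.

Lemma l1norm_ge0 n (x : Rn R n) : 0 <= l1norm x. Proof. exact: sumr_ge0. Qed.

Lemma l1normZ n (t : R) (x : Rn R n) : 0 < t -> l1norm (t *: x) = t * l1norm x.
Proof. by move=> t0; rewrite mulr_sumr; apply: eq_bigr => i _; rewrite tnthZ normrM gtr0_norm. Qed.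

Lemma measurable_l1norm n : measurable_fun setT (@l1norm n).
Proof. by rewrite /l1norm; meas. Qed.

Lemma integrable_expk n : integrable n (fun x => expR (- l1norm x)).
Proof.
have ml := @measurable_l1norm n.
apply/integrableP; split; first by rewrite /comp; meas.
under eq_integral do rewrite gee0_abs ?lee_fin ?expR_ge0//.
have -> : (\int[mu n]_x (expR (- l1norm x))%:E = \int[mu n]_x (\prod_(i < n) expR (- `|tnth x i|))%:E)%E.
  by apply: eq_integral => x _; rewrite /l1norm -sumrN expR_sum.
rewrite (@ge0_integral_prod_tnth R (fun t => expR (- `|t|)) 2).
- exact: ltry.
- by meas.
- by move=> t; exact: expR_ge0.
- exact: integral_exp.
Qed.

(** The Fourier transform of exp (-|x|_1), without normalisation. Being nonnegative of mass (2
    pi)^n, it acts as an approximate identity and fixes the constant of Plancherel's theorem. *)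
Definition pkernel n (z : Rn R n) : R := \prod_(i < n) (2 / (1 + tnth z i ^+ 2)).

Lemma pkernel_ge0 n (z : Rn R n) : 0 <= pkernel z.
Proof. by apply: prodr_ge0 => i _; rewrite divr_ge0// addr_ge0// sqr_ge0. Qed.

Lemma measurable_pkernel n : measurable_fun setT (@pkernel n).
Proof.
apply: measurable_prod => i _.
apply: (@measurableT_comp _ _ _ _ _ _ (fun t : R => 2 / (1 + t ^+ 2))); last exact: measurable_tnth.
apply: measurable_funM => //; apply: continuous_measurable_fun.
exact: continuous_oneDsqrV.
Qed.

Lemma integral_pkernel n : (\int[mu n]_z (pkernel z)%:E = ((2 * pi) ^+ n)%:E)%E.
Proof.
apply: (@ge0_integral_prod_tnth R (fun t => 2 / (1 + t ^+ 2))).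
- apply: measurable_funM => //; apply: continuous_measurable_fun.
  exact: continuous_oneDsqrV.
- by move=> t; rewrite divr_ge0// addr_ge0// sqr_ge0.
- exact: integral_oneDsqr.
Qed.

Lemma Rintegral_expk_sin n (z : Rn R n) : I n (fun x => expR (- l1norm x) * sin (dotRn z x)) = 0.
Proof.
have fi : integrable n (fun x => expR (- l1norm x) * sin (dotRn z x)).
  apply: (integrable_mul_bounded (M := 1) (integrable_expk n)).
    by meas.
  by move=> x; rewrite ler_norml sin_geN1 sin_le1.
have := Rintegral_opp fi.
have -> : (fun x => expR (- l1norm (- x)) * sin (dotRn z (- x))) =
    (fun x => -1 * (expR (- l1norm x) * sin (dotRn z x))).
  apply/funext => x; rewrite dotRnNr sinN mulrN mulN1r; congr (- (expR (- _) * _)).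
  by apply: eq_bigr => i _; rewrite tnthN normrN.
rewrite RintegralZl// mulN1r; lra.
Qed.

(** Splitting off one coordinate, the addition formula for the cosine leaves a product of cosines
    and a product of sines; the latter integrates to 0 by oddness. *)
Lemma Rintegral_expk_cos n (z : Rn R n) :
  I n (fun x => expR (- l1norm x) * cos (dotRn z x)) = pkernel z.
Proof.
have ml k := @measurable_l1norm k.
have ic k (w : Rn R k) : integrable k (fun x => expR (- l1norm x) * cos (dotRn w x)).
  apply: (integrable_mul_bounded (M := 1) (integrable_expk k)); first by meas.
  by move=> x; rewrite ler_norml cos_geN1 cos_le1.
have is_ k (w : Rn R k) : integrable k (fun x => expR (- l1norm x) * sin (dotRn w x)).
  apply: (integrable_mul_bounded (M := 1) (integrable_expk k)); first by meas.
  by move=> x; rewrite ler_norml sin_geN1 sin_le1.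
elim: n z => [|n ih] z.
  rewrite /pkernel big_ord0 (_ : (fun x => _) = cst 1).
    by rewrite /Rintegral /= integral_dirac// diracT mul1e.
  by apply/funext => x; rewrite /l1norm /dotRn !big_ord0 oppr0 expR0 cos0 mulr1.
rewrite Rintegral_cons//; have [t0 [w ->]] := Rn_consP z.
transitivity (Rintegral (@lebesgue_measure R) setT (fun t => pkernel w * (expR (- `|t|) * cos (t0 * t)))).
  apply: eq_Rintegral => t _; rewrite -ih mulrC.
  have -> : (fun x => expR (- l1norm (cons_Rn (t, x))) * cos (dotRn (cons_Rn (t0, w)) (cons_Rn (t, x)))) =
     (fun x => (expR (- `|t|) * cos (t0 * t)) * (expR (- l1norm x) * cos (dotRn w x)) -
               (expR (- `|t|) * sin (t0 * t)) * (expR (- l1norm x) * sin (dotRn w x))).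
    apply/funext => x; rewrite /l1norm /dotRn !big_ord_recl !tnth_cons_Rn0.
    under eq_bigr do rewrite tnth_cons_RnS.
    under [in cos _]eq_bigr do rewrite !tnth_cons_RnS.
    rewrite opprD expRD cosD; ring.
  rewrite RintegralB//; last 2 first.
  - by have := integrableZl measurableT (expR (- `|t|) * cos (t0 * t)) (ic n w).
  - by have := integrableZl measurableT (expR (- `|t|) * sin (t0 * t)) (is_ n w).
  by rewrite !RintegralZl// Rintegral_expk_sin mulr0 subr0.
rewrite RintegralZl//; last first.
  apply: le_integrable integrable_exp => //; first by apply/measurable_EFinP; meas.
  by move=> t _ /=; rewrite lee_fin normrM ler_piMr// ler_norml cos_geN1 cos_le1.
rewrite Rintegral_exp_cos /pkernel big_ord_recl tnth_cons_Rn0 mulrC; congr (_ * _).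
by apply: eq_bigr => i _; rewrite tnth_cons_RnS.
Qed.

End Rintegral_Rn.

(** * Continuity of translations in L^1 *)

Section L1_continuity.
Context {R : realType}.
Local Open Scope ereal_scope.

Lemma cvge0P (a : nat -> \bar R) : (forall k, 0 <= a k) ->
  (forall e : R, (0 < e)%R -> \forall k \near \oo, a k <= e%:E) -> a k @[k --> \oo] --> 0.
Proof.
move=> a0 ha; apply/fine_cvgP; split.
  have := ha 1%R ltr01; apply: filterS => k ak.
  by rewrite ge0_fin_numE//; exact: le_lt_trans ak (ltry _).
apply/cvgrPdist_le => e e0; have := ha e e0; apply: filterS => k ak.
rewrite sub0r normrN ger0_norm ?fine_ge0//.
by rewrite -lee_fin fineK// ge0_fin_numE//; exact: le_lt_trans ak (ltry _).
Qed.

Lemma cvge0_le (a : nat -> \bar R) (e : R) : a k @[k --> \oo] --> 0 -> (0 < e)%R ->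
  \forall k \near \oo, a k <= e%:E.
Proof.
move=> /fine_cvgP[af /cvgrPdist_le a0] e0; have := a0 _ e0; apply: filterS2 af => k af.
rewrite sub0r normrN => h; rewrite -(fineK af) lee_fin.
exact: le_trans (ler_norm _) h.
Qed.

(** Convergence is asked only where Phi is finite. In [L1_translation], Phi x is twice the L^1 norm
    of a slice, and the slices converge when they are integrable. *)
Lemma cvg_integral_dominated0 d (T : measurableType d) (mu : {measure set T -> \bar R})
    (phi : nat -> T -> \bar R) (Phi : T -> \bar R) :
  (forall k, measurable_fun setT (phi k)) -> measurable_fun setT Phi ->
  (forall k x, 0 <= phi k x <= Phi x) -> \int[mu]_x Phi x < +oo ->
  {ae mu, forall x, Phi x < +oo -> phi k x @[k --> \oo] --> 0} ->
  \int[mu]_x phi k x @[k --> \oo] --> 0.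
Proof.
move=> mphi mPhi phi01 Phioo phi0.
have P0 x : 0 <= Phi x by have /andP[h1 h2] := phi01 0%N x; exact: le_trans h2.
have iPhi : mu.-integrable setT Phi.
  by apply/integrableP; split => //; under eq_integral do rewrite gee0_abs//.
have h1 : {ae mu, forall x, setT x -> phi k x @[k --> \oo] --> (cst 0 : T -> \bar R) x}.
  apply: filterS2 phi0 (integrable_ae measurableT iPhi) => x hx /(_ Logic.I) Px _.
  by apply: hx; rewrite -ge0_fin_numE.
have h2 : {ae mu, forall x k, setT x -> `|phi k x| <= Phi x}.
  apply: aeW => x k _; have /andP[p1 p2] := phi01 k x.
  by rewrite gee0_abs.
have [_ _] := dominated_convergence measurableT mphi (@measurable_cst _ _ _ _ _ 0) h1 iPhi h2.
by rewrite integral0.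
Qed.

Lemma cvg_norm_EFin0 (a : nat -> R) (l : R) : a k @[k --> \oo] --> l ->
  (`|a k - l|%R)%:E @[k --> \oo] --> 0.
Proof.
move=> /cvgrPdist_le al; apply: cvge0P => // e e0.
by apply: filterS (al _ e0) => k; rewrite lee_fin distrC.
Qed.

Lemma lty_mul2 (x : \bar R) : 0 <= x -> 2%:E * x < +oo -> x < +oo.
Proof.
case: x => [r _ _||]; [exact: ltry| |by []].
by move=> _; rewrite gt0_muley.
Qed.

Lemma integral_diff_le d (T : measurableType d) (mu : {measure set T -> \bar R})
    (u : T -> R) (tau : T -> T) : measurable_fun setT u -> measurable_fun setT tau ->
  \int[mu]_x `|u (tau x)|%:E = \int[mu]_x `|u x|%:E ->
  \int[mu]_x `|u (tau x) - u x|%:E <= 2%:E * \int[mu]_x `|u x|%:E.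
Proof.
move=> mu_ mt h.
have mut : measurable_fun setT (fun x => u (tau x)) by exact: measurableT_comp.
have -> : (2%:E : \bar R) = 1 + 1 by rewrite -EFinD.
rewrite ge0_muleDl// !mul1e -{1}h -ge0_integralD//; [|by meas|by meas].
apply: ge0_le_integral => //; [by meas|by meas|].
by move=> x _; rewrite -EFinD lee_fin ler_normB.
Qed.

Local Notation leb := (@lebesgue_measure R).

Lemma L1_approx_continuous (f : R -> R) (e : R) : leb.-integrable setT (EFin \o f) ->
  (0 < e)%R -> exists (N : R) (g : R -> R), [/\ (0 < N)%R, continuous g &
    \int[leb]_t (`|f t - \1_(`[(- N)%R, N]%classic) t * g t|)%:E <= e%:E].
Proof.
move=> fi e0; have /integrableP[mf foo] := fi.
have mf' : measurable_fun setT f by exact/measurable_EFinP.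
have e20 : (0 < e / 2)%R by rewrite divr_gt0.
pose E (k : nat) := `[(- k.+1%:R)%R, (k.+1%:R : R)]%classic.
have mE k : measurable (E k) by exact: measurable_itv.
have m1 k : measurable_fun setT (\1_(E k) : R -> R) by exact: measurable_indic.
have tail : \int[leb]_t (`|f t - \1_(E k) t * f t|)%:E @[k --> \oo] --> 0.
  apply: (@cvg_integral_dominated0 _ (measurableTypeR R) leb (fun k t => (`|f t - \1_(E k) t * f t|)%:E) (fun t => `|f t|%:E)).
  - move=> k; apply/measurable_EFinP; apply: measurableT_comp => //.
    by apply: measurable_funB; [exact: mf'|apply: measurable_funM; [exact: (m1 k)|exact: mf']].
  - by apply/measurable_EFinP; exact: measurableT_comp.
  - move=> k t; rewrite !lee_fin normr_ge0/= indicE.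
    by case: (t \in E k); rewrite ?mul1r ?subrr ?normr0 ?mul0r ?subr0.
  - exact: foo.
  - apply: aeW => t _; apply: (cvg_near_cst); near=> k; rewrite indicE mem_set ?mul1r ?subrr ?normr0//.
    rewrite /E/= in_itv/= -ler_norml; apply/ltW/(lt_trans (archi_boundP (normr_ge0 t))).
    by rewrite ltr_nat ltnS; near: k; exact: nbhs_infty_ge.
have [k _ /(_ k (leqnn k)) hk] := cvge0_le tail e20.
have lebE : leb (E k) < +oo.
  rewrite /E; apply: (@le_lt_trans _ _ (k.+1%:R + k.+1%:R)%:E); last exact: ltry.
  rewrite lebesgue_measure_itv/=; case: ifP => _; last by rewrite lee_fin addr_ge0.
  by rewrite -EFinB opprK.
have [g_ [gc gi /cvge0_le/(_ e20)[j _ /(_ j (leqnn j)) hj]]] :=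
  approximation_continuous_integrable (mE k) lebE (@integrableS _ (measurableTypeR R) _ leb setT (E k) _ measurableT (mE k) (@subsetT _ _) fi).
exists k.+1%:R, (g_ j); split => //; rewrite -/(E k).
have mg : measurable_fun setT (g_ j) by exact: continuous_measurable_fun.
rewrite (splitr e) EFinD; apply: le_trans (leeD hk hj).
have -> : \int[leb]_(t in E k) `|(f t - g_ j t)%:E| = \int[leb]_t (\1_(E k) t * `|f t - g_ j t|)%:E.
  exact: (@integral_indic_mkcond _ (measurableTypeR R) R leb (E k) (fun t => `|f t - g_ j t|%R)).
have mfB (w : R -> R) : measurable_fun setT w ->
    measurable_fun [set: measurableTypeR R] (fun t : measurableTypeR R => (`|f t - \1_(E k) t * w t|)%:E).
  move=> mw; apply/measurable_EFinP; apply: measurableT_comp => //.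
  by apply: measurable_funB; [exact: mf'|apply: measurable_funM; [exact: (m1 k)|exact: mw]].
have mEfg : measurable_fun [set: measurableTypeR R] (fun t : measurableTypeR R => (\1_(E k) t * `|f t - g_ j t|)%:E).
  apply/measurable_EFinP; apply: measurable_funM; first exact: (m1 k).
  by apply: measurableT_comp => //; exact: (measurable_funB mf' mg).
rewrite -ge0_integralD//.
- apply: ge0_le_integral => //.
  + exact: mfB.
  + by apply: emeasurable_funD; [exact: mfB|exact: mEfg].
  + move=> t _; rewrite -EFinD lee_fin indicE.
    by case: (t \in E k); rewrite ?mul1r ?subrr ?normr0 ?add0r ?mul0r ?subr0 ?addr0.
- exact: mfB.
Unshelve. all: by end_near. Qed.

Lemma L1_translation_itv (g : R -> R) (N : R) (z : nat -> R) : (0 < N)%R -> continuous g ->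
  z k @[k --> \oo] --> (0 : R)%R ->
  let h t := (\1_(`[(- N)%R, N]%classic) t * g t)%R in
  \int[leb]_t (`|h (t + z k) - h t|)%:E @[k --> \oo] --> 0.
Proof.
move=> N0 gc z0 h.
have NN : (- N <= N)%R by lra.
have [B B0 zB] : exists2 B : R, (0 <= B)%R & forall k, (`|z k| <= B)%R.
  have [B [_ hB]] := cvg_seq_bounded (cvgP _ z0).
  exists (`|B| + 1)%R; first by rewrite addr_ge0.
  by move=> k; apply: hB => //; rewrite (le_lt_trans (ler_norm _))// ltrDl.
have [M M0 hM] : exists2 M : R, (0 <= M)%R & forall t, (`|h t| <= M)%R.
  have gc' : {within `[(- N)%R, N], continuous (fun t => `|g t|%R)}.
    apply: continuous_subspaceT => t.
    exact: (continuous_comp (gc t) (norm_continuous (x := g t))).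
  have [c _ hc] := EVT_max NN gc'.
  exists `|g c|%R => // t; rewrite /h indicE.
  have [/set_mem tN|_] := boolP (t \in _); rewrite ?mul1r ?mul0r ?normr0//.
  by exact: hc.
have mh : measurable_fun setT h.
  apply: measurable_funM; last exact: continuous_measurable_fun.
  exact: measurable_indic.
pose D := `[(- (N + B))%R, (N + B)%R]%classic.
have lD : leb D < +oo.
  rewrite /D lebesgue_measure_itv/=; case: ifP => _ //.
  by rewrite -EFinB ltry.
have mD : measurable_fun setT (\1_D : R -> R) by apply: measurable_indic; exact: measurable_itv.
apply: (@cvg_integral_dominated0 _ (measurableTypeR R) leb (fun k t => (`|h (t + z k) - h t|)%:E) (fun t => (2 * M * \1_D t)%:E)).
- move=> k; apply/measurable_EFinP; apply: measurableT_comp => //.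
  apply: measurable_funB => //; apply: measurableT_comp => //; exact: measurable_funD.
- by apply/measurable_EFinP; apply: measurable_funM; [exact: measurable_cst|exact: mD].
- move=> k t; rewrite !lee_fin normr_ge0/= [\1_D t]indicE.
  have hz u : ~ (`|u| <= N)%R -> h u = 0%R.
    move=> uN; rewrite /h indicE memNset ?mul0r//= in_itv/= -ler_norml; exact: uN.
  have [tD|tD] := boolP (t \in D).
    by rewrite mulr1; apply: le_trans (ler_normB _ _) _; have := hM t; have := hM (t + z k)%R; lra.
  have tN : ~ (`|t| <= N + B)%R.
    by move/negP: tD => tD h1; apply: tD; apply/mem_set; rewrite /D/= in_itv/= -ler_norml.
  rewrite !hz ?subrr ?normr0 ?mulr0//; last first.
    move=> h1; apply: tN; have := zB k; have := ler_normB (t + z k)%R (z k); rewrite addrK; lra.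
  by move=> h1; apply: tN; rewrite ler_wpDr.
- under eq_integral do rewrite EFinM.
  rewrite ge0_integralZl//; last 2 first.
  + by apply/measurable_EFinP; exact: mD.
  + by rewrite lee_fin mulr_ge0.
  rewrite integral_indic//; last exact: measurable_itv.
  by rewrite setIT lte_mul_pinfty// lee_fin mulr_ge0.
have hc t : `|t|%R != N -> {for t, continuous h}.
  move=> tN; have [tN'|tN'] := ltP `|t|%R N.
    have ht : h t = g t by rewrite /h indicE mem_set ?mul1r//= in_itv/= -ler_norml ltW.
    change (h u @[u --> t] --> h t); rewrite ht; apply: cvg_trans (gc t); apply: near_eq_cvg.
    apply/nbhs_ballP; exists (N - `|t|)%R; rewrite /= ?subr_gt0// => u tu.
    rewrite /h indicE mem_set ?mul1r//= in_itv/= -ler_norml.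
    have := ler_normB t (t - u)%R; rewrite opprB addrC subrK; move: tu; rewrite /ball/=; lra.
  have tN2 : (N < `|t|)%R by rewrite lt_neqAle eq_sym tN.
  have hz u : (N < `|u|)%R -> h u = 0%R.
    by move=> uN; rewrite /h indicE memNset ?mul0r//= in_itv/= -ler_norml leNgt uN.
  change (h u @[u --> t] --> h t); rewrite (hz t tN2); apply: cvg_near_cst.
  apply/nbhs_ballP; exists (`|t| - N)%R; rewrite /= ?subr_gt0// => u tu; apply: hz.
  have := ler_normD u (t - u)%R; rewrite addrC subrK; move: tu; rewrite /ball/=; lra.
exists ([set N] `|` [set (- N)%R]); split.
- by apply: measurableU; exact: measurable_set1.
- by apply: null_set_setU; [exact: measurable_set1|exact: measurable_set1|exact: lebesgue_measure_set1|exact: lebesgue_measure_set1].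
- move=> t /= h1; apply: contrapT => h2; apply: h1 => _.
  apply: cvg_norm_EFin0.
  have tN : `|t|%R != N.
    apply/eqP => tN; apply: h2; move: tN; case: (ger0P t) => _ tN; [left|right] => //.
    by rewrite -tN opprK.
  have tz : (t + z k)%R @[k --> \oo] --> (t : R).
    by rewrite -[X in _ --> X]addr0; apply: cvgD; [exact: cvg_cst|exact: z0].
  exact: (cvg_comp _ h tz (hc t tN)).
Unshelve. all: by end_near. Qed.

Lemma L1_translation1 (f : R -> R) (z : nat -> R) : leb.-integrable setT (EFin \o f) ->
  z k @[k --> \oo] --> (0 : R)%R ->
  \int[leb]_t (`|f (t + z k) - f t|)%:E @[k --> \oo] --> 0.
Proof.
move=> fi z0; apply: cvge0P => [k|e e0]; first by apply: integral_ge0.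
have e30 : (0 < e / 3)%R by rewrite divr_gt0.
have [N [g [N0 gc hg]]] := L1_approx_continuous fi e30.
have := cvge0_le (L1_translation_itv N0 gc z0) e30.
set h := fun t => (\1_(`[(- N)%R, N]%classic) t * g t)%R.
have mf : measurable_fun setT f by apply/measurable_EFinP; exact: measurable_int fi.
have mh : measurable_fun setT h.
  apply: measurable_funM; last exact: continuous_measurable_fun.
  exact: measurable_indic.
have ms (u : R -> R) (a : R) : measurable_fun setT u -> measurable_fun setT (fun t : R => u (t + a)%R).
  by move=> mu_; apply: measurableT_comp => //; exact: measurable_funD.
have mB (u v : R -> R) : measurable_fun setT u -> measurable_fun setT v ->
    measurable_fun setT (fun t => (`|u t - v t|)%:E).
  by move=> mu_ mv; apply/measurable_EFinP; apply: measurableT_comp => //; exact: measurable_funB.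
apply: filterS => k hk.
apply: (@le_trans _ _ (\int[leb]_t ((`|f (t + z k) - h (t + z k)|)%:E +
   ((`|h (t + z k) - h t|)%:E + (`|f t - h t|)%:E)))).
  apply: ge0_le_integral => //.
  - by apply: mB => //; exact: ms.
  - by apply: emeasurable_funD; [apply: mB; exact: ms|apply: emeasurable_funD; apply: mB => //; exact: ms].
  - move=> t _; rewrite -!EFinD lee_fin.
    have -> : (f (t + z k) - f t = (f (t + z k) - h (t + z k)) + ((h (t + z k) - h t) - (f t - h t)))%R by ring.
    apply: le_trans (ler_normD _ _) _; rewrite lerD2l.
    exact: ler_normB.
rewrite ge0_integralD//; last 3 first.
- by apply: mB; exact: ms.
- by move=> t _; rewrite -EFinD lee_fin addr_ge0.
- by apply: emeasurable_funD; apply: mB => //; exact: ms.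
rewrite (@ge0_integral_shift1 R (fun t => (`|f t - h t|)%:E)); [|exact: mB|by []].
rewrite ge0_integralD//; last 2 first.
- by apply: mB => //; exact: ms.
- exact: mB.
have -> : e%:E = (e / 3)%:E + ((e / 3)%:E + (e / 3)%:E) by rewrite -!EFinD; congr EFin; field.
by apply: leeD => //; apply: leeD.
Qed.

(** Induction on the dimension. A translation by (a, b) is split into one in the last coordinates
    and one in the first; on slices these converge by induction and by the one-dimensional case, and
    dominated convergence integrates the slices. *)
Lemma L1_translation n (f : Rn R n -> R) (z : nat -> Rn R n) :
  measurable_fun setT f -> \int[lebesgue_Rn n]_x `|f x|%:E < +oo ->
  (forall i, tnth (z k) i @[k --> \oo] --> (0 : R)%R) ->
  \int[lebesgue_Rn n]_x (`|f (x + z k) - f x|)%R%:E @[k --> \oo] --> 0.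
Proof.
elim: n f z => [|n ih] f z mf foo z0.
  apply: cvg_near_cst; apply: nearW => k; rewrite -[RHS](integral0 (lebesgue_Rn 0) setT).
  by apply: eq_integral => x _; rewrite (tuple0 (x + z k)%R) (tuple0 x) subrr normr0.
pose a k := (uncons_Rn (z k)).1; pose b k := (uncons_Rn (z k)).2.
have zE k : z k = cons_Rn (a k, b k) by rewrite -surjective_pairing uncons_RnK.
have a0 : a k @[k --> \oo] --> (0 : R)%R.
  by have := z0 ord0; congr (_ --> _); apply/funext => A; congr (_ _); apply/funext => k; rewrite zE.
have b0 i : tnth (b k) i @[k --> \oo] --> (0 : R)%R.
  have -> : (fun k => tnth (b k) i) = (fun k => tnth (z k) (lift ord0 i)).
    by apply/funext => k; rewrite zE tnth_cons_RnS.
  exact: z0.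
have mc : measurable_fun setT (fun p : measurableTypeR R * Rn R n => f (cons_Rn p)).
  by apply: measurableT_comp => //; exact: measurable_cons_Rn.
have m2 (g : measurableTypeR R * Rn R n -> measurableTypeR R * Rn R n) : measurable_fun setT g ->
   measurable_fun setT (fun p => f (cons_Rn (g p))) by move=> mg; exact: (measurableT_comp mc mg).
pose J k (p : measurableTypeR R * Rn R n) := `|f (cons_Rn (p.1, p.2 + b k)) - f (cons_Rn p)|%R%:E.
pose L k (p : measurableTypeR R * Rn R n) := `|f (cons_Rn (p.1 + a k, p.2)) - f (cons_Rn p)|%R%:E.
pose F (p : measurableTypeR R * Rn R n) := `|f (cons_Rn p)|%R%:E.
have mF : measurable_fun setT F by apply/measurable_EFinP; exact: measurableT_comp.
have mJ k : measurable_fun setT (J k).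
  apply/measurable_EFinP; apply: measurableT_comp => //; apply: measurable_funB => //.
  by apply: (m2 (fun p => (p.1, p.2 + b k))%R); apply/measurable_fun_pair => /=; [exact: measurable_fst|by meas].
have mL k : measurable_fun setT (L k).
  apply/measurable_EFinP; apply: measurableT_comp => //; apply: measurable_funB => //.
  by apply: (m2 (fun p => (p.1 + a k, p.2))%R); apply/measurable_fun_pair => /=; [by meas|exact: measurable_snd].
have J0 k p : 0 <= J k p by rewrite lee_fin.
have L0 k p : 0 <= L k p by rewrite lee_fin.
have F0 p : 0 <= F p by rewrite lee_fin.
have Foo : \int[leb]_t \int[lebesgue_Rn n]_x F (t, x) < +oo.
  move: foo; rewrite ge0_integral_cons//.
  by apply/measurable_EFinP; exact: measurableT_comp.
have Foo2 : \int[lebesgue_Rn n]_x \int[leb]_t F (t, x) < +oo.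
  by rewrite -(fubini_tonelli (m1 := leb) F).
have f1 t : measurable_fun setT (fun x => f (cons_Rn (t, x))).
  exact: (measurableT_comp mc (pair1_measurable t)).
have f2 x : measurable_fun setT (fun t => f (cons_Rn (t, x))).
  exact: (measurableT_comp mc (pair2_measurable x)).
have mF1 : measurable_fun setT (fun t => \int[lebesgue_Rn n]_x F (t, x)).
  exact: (measurable_fun_fubini_tonelli_F _ mF).
have mF2 : measurable_fun setT (fun x => \int[leb]_t F (t, x)).
  exact: (measurable_fun_fubini_tonelli_G _ mF).
have hJ : \int[leb]_t \int[lebesgue_Rn n]_x J k (t, x) @[k --> \oo] --> 0.
  apply: (@cvg_integral_dominated0 _ (measurableTypeR R) leb (fun k t => \int[lebesgue_Rn n]_x J k (t, x))
    (fun t => 2%:E * \int[lebesgue_Rn n]_x F (t, x))).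
  - by move=> k; exact: (measurable_fun_fubini_tonelli_F _ (mJ k)).
  - exact: measurable_funeM.
  - move=> k t; rewrite integral_ge0//=.
    apply: (@integral_diff_le _ _ (lebesgue_Rn n) _ (fun x => x + b k)%R (f1 t)); first by meas.
    by rewrite (ge0_integral_shift (b k) (f := fun x => F (t, x)))//; exact: (measurableT_comp mF (pair1_measurable t)).
  - rewrite ge0_integralZl//; first by rewrite lte_mul_pinfty.
    by move=> t _; exact: integral_ge0.
  - apply: aeW => t ht; apply: ih => //.
    by apply: lty_mul2 ht; exact: integral_ge0.
have hL : \int[lebesgue_Rn n]_x \int[leb]_t L k (t, x) @[k --> \oo] --> 0.
  apply: (@cvg_integral_dominated0 _ _ (lebesgue_Rn n) (fun k x => \int[leb]_t L k (t, x))
    (fun x => 2%:E * \int[leb]_t F (t, x))).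
  - by move=> k; exact: (measurable_fun_fubini_tonelli_G _ (mL k)).
  - exact: measurable_funeM.
  - move=> k x; rewrite integral_ge0//=.
    apply: (@integral_diff_le _ _ leb _ (fun t => t + a k)%R (f2 x)); first exact: measurable_funD.
    by rewrite (ge0_integral_shift1 (a k) (f := fun t => F (t, x)))//; exact: (measurableT_comp mF (pair2_measurable x)).
  - rewrite ge0_integralZl//; first by rewrite lte_mul_pinfty.
    by move=> t _; exact: integral_ge0.
  - apply: aeW => x hx; apply: L1_translation1 => //; apply/integrableP; split.
      by apply/measurable_EFinP; exact: f2.
    by apply: lty_mul2 hx; exact: integral_ge0.
have hJL : \int[leb]_t \int[lebesgue_Rn n]_x J k (t, x) + \int[lebesgue_Rn n]_x \int[leb]_t L k (t, x)
    @[k --> \oo] --> 0.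
  by rewrite -[X in _ --> X]adde0; apply: cvgeD.
apply: (squeeze_cvge _ (cvg_cst 0) hJL); apply: nearW => k.
rewrite integral_ge0//=.
have mfz : measurable_fun setT (fun x : Rn R n.+1 => (`|f (x + z k) - f x|)%R%:E).
  by apply/measurable_EFinP; apply: measurableT_comp => //; apply: measurable_funB => //; meas.
pose G (p : measurableTypeR R * Rn R n) := `|f (cons_Rn (p.1 + a k, p.2 + b k)) - f (cons_Rn p)|%R%:E.
(* The increment in the last coordinates appears at the first coordinate t + a k; a shift in t
   removes this displacement from the integral. *)
pose Ja (p : measurableTypeR R * Rn R n) := J k (p.1 + a k, p.2)%R.
have mG : measurable_fun setT G.
  apply/measurable_EFinP; apply: measurableT_comp => //; apply: measurable_funB => //.
  by apply: (m2 (fun p => (p.1 + a k, p.2 + b k))%R); apply/measurable_fun_pair => /=; meas.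
have mJa : measurable_fun setT Ja.
  apply: (measurableT_comp (mJ k)).
  by apply/measurable_fun_pair => /=; [by meas|exact: measurable_snd].
have G0 p : 0 <= G p by rewrite lee_fin.
have Ja0 p : 0 <= Ja p by rewrite lee_fin.
have E : \int[lebesgue_Rn n.+1]_x (`|f (x + z k) - f x|)%R%:E = \int[leb]_t \int[lebesgue_Rn n]_x G (t, x).
  rewrite (ge0_integral_cons mfz); last by move=> x; rewrite lee_fin.
  by apply: eq_integral => t _; apply: eq_integral => x _; rewrite zE -cons_RnD.
rewrite [leLHS]E -(fubini_tonelli (m1 := leb) (L k))//=.
rewrite -(ge0_integral_shift1 (a k) (f := fun t => \int[lebesgue_Rn n]_x J k (t, x))); last 2 first.
- exact: (measurable_fun_fubini_tonelli_F _ (mJ k)).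
- by move=> t; exact: integral_ge0.
have mFG := measurable_fun_fubini_tonelli_F (m2 := lebesgue_Rn n) _ mG G0.
have mFJ := measurable_fun_fubini_tonelli_F (m2 := lebesgue_Rn n) _ mJa Ja0.
have mFL := measurable_fun_fubini_tonelli_F (m2 := lebesgue_Rn n) _ (mL k) (L0 k).
rewrite -ge0_integralD//; last 2 first.
- by move=> t _; exact: integral_ge0.
- by move=> t _; exact: integral_ge0.
apply: ge0_le_integral => //.
- by move=> t _; exact: integral_ge0.
- exact: emeasurable_funD.
move=> t _; rewrite -ge0_integralD//; last 2 first.
- exact: (measurableT_comp (mJ k) (pair1_measurable _)).
- exact: (measurableT_comp (mL k) (pair1_measurable _)).
apply: ge0_le_integral => //.
- exact: (measurableT_comp mG (pair1_measurable _)).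
- by apply: emeasurable_funD; [exact: (measurableT_comp (mJ k) (pair1_measurable _))|exact: (measurableT_comp (mL k) (pair1_measurable _))].
move=> x _; rewrite -EFinD lee_fin /=.
rewrite -(subrKA (f (cons_Rn (t + a k, x))))%R.
exact: ler_normD.
Qed.

End L1_continuity.

(** * Plancherel's theorem *)

Section real_plancherel.
Context {R : realType} {n : nat}.
Local Notation V := (Rn R n).
Local Notation mu := (lebesgue_Rn n : {sigma_finite_measure set V -> \bar R}).
Local Notation I f := (Rintegral mu setT f).
Local Notation intg f := (mu.-integrable setT (EFin \o f)).
Implicit Types (a f : V -> R) (x y z xi : V).

(** Real functions come first: cosine and sine transforms avoid complex integration, and the complex
    transform is assembled from them afterwards. *)
Definition cosT a xi := I (fun x => a x * cos (dotRn x xi)).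
Definition sinT a xi := I (fun x => a x * sin (dotRn x xi)).
Definition corr a z := I (fun x => a x * a (x + z)).

Lemma intg_measurable a : intg a -> measurable_fun setT a.
Proof. by move=> /measurable_int/measurable_EFinP. Qed.

Lemma intg_cos a xi : intg a -> intg (fun x => a x * cos (dotRn x xi)).
Proof.
move=> ai; apply: (integrable_mul_bounded (M := 1) ai); first by meas.
by move=> x; rewrite ler_norml cos_geN1 cos_le1.
Qed.

Lemma intg_sin a xi : intg a -> intg (fun x => a x * sin (dotRn x xi)).
Proof.
move=> ai; apply: (integrable_mul_bounded (M := 1) ai); first by meas.
by move=> x; rewrite ler_norml sin_geN1 sin_le1.
Qed.

Lemma measurable_cosT a : measurable_fun setT a -> measurable_fun setT (cosT a).
Proof.
move=> ma; apply: (measurable_Rintegral_param _ (f := fun xi x => a x * cos (dotRn x xi))) => //.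
by meas.
Qed.

Lemma measurable_sinT a : measurable_fun setT a -> measurable_fun setT (sinT a).
Proof.
move=> ma; apply: (measurable_Rintegral_param _ (f := fun xi x => a x * sin (dotRn x xi))) => //.
by meas.
Qed.

Lemma measurable_corr a : measurable_fun setT a -> measurable_fun setT (corr a).
Proof.
move=> ma; apply: (measurable_Rintegral_param _ (f := fun z x => a x * a (x + z))) => //.
by meas.
Qed.

Lemma norm_Rintegral_le f : measurable_fun setT f -> (`|I f|%:E <= \int[mu]_x `|f x|%:E)%E.
Proof.
move=> mf; have mf' : measurable_fun setT (EFin \o f) by exact/measurable_EFinP.
apply: le_trans (le_abse_integral mu measurableT mf').
rewrite /Rintegral /=; case: (\int[mu]_x (f x)%:E)%E => [r| |] //=; rewrite normr0; exact: leey.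
Qed.

Lemma integral_corr_le a : intg a ->
  (\int[mu]_x \int[mu]_z `|a x * a (x + z)|%:E = (\int[mu]_x `|a x|%:E) * (\int[mu]_x `|a x|%:E))%E.
Proof.
move=> ai; have ma := intg_measurable ai.
transitivity (\int[mu]_x (`|a x|%:E * \int[mu]_z `|a z|%:E))%E.
  apply: eq_integral => x _.
  under eq_integral do rewrite normrM EFinM.
  rewrite ge0_integralZl//; last by meas.
  congr (_ * _)%E; rewrite -(ge0_integral_shift x (f := fun z => `|a z|%:E))//; last by meas.
  by apply: eq_integral => z _; rewrite addrC.
by rewrite ge0_integralZr//; [meas|exact: integral_ge0].
Qed.

Lemma intg_lty a : intg a -> (\int[mu]_x `|a x|%:E < +oo)%E.
Proof. by move=> /integrableP[_]. Qed.

Lemma integral_corr_lty a : intg a -> (\int[mu]_x \int[mu]_z `|a x * a (x + z)|%:E < +oo)%E.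
Proof.
move=> ai; rewrite integral_corr_le//.
have ioo := intg_lty ai.
have i0 : (0 <= \int[mu]_x `|a x|%:E)%E by exact: integral_ge0.
by rewrite lte_mul_pinfty// ge0_fin_numE.
Qed.

Lemma L2_intg_sqr a : L2 mu a -> intg (fun x => a x ^+ 2).
Proof.
move=> [ma aoo]; apply/integrableP; split; first by apply/measurable_EFinP; exact: measurable_funX.
by under eq_integral do rewrite gee0_abs ?lee_fin ?sqr_ge0//.
Qed.

Lemma intg_mul_shift a z : L2 mu a -> intg (fun x => a x * a (x + z)).
Proof.
move=> La; have ma := La.1.
have h := integrableD measurableT (L2_intg_sqr La) (L2_intg_sqr (L2_shift z La)).
apply: le_integrable h => //; first by apply/measurable_EFinP; meas.
move=> x _; rewrite /= lee_fin.
rewrite [leRHS]ger0_norm ?addr_ge0 ?sqr_ge0// ler_norml; apply/andP; split.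
  by have := sqr_ge0 (a x + a (x + z)); have := sqr_ge0 (a x); have := sqr_ge0 (a (x + z)); nra.
by have := sqr_ge0 (a x - a (x + z)); have := sqr_ge0 (a x); have := sqr_ge0 (a (x + z)); nra.
Qed.

Lemma intg_corr a : intg a -> intg (corr a).
Proof.
move=> ai; have ma := intg_measurable ai; have ioo := intg_lty ai.
apply/integrableP; split; first by apply/measurable_EFinP; exact: measurable_corr.
have mH : measurable_fun setT (fun p : V * V => `|a p.1 * a (p.1 + p.2)|%:E) by meas.
apply: (@le_lt_trans _ _ (\int[mu]_z \int[mu]_x `|a x * a (x + z)|%:E)%E).
  apply: ge0_le_integral => //.
  - by apply/measurable_EFinP; apply: measurableT_comp => //; exact: measurable_corr.
  - exact: (measurable_fun_fubini_tonelli_G _ mH).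
  - by move=> z _; apply: norm_Rintegral_le; meas.
rewrite -(fubini_tonelli (fun p : V * V => `|a p.1 * a (p.1 + p.2)|%:E))//=.
exact: integral_corr_lty.
Qed.

(* Wiener-Khinchin: the power spectrum is the Fourier transform of the autocorrelation. *)
Lemma power_spectrumE a xi : intg a -> L2 mu a ->
  cosT a xi ^+ 2 + sinT a xi ^+ 2 = I (fun z => corr a z * cos (dotRn z xi)).
Proof.
move=> ai La; have ma := intg_measurable ai; have ioo := intg_lty ai.
have ci := intg_cos xi ai; have si := intg_sin xi ai.
pose f x z := a x * a (x + z) * cos (dotRn z xi).
have mf : measurable_fun setT (fun p : V * V => f p.1 p.2) by rewrite /f; meas.
have zi x : intg (fun z => a (x + z) * cos (dotRn z xi)).
  have [h _] := Rintegral_shift x ai.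
  have := intg_cos xi h; apply: eq_integrable => // z _ /=; by rewrite addrC.
(* With y = x + z, the addition formula for the cosine of (y - x) . xi separates x from y. *)
have fE x : I (f x) = cosT a xi * (a x * cos (dotRn x xi)) + sinT a xi * (a x * sin (dotRn x xi)).
  transitivity (a x * I (fun z => a (x + z) * cos (dotRn z xi))).
    by rewrite -RintegralZl//; apply: eq_Rintegral => z _; rewrite /f mulrA.
  have -> : I (fun z => a (x + z) * cos (dotRn z xi)) =
      I (fun y => cos (dotRn x xi) * (a y * cos (dotRn y xi)) + sin (dotRn x xi) * (a y * sin (dotRn y xi))).
    have gi : intg (fun y => cos (dotRn x xi) * (a y * cos (dotRn y xi)) + sin (dotRn x xi) * (a y * sin (dotRn y xi))).
      have h1 := integrableZl measurableT (cos (dotRn x xi)) ci.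
      have h2 := integrableZl measurableT (sin (dotRn x xi)) si.
      have := integrableD measurableT h1 h2.
      by apply: eq_integrable => // y _ /=; rewrite -!EFinM -EFinD.
    have [_ <-] := Rintegral_shift x gi.
    apply: eq_Rintegral => z _.
    have -> : dotRn z xi = dotRn (z + x) xi - dotRn x xi by rewrite dotRnDl addrK.
    by rewrite cosB (addrC x z); ring.
  rewrite RintegralD//; last 2 first.
  - by have := integrableZl measurableT (cos (dotRn x xi)) ci.
  - by have := integrableZl measurableT (sin (dotRn x xi)) si.
  rewrite !RintegralZl// -/(cosT a xi) -/(sinT a xi); ring.
transitivity (I (fun x => I (f x))).
  under eq_Rintegral do rewrite fE.
  rewrite RintegralD//; last 2 first.
  - by have := integrableZl measurableT (cosT a xi) ci.
  - by have := integrableZl measurableT (sinT a xi) si.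
  by rewrite !RintegralZl// -/(cosT a xi) -/(sinT a xi) -!expr2.
rewrite (Rintegral_fubini (m1 := mu) (m2 := mu) mf).
  apply: eq_Rintegral => z _; rewrite /corr mulrC.
  by rewrite -RintegralZl; [apply: eq_Rintegral => x _; rewrite /f mulrC|by []|exact: intg_mul_shift].
have fle : (\int[mu]_x \int[mu]_z `|f x z|%:E <= \int[mu]_x \int[mu]_z `|a x * a (x + z)|%:E)%E.
  have mf2 : measurable_fun setT (fun p : V * V => `|f p.1 p.2|%:E) by meas.
  have mH : measurable_fun setT (fun p : V * V => `|a p.1 * a (p.1 + p.2)|%:E) by meas.
  apply: ge0_le_integral => //.
  - by move=> x _; exact: integral_ge0.
  - exact: (measurable_fun_fubini_tonelli_F _ mf2).
  - exact: (measurable_fun_fubini_tonelli_F _ mH).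
  move=> x _; apply: ge0_le_integral => //.
  - by rewrite /f; meas.
  - by meas.
  - by move=> z _; rewrite lee_fin /f normrM ler_piMr// ler_norml cos_geN1 cos_le1.
apply: le_lt_trans fle _.
exact: integral_corr_lty.
Qed.

Lemma corr0 a : corr a 0 = I (fun x => a x ^+ 2).
Proof. by apply: eq_Rintegral => x _; rewrite addr0 expr2. Qed.

Lemma corr_diffE a z : L2 mu a ->
  2 * (corr a 0 - corr a z) = I (fun x => (a (x + z) - a x) ^+ 2).
Proof.
move=> La; have i2 := L2_intg_sqr La.
have [i2z e2z] := Rintegral_shift z i2; have iz := intg_mul_shift z La.
transitivity (I (fun x => (a (x + z) ^+ 2 + a x ^+ 2) - 2 * (a x * a (x + z)))).
  rewrite RintegralB//; last 2 first.
  - by have := integrableD measurableT i2z i2; apply: eq_integrable => // x _ /=; rewrite EFinD.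
  - by have := integrableZl measurableT 2 iz.
  by rewrite RintegralD// RintegralZl// e2z -corr0 -/(corr a z); ring.
by apply: eq_Rintegral => x _; ring.
Qed.

Lemma corr_bound a z : L2 mu a -> `|corr a z| <= corr a 0.
Proof.
move=> La; have i2 := L2_intg_sqr La.
have [i2z e2z] := Rintegral_shift z i2; have iz := intg_mul_shift z La.
have p : 0 <= I (fun x => (a x + a (x + z)) ^+ 2) by apply: Rintegral_ge0 => x _; exact: sqr_ge0.
have q : 0 <= I (fun x => (a (x + z) - a x) ^+ 2) by apply: Rintegral_ge0 => x _; exact: sqr_ge0.
rewrite -corr_diffE// in q.
have e : I (fun x => (a x + a (x + z)) ^+ 2) = 2 * (corr a 0 + corr a z).
  transitivity (I (fun x => (a (x + z) ^+ 2 + a x ^+ 2) + 2 * (a x * a (x + z)))).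
    by apply: eq_Rintegral => x _; ring.
  rewrite RintegralD//; last 2 first.
  - by have := integrableD measurableT i2z i2; apply: eq_integrable => // x _ /=; rewrite EFinD.
  - by have := integrableZl measurableT 2 iz.
  by rewrite RintegralD// RintegralZl// e2z -corr0 -/(corr a z); ring.
rewrite ler_norml; apply/andP; split; lra.
Qed.

(** The map s |s| is the signed square. For a in L^2 the function a |a| is integrable, and this
    inequality reduces the continuity of translations in L^2 to that in L^1. *)
Lemma sqr_diff_le (s t : R) : (s - t) ^+ 2 <= 2 * `| s * `|s| - t * `|t| |.
Proof.
have h1 := ler_norm (s * `|s| - t * `|t|).
have h2 := ler_norm (- (s * `|s| - t * `|t|)); rewrite normrN in h2.
move: h1 h2; set w := `| _ - _|; have := sqr_ge0 (s + t).
have [s0|s0] := ger0P s; have [t0|t0] := ger0P t; have [st|st] := leP s t; nra.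
Qed.

Lemma cvg_corr a (z : nat -> V) : L2 mu a ->
  (forall i, tnth (z k) i @[k --> \oo] --> (0 : R)) ->
  corr a (z k) @[k --> \oo] --> corr a 0.
Proof.
move=> La z0; have ma := La.1.
pose f x := a x * `|a x|.
have mf : measurable_fun setT f by rewrite /f; meas.
have foo : (\int[mu]_x `|f x|%:E < +oo)%E.
  apply: le_lt_trans La.2; rewrite le_eqVlt; apply/orP; left; apply/eqP.
  by apply: eq_integral => x _; rewrite /f normrM normr_id -expr2 real_normK ?num_real.
have h := L1_translation mf foo z0.
apply/cvgrPdist_le => e e0; have := cvge0_le h e0; apply: filterS => k hk.
have nn : 0 <= corr a 0 - corr a (z k) by have := corr_bound (z k) La; rewrite ler_norml => /andP[_]; lra.
rewrite ger0_norm// -(@ler_pM2l _ 2)// corr_diffE//.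
rewrite -lee_fin /Rintegral fineK.
  apply: le_trans (_ : _ <= 2%:E * \int[mu]_x `|f (x + z k) - f x|%:E)%E _.
    rewrite -ge0_integralZl//; last by meas.
    apply: ge0_le_integral => //.
    - by move=> x _; rewrite lee_fin sqr_ge0.
    - by meas.
    - by apply: measurable_funeM; meas.
    - by move=> x _; rewrite -EFinM lee_fin sqr_diff_le.
  by rewrite EFinM; exact: lee_wpmul2l.
apply: integrable_fin_num => //.
have LB := L2B (L2_shift (z k) La) La.
exact: L2_intg_sqr LB.
Qed.

Lemma intg_corr_pkernel a (t : R) : L2 mu a -> intg (fun z => corr a (t *: z) * pkernel z).
Proof.
move=> La; have mcorr := measurable_corr La.1; have mp := @measurable_pkernel R n.
have ip : intg (fun z => pkernel z).
  apply/integrableP; split; first by apply/measurable_EFinP.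
  under eq_integral do rewrite gee0_abs ?lee_fin ?pkernel_ge0//.
  by rewrite integral_pkernel ltry.
have := integrable_mul_bounded ip (g := fun z => corr a (t *: z)) (M := corr a 0) _ (fun z => corr_bound _ La).
by move=> /(_ ltac:(meas)); apply: eq_integrable => // z _ /=; rewrite mulrC.
Qed.

(** After Fubini the integral in xi is the rescaled kernel t^-n pkernel (z / t); the substitution of
    t z for z moves the scale into the autocorrelation. *)
Lemma regularized_power_spectrum a (t : R) : intg a -> L2 mu a -> 0 < t ->
  I (fun xi => expR (- l1norm (t *: xi)) * (cosT a xi ^+ 2 + sinT a xi ^+ 2)) =
  I (fun z => corr a (t *: z) * pkernel z).
Proof.
move=> ai La t0; have ma := intg_measurable ai; have ioo := intg_lty ai.
have mcorr := measurable_corr ma.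
have ic := intg_corr ai.
have mp := @measurable_pkernel R n.
have ml := @measurable_l1norm R n.
have [ek _] := Rintegral_dilation t0 (integrable_expk n).
transitivity (I (fun xi => I (fun z => expR (- l1norm (t *: xi)) * (corr a z * cos (dotRn z xi))))).
  apply: eq_Rintegral => xi _; rewrite power_spectrumE// RintegralZl//.
  exact: intg_cos.
rewrite (Rintegral_fubini (m1 := mu) (m2 := mu) (f := fun xi z => expR (- l1norm (t *: xi)) * (corr a z * cos (dotRn z xi)))); last 2 first.
- by meas.
- apply: (@le_lt_trans _ _ (\int[mu]_xi ((expR (- l1norm (t *: xi)))%:E * \int[mu]_z `|corr a z|%:E))%E).
    have mH : measurable_fun setT (fun p : V * V => `|expR (- l1norm (t *: p.1)) * (corr a p.2 * cos (dotRn p.2 p.1))|%:E) by meas.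
    apply: ge0_le_integral => //.
    + by move=> x _; exact: integral_ge0.
    + exact: (measurable_fun_fubini_tonelli_F _ mH).
    + by apply: emeasurable_funM; [meas|exact: measurable_cst].
    move=> xi _; rewrite -ge0_integralZl//; last by meas.
    apply: ge0_le_integral => //; [by meas|by apply: measurable_funeM; meas|].
    move=> z _; rewrite -EFinM lee_fin !normrM (ger0_norm (expR_ge0 _)) ler_wpM2l ?expR_ge0//.
    by rewrite ler_piMr// ler_norml cos_geN1 cos_le1.
  rewrite ge0_integralZr; [|by []|by meas|by move=> x _; rewrite lee_fin expR_ge0|exact: integral_ge0].
  rewrite lte_mul_pinfty//.
  + by apply: integral_ge0 => x _; rewrite lee_fin expR_ge0.
  + exact: integrable_fin_num.
  + exact: intg_lty.
have ih : intg (fun z => corr a (t *: z) * pkernel z) by exact: intg_corr_pkernel.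
have ti : 0 < t^-1 by rewrite invr_gt0.
transitivity (I (fun z => t^-1 ^+ n * (corr a (t *: (t^-1 *: z)) * pkernel (t^-1 *: z)))).
  apply: eq_Rintegral => z _; rewrite scalerA divff ?gt_eqF// scale1r.
  transitivity (corr a z * I (fun xi => expR (- l1norm (t *: xi)) * cos (dotRn (t^-1 *: z) (t *: xi)))).
    rewrite -RintegralZl//.
      apply: eq_Rintegral => xi _.
      by rewrite dotRnZl dotRnZr [t^-1 * _]mulrA mulVf ?gt_eqF// mul1r mulrCA.
    have := integrable_mul_bounded ek (g := fun xi => cos (dotRn (t^-1 *: z) (t *: xi))) (M := 1).
    by apply; [meas|move=> x; rewrite ler_norml cos_geN1 cos_le1].
  have ic1 : intg (fun xi => expR (- l1norm xi) * cos (dotRn (t^-1 *: z) xi)).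
    by apply: (integrable_mul_bounded (M := 1) (integrable_expk n)); [meas|move=> x; rewrite ler_norml cos_geN1 cos_le1].
  have [_ ->] := Rintegral_dilation t0 ic1.
  by rewrite Rintegral_expk_cos; ring.
have [ih2 e2] := Rintegral_dilation ti ih.
rewrite RintegralZl// e2; set J := Rintegral _ _ _.
by rewrite mulrA -exprMn mulfV ?expr1n ?mul1r// gt_eqF.
Qed.

Lemma cosT_bound a xi : intg a -> `|cosT a xi| <= fine (\int[mu]_x `|a x|%:E)%E.
Proof.
move=> ai; have ma := intg_measurable ai; have ioo := intg_lty ai.
rewrite -lee_fin fineK; last by rewrite ge0_fin_numE//; exact: integral_ge0.
apply: le_trans (norm_Rintegral_le _) _; first by meas.
apply: ge0_le_integral => //; [by meas|by meas|].
by move=> x _; rewrite lee_fin normrM ler_piMr// ler_norml cos_geN1 cos_le1.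
Qed.

Lemma sinT_bound a xi : intg a -> `|sinT a xi| <= fine (\int[mu]_x `|a x|%:E)%E.
Proof.
move=> ai; have ma := intg_measurable ai; have ioo := intg_lty ai.
rewrite -lee_fin fineK; last by rewrite ge0_fin_numE//; exact: integral_ge0.
apply: le_trans (norm_Rintegral_le _) _; first by meas.
apply: ge0_le_integral => //; [by meas|by meas|].
by move=> x _; rewrite lee_fin normrM ler_piMr// ler_norml sin_geN1 sin_le1.
Qed.

Definition pspec a xi := cosT a xi ^+ 2 + sinT a xi ^+ 2.

Lemma pspec_ge0 a xi : 0 <= pspec a xi.
Proof. by rewrite addr_ge0// sqr_ge0. Qed.

Lemma measurable_pspec a : measurable_fun setT a -> measurable_fun setT (pspec a).
Proof.
move=> ma; have mc := measurable_cosT ma; have ms := measurable_sinT ma.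
by rewrite /pspec; meas.
Qed.

Lemma pspec_bound a xi : intg a ->
  pspec a xi <= 2 * fine (\int[mu]_x `|a x|%:E)%E ^+ 2.
Proof.
move=> ai; rewrite mulr2n mulrDl mul1r; apply: lerD.
- by rewrite -real_normK ?num_real// lerXn2r ?nnegrE ?cosT_bound// fine_ge0// integral_ge0.
- by rewrite -real_normK ?num_real// lerXn2r ?nnegrE ?sinT_bound// fine_ge0// integral_ge0.
Qed.

(** Let t tend to 0 through 2^-k in [regularized_power_spectrum]. The left side increases, so
    monotone convergence applies before the power spectrum is known to be integrable; on the right,
    the autocorrelation is continuous at 0 and maximal there. *)
Lemma integral_pspec a : intg a -> L2 mu a ->
  (\int[mu]_xi (pspec a xi)%:E = ((2 * pi) ^+ n)%:E * sqint mu a)%E.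
Proof.
move=> ai La; have ma := intg_measurable ai.
have mP := measurable_pspec ma.
have ml := @measurable_l1norm R n.
have mp := @measurable_pkernel R n.
have mcorr := measurable_corr ma.
pose t k : R := 2^-1 ^+ k.
have t0 k : 0 < t k by rewrite exprn_gt0// invr_gt0.
have tcvg : t k @[k --> \oo] --> (0 : R).
  by apply: cvg_expr; rewrite ger0_norm ?invr_ge0// invf_lt1// ltr1n.
pose g k xi := expR (- l1norm (t k *: xi)) * pspec a xi.
have mg k : measurable_fun setT (fun xi => (g k xi)%:E) by rewrite /g; meas.
have g0 k xi : setT xi -> (0 <= (g k xi)%:E)%E.
  by move=> _; rewrite lee_fin mulr_ge0 ?expR_ge0 ?pspec_ge0.
have gnd xi : setT xi -> {homo (fun k => (g k xi)%:E) : j k / (j <= k)%N >-> (j <= k)%E}.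
  move=> _ j k jk; rewrite lee_fin; apply: ler_wpM2r; first exact: pspec_ge0.
  rewrite ler_expR lerN2 !l1normZ//; apply: ler_wpM2r; first exact: l1norm_ge0.
  by apply: ler_wiXn2l => //; rewrite ?invr_ge0// invf_le1// ler1n.
have mcv := cvg_monotone_convergence measurableT mg g0 gnd (mu := mu).
have glim xi : limn (fun k => (g k xi)%:E) = (pspec a xi)%:E.
  apply/cvg_lim => //; apply/fine_cvgP; split; first exact: nearW.
  rewrite -[X in _ --> X]mul1r /g; apply: cvgM; last exact: cvg_cst.
  have h : - (t k * l1norm xi) @[k --> \oo] --> (0 : R).
    by rewrite -oppr0 -(mul0r (l1norm xi)); apply: cvgN; apply: cvgM => //; exact: cvg_cst.
  have := cvg_comp _ _ h (continuous_expR (x := 0)); rewrite expR0.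
  by under eq_fun do rewrite -l1normZ//.
have ig k : (\int[mu]_xi (g k xi)%:E = \int[mu]_z (corr a (t k *: z) * pkernel z)%:E)%E.
  have [ek _] := Rintegral_dilation (t0 k) (integrable_expk n).
  have ig : intg (g k).
    apply: (integrable_mul_bounded (M := 2 * fine (\int[mu]_x `|a x|%:E)%E ^+ 2) ek mP) => xi.
    by rewrite ger0_norm ?pspec_ge0// pspec_bound.
  have := regularized_power_spectrum ai La (t0 k); rewrite /Rintegral => e.
  rewrite -[LHS]fineK; last exact: integrable_fin_num.
  rewrite -[RHS]fineK; last by apply: integrable_fin_num => //; exact: intg_corr_pkernel.
  by congr EFin.
have i2 := L2_intg_sqr La.
have c0E : (corr a 0)%:E = sqint mu a.
  by rewrite corr0 /Rintegral fineK//; apply: integrable_fin_num.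
have c0 : 0 <= corr a 0 by rewrite -lee_fin c0E sqint_ge0.
have dct : (\int[mu]_z (corr a (t k *: z) * pkernel z)%:E)%E @[k --> \oo] -->
    (\int[mu]_z (corr a 0 * pkernel z)%:E)%E.
  have h1 : {ae mu, forall z, setT z -> (corr a (t k *: z) * pkernel z)%:E @[k --> \oo] --> (corr a 0 * pkernel z)%:E}.
    apply: aeW => z _; apply/fine_cvgP; split; first exact: nearW.
    apply: cvgM; last exact: cvg_cst.
    apply: (cvg_corr La) => i; under eq_fun do rewrite tnthZ.
    by rewrite -(mul0r (tnth z i)); apply: cvgM => //; exact: cvg_cst.
  have h2 : {ae mu, forall z k, setT z -> (`|(corr a (t k *: z) * pkernel z)%:E| <= (corr a 0 * pkernel z)%:E)%E}.
    apply: aeW => z k _; rewrite lee_fin normrM (ger0_norm (pkernel_ge0 z)) ler_wpM2r ?pkernel_ge0//.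
    exact: corr_bound.
  have ip : intg (fun z => corr a 0 * pkernel z).
    apply/integrableP; split; first by apply/measurable_EFinP; meas.
    under eq_integral => z _ do rewrite /= ger0_norm ?mulr_ge0 ?pkernel_ge0// EFinM.
    rewrite ge0_integralZl//; [|by meas|by move=> z _; rewrite lee_fin pkernel_ge0].
    by rewrite integral_pkernel -EFinM ltry.
  have m1 k : measurable_fun setT (fun z => (corr a (t k *: z) * pkernel z)%:E) by meas.
  have m2 : measurable_fun setT (fun z => (corr a 0 * pkernel z)%:E) by meas.
  by have [_ _] := dominated_convergence measurableT m1 m2 h1 ip h2.
have e1 : (\int[mu]_xi (pspec a xi)%:E = \int[mu]_xi limn (fun k => (g k xi)%:E))%E.
  by apply: eq_integral => xi _; rewrite glim.
have e2 : (fun k => \int[mu]_xi (g k xi)%:E)%E = (fun k => \int[mu]_z (corr a (t k *: z) * pkernel z)%:E)%E.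
  by apply/funext => k; exact: ig.
rewrite e1 -(cvg_lim _ mcv)// e2 (cvg_lim _ dct)//.
under eq_integral do rewrite EFinM.
rewrite ge0_integralZl//; [|by meas|by move=> z _; rewrite lee_fin pkernel_ge0].
by rewrite integral_pkernel c0E muleC.
Qed.

Lemma intg_fdiff m y a : intg a -> intg (fdiff m y a).
Proof.
move=> ai; elim: m => //= m ih; have [h _] := Rintegral_shift y ih.
by have := integrableB measurableT h ih; apply: eq_integrable => // x _ /=; rewrite EFinB.
Qed.

(** A translation by y rotates the pair of cosine and sine transforms by the angle y . xi.
    Subtracting the original pair multiplies its squared length by |exp (i y.xi) - 1|^2 = 2 - 2 cos
    (y.xi). *)
Lemma pspec_diff a y xi : intg a ->
  pspec (fun x => a (x + y) - a x) xi = (2 - 2 * cos (dotRn y xi)) * pspec a xi.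
Proof.
move=> ai; have [aiy _] := Rintegral_shift y ai.
have ci := intg_cos xi ai; have si := intg_sin xi ai.
have ciy := intg_cos xi aiy; have siy := intg_sin xi aiy.
have cZ (k : R) : intg (fun x => k * (a x * cos (dotRn x xi))) by have := integrableZl measurableT k ci.
have sZ (k : R) : intg (fun x => k * (a x * sin (dotRn x xi))) by have := integrableZl measurableT k si.
have hc : cosT (fun x => a (x + y)) xi = cos (dotRn y xi) * cosT a xi + sin (dotRn y xi) * sinT a xi.
  have gi : intg (fun x => cos (dotRn y xi) * (a x * cos (dotRn x xi)) + sin (dotRn y xi) * (a x * sin (dotRn x xi))).
    by have := integrableD measurableT (cZ (cos (dotRn y xi))) (sZ (sin (dotRn y xi))); apply: eq_integrable => // x _ /=; rewrite EFinD.
  have [_ e] := Rintegral_shift y gi.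
  have e' : I (fun x => cos (dotRn y xi) * (a x * cos (dotRn x xi)) + sin (dotRn y xi) * (a x * sin (dotRn x xi))) =
      cos (dotRn y xi) * cosT a xi + sin (dotRn y xi) * sinT a xi.
    by rewrite RintegralD// !RintegralZl.
  rewrite -e' -e.
  apply: eq_Rintegral => x _.
  rewrite (_ : dotRn x xi = dotRn (x + y) xi - dotRn y xi); last by rewrite dotRnDl addrK.
  by rewrite cosB; ring.
have hs : sinT (fun x => a (x + y)) xi = cos (dotRn y xi) * sinT a xi - sin (dotRn y xi) * cosT a xi.
  have gi : intg (fun x => cos (dotRn y xi) * (a x * sin (dotRn x xi)) - sin (dotRn y xi) * (a x * cos (dotRn x xi))).
    by have := integrableB measurableT (sZ (cos (dotRn y xi))) (cZ (sin (dotRn y xi))); apply: eq_integrable => // x _ /=; rewrite EFinB.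
  have [_ e] := Rintegral_shift y gi.
  have e' : I (fun x => cos (dotRn y xi) * (a x * sin (dotRn x xi)) - sin (dotRn y xi) * (a x * cos (dotRn x xi))) =
      cos (dotRn y xi) * sinT a xi - sin (dotRn y xi) * cosT a xi.
    by rewrite RintegralB// !RintegralZl.
  rewrite -e' -e.
  apply: eq_Rintegral => x _.
  rewrite (_ : dotRn x xi = dotRn (x + y) xi - dotRn y xi); last by rewrite dotRnDl addrK.
  by rewrite sinB; ring.
have dc : cosT (fun x => a (x + y) - a x) xi = cosT (fun x => a (x + y)) xi - cosT a xi.
  by rewrite -RintegralB//; apply: eq_Rintegral => x _; rewrite mulrBl.
have ds : sinT (fun x => a (x + y) - a x) xi = sinT (fun x => a (x + y)) xi - sinT a xi.
  by rewrite -RintegralB//; apply: eq_Rintegral => x _; rewrite mulrBl.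
rewrite /pspec dc ds hc hs.
have := cos2Dsin2 (dotRn y xi).
move: (cos _) (sin _) (cosT _ _) (sinT _ _) => c s C S.
move=> /(congr1 (fun k => k * (C ^+ 2 + S ^+ 2))); rewrite mul1r => h.
have -> : (c * C + s * S - C) ^+ 2 + (c * S - s * C - S) ^+ 2 =
  (c ^+ 2 + s ^+ 2) * (C ^+ 2 + S ^+ 2) + (1 - 2 * c) * (C ^+ 2 + S ^+ 2) by ring.
by rewrite h; ring.
Qed.

Lemma pspec_fdiff m y a xi : intg a ->
  pspec (fdiff m y a) xi = (2 - 2 * cos (dotRn y xi)) ^+ m * pspec a xi.
Proof.
move=> ai; elim: m => [|m ih]; first by rewrite mul1r.
by rewrite /= pspec_diff ?ih ?exprS ?mulrA//; exact: intg_fdiff.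
Qed.

End real_plancherel.

Lemma norm_sin_le (R : realType) (t : R) : `|sin t| <= `|t|.
Proof.
have h (a : R) : 0 <= a -> `|sin a| <= a.
  move=> a0; have [|c _] := @MVT_segment R sin cos 0 a a0 (fun x _ => is_derive_sin x).
    by apply: continuous_subspaceT; exact: continuous_sin.
  rewrite sin0 !subr0 => ->; rewrite normrM (ger0_norm a0) ler_piMl//.
  by rewrite ler_norml cos_geN1 cos_le1.
have [t0|t0] := leP 0 t; first by rewrite (ger0_norm t0); exact: h.
by rewrite -(normrN t) -(normrN (sin t)) -sinN (gtr0_norm (x := - t)) ?oppr_gt0// h// oppr_ge0 ltW.
Qed.

Lemma cos_diff_le (R : realType) (t : R) : 2 - 2 * cos t <= t ^+ 2.
Proof.
have := norm_sin_le (t / 2).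
have -> : cos t = cos (t / 2) ^+ 2 - sin (t / 2) ^+ 2.
  by rewrite {1}(splitr t) cosD !expr2.
have := cos2Dsin2 (t / 2); move: (cos _) (sin _) => c s h1 h2.
have h3 : s ^+ 2 <= (t / 2) ^+ 2.
  by rewrite -(real_normK (num_real s)) -(real_normK (num_real (t / 2))) lerXn2r ?nnegrE.
have -> : t ^+ 2 = 4 * (t / 2) ^+ 2 by field.
by lra.
Qed.

(** * Complex functions, the Fourier-Plancherel transform and the fractional Laplacian *)

Section complex_plancherel.
Context {R : realType} {n : nat}.
Local Notation V := (Rn R n).
Local Notation mu := (lebesgue_Rn n : {sigma_finite_measure set V -> \bar R}).
Local Notation intg f := (mu.-integrable setT (EFin \o f)).
Local Notation normc := (@ComplexField.Normc.normc R).
Implicit Types (u v w g : V -> R[i]) (x y z xi : V).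

Definition rep u x : R := complex.Re (u x).
Definition imp u x : R := complex.Im (u x).
Definition cmod2 (z : R[i]) : R := complex.Re z ^+ 2 + complex.Im z ^+ 2.

Lemma cmod2_ge0 (z : R[i]) : 0 <= cmod2 z.
Proof. by rewrite addr_ge0// sqr_ge0. Qed.

Lemma normc_sqr (z : R[i]) : normc z ^+ 2 = cmod2 z.
Proof. by case: z => a b; rewrite /ComplexField.Normc.normc /cmod2/= sqr_sqrtr// addr_ge0// sqr_ge0. Qed.

Lemma normc_ge0 (z : R[i]) : 0 <= normc z.
Proof. by case: z => a b; rewrite /ComplexField.Normc.normc sqrtr_ge0. Qed.

Lemma Re_le_normc (z : R[i]) : `|complex.Re z| <= normc z.
Proof.
rewrite -(ler_pXn2r (n := 2))// ?nnegrE ?normc_ge0// normc_sqr real_normK ?num_real//.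
by rewrite lerDl sqr_ge0.
Qed.

Lemma Im_le_normc (z : R[i]) : `|complex.Im z| <= normc z.
Proof.
rewrite -(ler_pXn2r (n := 2))// ?nnegrE ?normc_ge0// normc_sqr real_normK ?num_real//.
by rewrite lerDr sqr_ge0.
Qed.

Lemma repB u v : rep (u - v) = (fun x => rep u x - rep v x).
Proof. apply/funext => x; rewrite /rep; change ((u - v) x) with (u x - v x).
by case: (u x) => a b; case: (v x). Qed.

Lemma impB u v : imp (u - v) = (fun x => imp u x - imp v x).
Proof. apply/funext => x; rewrite /imp; change ((u - v) x) with (u x - v x).
by case: (u x) => a b; case: (v x). Qed.

Local Open Scope ereal_scope.

(** The squared L^2 norm, split into the two parts to which the real results apply. *)
Definition csq u := sqint mu (rep u) + sqint mu (imp u).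

Lemma csq_ge0 u : 0 <= csq u.
Proof. by rewrite adde_ge0// sqint_ge0. Qed.

Lemma mule2 (x : \bar R) : 2%:E * x = x + x.
Proof. by rewrite mule_natl. Qed.

Lemma csq_cmod2 u : cmeasurable u -> csq u = \int[mu]_x (cmod2 (u x))%:E.
Proof.
move=> [mr mi]; rewrite /csq /sqint -ge0_integralD//.
- by move=> x _; rewrite lee_fin sqr_ge0.
- by apply/measurable_EFinP; exact: measurable_funX.
- by move=> x _; rewrite lee_fin sqr_ge0.
- by apply/measurable_EFinP; exact: measurable_funX.
Qed.

Lemma cLnorm_le u (M : R) : cmeasurable u -> (0 <= M)%R ->
  (cLnorm 2 u <= M%:E) = (csq u <= (M ^+ 2)%:E).
Proof.
move=> mu_ M0; rewrite csq_cmod2//.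
have h := @Lnorm_lePr _ _ _ mu 2 _ (fun x => normc (u x)) M M0.
rewrite /cLnorm [LHS]h ?ler1n// powR_mulrn//; congr (_ <= _).
apply: eq_integral => x _; congr EFin.
by rewrite powR_mulrn// real_normK ?num_real// normc_sqr.
Qed.

Lemma cLp2P u : cLp 2 u -> [/\ cmeasurable u, L2 mu (rep u) & L2 mu (imp u)].
Proof.
move=> [mu_ uoo]; have [mr mi] := mu_.
have : csq u < +oo.
  have N0 : 0 <= cLnorm 2 u by exact: Lnorm_ge0.
  have fN : cLnorm 2 u \is a fin_num by rewrite ge0_fin_numE.
  have := cLnorm_le mu_ (fine_ge0 N0); rewrite fineK// lexx => /esym/le_lt_trans; apply.
  exact: ltry.
move=> h; split => //; split => //.
- by apply: le_lt_trans h; rewrite leeDl// sqint_ge0.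
- by apply: le_lt_trans h; rewrite leeDr// sqint_ge0.
Qed.

Lemma cLp1P u : cLp 1 u -> intg (rep u) /\ intg (imp u).
Proof.
move=> [[mr mi]]; rewrite /cLnorm Lnorm1 => uoo.
have mn : measurable_fun setT (fun x => normc (u x)).
  rewrite (_ : (fun x => _) = (fun x => Num.sqrt (rep u x ^+ 2 + imp u x ^+ 2))).
    apply: (@measurableT_comp _ _ _ _ _ _ (@Num.sqrt R)).
      by apply: continuous_measurable_fun; exact: sqrt_continuous.
    by apply: measurable_funD; exact: measurable_funX.
  by apply/funext => x; rewrite /rep /imp; case: (u x).
have ni : intg (fun x => normc (u x)) by apply/integrableP; split => //; exact/measurable_EFinP.
split; apply: le_integrable ni => //; [exact/measurable_EFinP| |exact/measurable_EFinP|].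
- by move=> x _; rewrite /= lee_fin (ger0_norm (normc_ge0 _)) Re_le_normc.
- by move=> x _; rewrite /= lee_fin (ger0_norm (normc_ge0 _)) Im_le_normc.
Qed.

Lemma cmeasurableB u v : cmeasurable u -> cmeasurable v -> cmeasurable (u - v)%R.
Proof.
move=> [a b] [c d]; split.
- by rewrite -/(rep (u - v)%R) repB; exact: measurable_funB.
- by rewrite -/(imp (u - v)%R) impB; exact: measurable_funB.
Qed.

Lemma cLnorm_cvg0 (f : nat -> V -> R[i]) : (forall k, cmeasurable (f k)) ->
  cLnorm 2 (f k) @[k --> \oo] --> 0 ->
  forall e : R, (0 < e)%R -> \forall k \near \oo, csq (f k) <= e%:E.
Proof.
move=> mf f0 e e0; have s0 : (0 < Num.sqrt e)%R by rewrite sqrtr_gt0.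
have := cvge0_le f0 s0; apply: filterS => k.
by rewrite cLnorm_le// ?sqr_sqrtr ?sqrtr_ge0// ltW.
Qed.

Definition fconst : R := ((2 * pi) `^ (- (n%:R / 2)))%R.

(** The normalisation of [fourierL1] cancels the factor (2 pi)^n of [integral_pspec]. *)
Lemma fconst_sqr : (fconst ^+ 2 * (2 * pi) ^+ n)%R = 1%R.
Proof.
have p0 : (0 < 2 * pi :> R)%R by rewrite mulr_gt0// pi_gt0.
rewrite /fconst -[(_ `^ _ ^+ 2)%R]powR_mulrn ?powR_ge0// -powRrM -[((2 * pi) ^+ n)%R]powR_mulrn ?(ltW p0)//.
rewrite -powRD; last by apply/implyP => _; rewrite gt_eqF.
by rewrite (_ : (- (n%:R / 2) * 2 + n%:R)%R = 0%R) ?powRr0//; field.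
Qed.

Lemma Re_fourierL1 w xi : intg (rep w) -> intg (imp w) ->
  complex.Re (fourierL1 w xi) = (fconst * (cosT (rep w) xi + sinT (imp w) xi))%R.
Proof.
move=> ir ii; rewrite /fourierL1 /cintegral /= mul0r subr0; congr (_ * _)%R.
have ci := intg_cos xi ir; have si := intg_sin xi ii.
rewrite -RintegralD//; apply: eq_Rintegral => x _; rewrite /rep /imp /expi cosN sinN.
by case: (w x) => a b /=; ring.
Qed.

Lemma Im_fourierL1 w xi : intg (rep w) -> intg (imp w) ->
  complex.Im (fourierL1 w xi) = (fconst * (cosT (imp w) xi - sinT (rep w) xi))%R.
Proof.
move=> ir ii; rewrite /fourierL1 /cintegral /= mul0r addr0; congr (_ * _)%R.
have ci := intg_cos xi ii; have si := intg_sin xi ir.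
rewrite -RintegralB//; apply: eq_Rintegral => x _; rewrite /rep /imp /expi cosN sinN.
by case: (w x) => a b /=; ring.
Qed.

Lemma cosT_opp (a : V -> R) xi : cosT a (- xi)%R = cosT a xi.
Proof. by apply: eq_Rintegral => x _; rewrite dotRnNr cosN. Qed.

Lemma sinT_opp (a : V -> R) xi : intg a -> sinT a (- xi)%R = (- sinT a xi)%R.
Proof.
move=> ai; rewrite -mulN1r -RintegralZl//; last exact: intg_sin.
by apply: eq_Rintegral => x _; rewrite dotRnNr sinN mulN1r mulrN.
Qed.

Lemma cmod2_fourierL1 w xi : intg (rep w) -> intg (imp w) ->
  (cmod2 (fourierL1 w xi) + cmod2 (fourierL1 w (- xi)) =
   2 * fconst ^+ 2 * (pspec (rep w) xi + pspec (imp w) xi))%R.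
Proof.
move=> ir ii; rewrite /cmod2 !Re_fourierL1// !Im_fourierL1// !cosT_opp !sinT_opp// /pspec.
ring.
Qed.

Lemma cmeasurable_fourierL1 w : intg (rep w) -> intg (imp w) -> cmeasurable (fourierL1 w).
Proof.
move=> ir ii; have mr := intg_measurable ir; have mi := intg_measurable ii.
have m1 := measurable_cosT mr; have m2 := measurable_sinT mr.
have m3 := measurable_cosT mi; have m4 := measurable_sinT mi.
split.
- rewrite (_ : (fun x => _) = (fun xi => fconst * (cosT (rep w) xi + sinT (imp w) xi))%R).
    by meas.
  by apply/funext => xi; exact: Re_fourierL1.
- rewrite (_ : (fun x => _) = (fun xi => fconst * (cosT (imp w) xi - sinT (rep w) xi))%R).
    by meas.
  by apply/funext => xi; exact: Im_fourierL1.
Qed.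

(* |exp (i y.xi) - 1| ^ (2 m), the squared modulus of the symbol of fdiff m y. *)
Definition dsymb m y xi : R := ((2 - 2 * cos (dotRn y xi)) ^+ m)%R.

Lemma dsymb_ge0 m y xi : (0 <= dsymb m y xi)%R.
Proof. by rewrite exprn_ge0//; have := cos_le1 (dotRn y xi); lra. Qed.

Lemma measurable_dsymb m y : measurable_fun setT (dsymb m y).
Proof. by rewrite /dsymb; meas. Qed.

Lemma dsymb_opp m y xi : dsymb m y (- xi)%R = dsymb m y xi.
Proof. by rewrite /dsymb dotRnNr cosN. Qed.

Lemma dsymb_le m y xi : (dsymb m y xi <= 4 ^+ m)%R.
Proof.
have h1 := cos_le1 (dotRn y xi); have h2 := cos_geN1 (dotRn y xi).
have h3 : (0 <= 2 - 2 * cos (dotRn y xi))%R by lra.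
by rewrite lerXn2r ?nnegrE//; lra.
Qed.

(* |fourierL1 w| ^ 2 is not the sum of the power spectra of the real and imaginary parts
   of w, but its even part is; the weights we integrate against are even. *)
Lemma integral_even_part (p F P : V -> R) (c : R) :
  measurable_fun setT p -> measurable_fun setT F -> measurable_fun setT P ->
  (forall xi, 0 <= p xi)%R -> (forall xi, 0 <= F xi)%R -> (forall xi, 0 <= P xi)%R -> (0 <= c)%R ->
  (forall xi, p (- xi) = p xi)%R -> (forall xi, F xi + F (- xi) = 2 * c * P xi)%R ->
  \int[mu]_xi (p xi * F xi)%:E = c%:E * \int[mu]_xi (p xi * P xi)%:E.
Proof.
move=> mp mF mP p0 F0 P0 c0 pN FN.
have h : \int[mu]_xi (p xi * F xi)%:E = \int[mu]_xi (p xi * F (- xi)%R)%:E.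
  rewrite -(ge0_integral_opp (f := fun xi => (p xi * F (- xi)%R)%:E)).
  - by apply: eq_integral => xi _; rewrite pN opprK.
  - by meas.
  - by move=> x; rewrite lee_fin mulr_ge0.
have h2 : 2%:E * \int[mu]_xi (p xi * F xi)%:E = 2%:E * (c%:E * \int[mu]_xi (p xi * P xi)%:E).
  transitivity (\int[mu]_xi (p xi * F xi)%:E + \int[mu]_xi (p xi * F (- xi)%R)%:E).
    by rewrite -h mule2.
  rewrite -ge0_integralD//; [|by move=> x _; rewrite lee_fin mulr_ge0|by meas|by move=> x _; rewrite lee_fin mulr_ge0|by meas].
  rewrite muleA -EFinM -ge0_integralZl; [|by []|by meas|by move=> x _; rewrite lee_fin mulr_ge0|by rewrite lee_fin mulr_ge0].
  apply: eq_integral => xi _; rewrite -EFinD -EFinM -mulrDr FN.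
  by congr EFin; ring.
move: h2 => /(congr1 (fun t => 2^-1%:E * t)).
by rewrite !muleA -!EFinM mulVf// !mul1e mul1r => ->.
Qed.

Definition csqd m y u := sqint mu (fdiff m y (rep u)) + sqint mu (fdiff m y (imp u)).

Definition wsq m y v := \int[mu]_xi (dsymb m y xi * cmod2 (v xi))%:E.

Lemma measurable_cmod2 v : cmeasurable v -> measurable_fun setT (fun x => cmod2 (v x)).
Proof. by move=> [mr mi]; apply: measurable_funD; exact: measurable_funX. Qed.

(** The real identity is applied to the differences of both parts of w, and the two spectra are
    recombined through the even part. The case m = 0 is Plancherel's identity for w itself. *)
Lemma plancherel_fdiff m y w : cLp 1 w -> cLp 2 w -> csqd m y w = wsq m y (fourierL1 w).
Proof.
move=> /cLp1P[ir ii] /cLp2P[mw Lr Li].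
have mF := measurable_cmod2 (cmeasurable_fourierL1 ir ii).
have md := @measurable_dsymb m y.
have mpr := measurable_pspec (intg_measurable ir).
have mpi := measurable_pspec (intg_measurable ii).
have p0 : (0 < (2 * pi) ^+ n :> R)%R by rewrite exprn_gt0// mulr_gt0// pi_gt0.
have f0 : (0 < fconst ^+ 2)%R by rewrite exprn_gt0// powR_gt0// mulr_gt0// pi_gt0.
have E (a : V -> R) : intg a -> L2 mu a ->
    sqint mu (fdiff m y a) = (fconst ^+ 2)%:E * \int[mu]_xi (dsymb m y xi * pspec a xi)%:E.
  move=> ai La; have := integral_pspec (intg_fdiff m y ai) (L2_fdiff m y La).
  under eq_integral do rewrite pspec_fdiff//.
  by move=> ->; rewrite muleA -EFinM fconst_sqr mul1e.
rewrite /csqd !E// -ge0_muleDr; last 2 first.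
- by apply: integral_ge0 => x _; rewrite lee_fin mulr_ge0 ?dsymb_ge0 ?pspec_ge0.
- by apply: integral_ge0 => x _; rewrite lee_fin mulr_ge0 ?dsymb_ge0 ?pspec_ge0.
rewrite -ge0_integralD//; last 4 first.
- by move=> x _; rewrite lee_fin mulr_ge0 ?dsymb_ge0 ?pspec_ge0.
- by meas.
- by move=> x _; rewrite lee_fin mulr_ge0 ?dsymb_ge0 ?pspec_ge0.
- by meas.
rewrite /wsq (@integral_even_part (dsymb m y) _ (fun xi => pspec (rep w) xi + pspec (imp w) xi)%R (fconst ^+ 2)).
- by congr (_ * _); apply: eq_integral => xi _; rewrite -EFinD -mulrDr.
- exact: md.
- exact: mF.
- exact: measurable_funD.
- exact: dsymb_ge0.
- by move=> xi; exact: cmod2_ge0.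
- by move=> xi; rewrite addr_ge0 ?pspec_ge0.
- exact: ltW.
- exact: dsymb_opp.
- by move=> xi; exact: cmod2_fourierL1.
Qed.

Lemma sqintB_bound (f h : V -> R) : L2 mu f -> L2 mu h ->
  sqint mu (fun x => f x - h x)%R <= 2%:E * sqint mu f + 2%:E * sqint mu h.
Proof. by move=> Lf Lh; rewrite -(sqintN mu h); exact: sqintD Lf (L2N Lh). Qed.

Lemma sqint_fdiff_le m y (f : V -> R) : L2 mu f -> sqint mu (fdiff m y f) <= (4 ^+ m)%:E * sqint mu f.
Proof.
move=> Lf; elim: m => [|m ih]; first by rewrite expr0 mul1e.
have LF := L2_fdiff m y Lf.
apply: le_trans (sqintB_bound (L2_shift y LF) LF) _.
rewrite sqint_shift; last exact: LF.1.
rewrite -ge0_muleDl// -EFinD exprS EFinM -muleA (_ : (2 + 2 = 4 :> R)%R); last by ring.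
exact: lee_wpmul2l.
Qed.

(** An m-th difference enlarges the squared L^2 norm by at most 4^m, so difference bounds are stable
    under approximation of u in L^2. *)
Lemma csqd_split m y u w : cLp 2 u -> cLp 2 w ->
  csqd m y u <= 2%:E * csqd m y w + 2%:E * ((4 ^+ m)%:E * csq (w - u)%R).
Proof.
move=> /cLp2P[_ Lur Lui] /cLp2P[_ Lwr Lwi].
have E (f h : V -> R) : L2 mu f -> L2 mu h -> sqint mu (fdiff m y f) <=
    2%:E * sqint mu (fdiff m y h) + 2%:E * ((4 ^+ m)%:E * sqint mu (fun x => h x - f x)%R).
  move=> Lf Lh; have LB := L2B Lh Lf.
  have -> : fdiff m y f = (fun x => fdiff m y h x - fdiff m y (fun x => h x - f x) x)%R.
    by apply/funext => x; rewrite fdiffB; ring.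
  apply: le_trans (sqintB_bound (L2_fdiff m y Lh) (L2_fdiff m y LB)) _.
  by apply: leeD => //; apply: lee_wpmul2l => //; exact: sqint_fdiff_le.
apply: le_trans (leeD (E _ _ Lur Lwr) (E _ _ Lui Lwi)) _.
rewrite /csqd /csq repB impB.
have dist (k a b c d : \bar R) : 0 <= k -> 0 <= a -> 0 <= b -> 0 <= c -> 0 <= d ->
    2%:E * a + 2%:E * (k * c) + (2%:E * b + 2%:E * (k * d)) = 2%:E * (a + b) + 2%:E * (k * (c + d)).
  move=> k0 a0 b0 c0 d0; rewrite addeACA (ge0_muleDr _ a0 b0) (ge0_muleDr _ c0 d0).
  by rewrite (ge0_muleDr _ (mule_ge0 k0 c0) (mule_ge0 k0 d0)).
by rewrite dist ?sqint_ge0// lee_fin exprn_ge0.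
Qed.

Lemma wsq_split m y v1 v2 : cmeasurable v1 -> cmeasurable v2 ->
  wsq m y v1 <= 2%:E * wsq m y v2 + 2%:E * ((4 ^+ m)%:E * csq (v1 - v2)%R).
Proof.
move=> m1 m2; have mB := cmeasurableB m1 m2.
have c1 := measurable_cmod2 m1; have c2 := measurable_cmod2 m2; have cB := measurable_cmod2 mB.
have md := @measurable_dsymb m y.
have mw v : measurable_fun setT (fun x => cmod2 (v x)) -> measurable_fun setT (fun xi => (dsymb m y xi * cmod2 (v xi))%:E).
  by move=> mv; apply/measurable_EFinP; exact: measurable_funM.
rewrite csq_cmod2// muleA -EFinM.
have i1 : 2%:E * wsq m y v2 = \int[mu]_x (2%:E * (dsymb m y x * cmod2 (v2 x))%:E).
  rewrite ge0_integralZl//; first exact: mw.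
  by move=> x _; rewrite lee_fin mulr_ge0 ?dsymb_ge0 ?cmod2_ge0.
have i2 : (2 * 4 ^+ m)%:E * \int[mu]_x (cmod2 ((v1 - v2)%R x))%:E =
    \int[mu]_x ((2 * 4 ^+ m)%:E * (cmod2 ((v1 - v2)%R x))%:E).
  rewrite ge0_integralZl//; first exact/measurable_EFinP.
  by move=> x _; rewrite lee_fin cmod2_ge0.
rewrite i1 i2 -ge0_integralD//; last 4 first.
- by move=> x _; rewrite -EFinM lee_fin mulr_ge0// mulr_ge0 ?dsymb_ge0 ?cmod2_ge0.
- by apply: measurable_funeM; exact: mw.
- by move=> x _; rewrite -EFinM lee_fin mulr_ge0 ?cmod2_ge0// mulr_ge0// exprn_ge0.
- by apply: measurable_funeM; exact/measurable_EFinP.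
apply: ge0_le_integral => //.
- by move=> x _; rewrite lee_fin mulr_ge0 ?dsymb_ge0 ?cmod2_ge0.
- exact: mw.
- apply: emeasurable_funD; apply: measurable_funeM; first exact: mw.
  exact/measurable_EFinP.
move=> x _; rewrite -!EFinM -EFinD lee_fin.
have h : (cmod2 (v1 x) <= 2 * cmod2 (v2 x) + 2 * cmod2 ((v1 - v2)%R x))%R.
  change ((v1 - v2)%R x) with (v1 x - v2 x)%R.
  case: (v1 x) => a b; case: (v2 x) => c d; rewrite /cmod2/=.
  by have := sqr_ge0 (a - 2 * c)%R; have := sqr_ge0 (b - 2 * d)%R; nra.
have d0 := dsymb_ge0 m y x; have d1 := dsymb_le m y x; have B0 := cmod2_ge0 ((v1 - v2)%R x).
apply: le_trans (ler_wpM2l d0 h) _; rewrite mulrDr mulrCA lerD2l mulrCA -mulrA.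
by apply: ler_wpM2l => //; exact: ler_wpM2r.
Qed.

Lemma wsq0 v : cmeasurable v -> wsq 0 (0 : V)%R v = csq v.
Proof. by move=> mv; rewrite csq_cmod2//; apply: eq_integral => x _; rewrite /dsymb expr0 mul1r. Qed.

(** A single approximant, within d on both sides of the transform, replaces the sequence in the
    definition; passages to the limit become arguments with an arbitrary error. *)
Lemma fourierL2_approx u v : is_fourierL2 u v -> forall d : R, (0 < d)%R ->
  exists w, [/\ cLp 1 w, cLp 2 w, csq (w - u)%R <= d%:E & csq (fourierL1 w - v)%R <= d%:E].
Proof.
move=> [Lu Lv [w [Lw wu wv]]] d d0.
have mu_ : cmeasurable u by case: Lu.
have mv : cmeasurable v by case: Lv.
have m1 k : cmeasurable (w k - u)%R by apply: cmeasurableB => //; have [_ []] := Lw k.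
have m2 k : cmeasurable (fourierL1 (w k) - v)%R.
  by apply: cmeasurableB => //; have [/cLp1P[a b] _] := Lw k; exact: cmeasurable_fourierL1.
have h1 := cLnorm_cvg0 m1 wu d0; have h2 := cLnorm_cvg0 m2 wv d0.
have [k [hk1 hk2]] := filter_ex (filterI h1 h2).
by exists (w k); split => //; have [] := Lw k.
Qed.

(* The factor 4 is lost by using |a + b| ^ 2 <= 2 |a| ^ 2 + 2 |b| ^ 2 twice when passing
   to the limit; equality is not needed. *)
Lemma csqd_le_wsq m y u v : is_fourierL2 u v -> csqd m y u <= 4%:E * wsq m y v.
Proof.
move=> uv; have [Lu Lv _] := uv.
have mv : cmeasurable v by case: Lv.
have p4 : (0 < 4 ^+ m :> R)%R by rewrite exprn_gt0.
apply/lee_addgt0Pr => e e0.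
(* The two approximations contribute 2 * 2 and 2 times 4^m d, in all 6 * 4^m d. *)
have d0 : (0 < e / (6 * 4 ^+ m))%R by rewrite divr_gt0// mulr_gt0.
have [w [w1 w2 wu wv]] := fourierL2_approx uv d0.
have mF : cmeasurable (fourierL1 w) by have [a b] := cLp1P w1; exact: cmeasurable_fourierL1.
apply: le_trans (csqd_split m y Lu w2) _; rewrite plancherel_fdiff//.
have h0 : (0 <= (4 ^+ m)%:E :> \bar R) by rewrite lee_fin ltW.
have h1 := lee_wpmul2l h0 wu; have h2 := lee_wpmul2l h0 wv.
apply: (@le_trans _ _ (2%:E * (2%:E * wsq m y v + 2%:E * ((4 ^+ m)%:E * (e / (6 * 4 ^+ m))%:E)) +
    2%:E * ((4 ^+ m)%:E * (e / (6 * 4 ^+ m))%:E))).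
  apply: leeD; last exact: lee_wpmul2l.
  apply: lee_wpmul2l => //; apply: le_trans (wsq_split m y mF mv) _.
  by apply: leeD => //; exact: lee_wpmul2l.
have W0 : 0 <= wsq m y v by apply: integral_ge0 => x _; rewrite lee_fin mulr_ge0 ?dsymb_ge0 ?cmod2_ge0.
rewrite ge0_muleDr ?mule_ge0 ?lee_fin ?(ltW d0) ?(ltW p4)// muleA -EFinM -addeA -!EFinM -EFinD.
apply: leeD; first by rewrite (_ : (2 * 2 = 4 :> R)%R)//; ring.
rewrite lee_fin le_eqVlt; apply/orP; left; apply/eqP; field.
by rewrite gt_eqF.
Qed.

(** The opposite inequality for m = 0, by the same approximation with u and v exchanged. *)
Lemma csq_fourierL2_le u v : is_fourierL2 u v -> csq v <= 4%:E * csq u.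
Proof.
move=> uv; have [Lu Lv _] := uv.
have mv : cmeasurable v by case: Lv.
apply/lee_addgt0Pr => e e0.
have d0 : (0 < e / 6)%R by rewrite divr_gt0.
have [w [w1 w2 wu wv]] := fourierL2_approx uv d0.
have mF : cmeasurable (fourierL1 w) by have [a b] := cLp1P w1; exact: cmeasurable_fourierL1.
have opp (a b : V -> R[i]) : csq (a - b)%R = csq (b - a)%R.
  rewrite /csq !repB !impB; congr (_ + _).
    by rewrite -sqintN; congr sqint; apply/funext => x; rewrite opprB.
  by rewrite -sqintN; congr sqint; apply/funext => x; rewrite opprB.
have h1 := @wsq_split 0 (0 : V)%R _ _ mv mF; rewrite !wsq0// expr0 mul1e opp in h1.
have h2 := @csqd_split 0 (0 : V)%R _ _ w2 Lu; rewrite expr0 mul1e opp in h2.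
have h3 := @plancherel_fdiff 0 (0 : V)%R _ w1 w2; rewrite wsq0// in h3.
apply: le_trans h1 _; rewrite -h3.
apply: (@le_trans _ _ (2%:E * (2%:E * csq u + 2%:E * (e / 6)%:E) + 2%:E * (e / 6)%:E)).
  apply: leeD; last exact: lee_wpmul2l.
  apply: lee_wpmul2l => //; apply: le_trans h2 _.
  by apply: leeD; [exact: lexx|exact: lee_wpmul2l].
rewrite ge0_muleDr ?mule_ge0 ?csq_ge0 ?lee_fin ?(ltW d0)// muleA -EFinM -addeA -!EFinM -EFinD.
apply: leeD; first by rewrite (_ : (2 * 2 = 4 :> R)%R)//; ring.
by rewrite lee_fin le_eqVlt; apply/orP; left; apply/eqP; field.
Qed.

(** Let T = |y| |xi|. The symbol is at most 4^m, which suffices for T > 1, and at most T^(2m), which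
    is at most T^(2s) for T <= 1 because s <= m. *)
Lemma dsymb_powR m (s : R) y xi : (0 < s)%R -> (s <= m%:R)%R ->
  (dsymb m y xi <= 4 ^+ m * (enorm y `^ (2 * s) * enorm xi `^ (2 * s)))%R.
Proof.
move=> s0 sm; have p4 : (0 < 4 ^+ m :> R)%R by rewrite exprn_gt0.
rewrite -powRM ?enorm_ge0//.
set T := (enorm y * enorm xi)%R.
have T0 : (0 <= T)%R by rewrite mulr_ge0 ?enorm_ge0.
have tT : (dotRn y xi ^+ 2 <= T ^+ 2)%R.
  by rewrite -(real_normK (num_real (dotRn y xi))) lerXn2r ?nnegrE ?dotRn_le_enorm.
have [T1|T1] := leP T 1%R; last first.
  apply: le_trans (dsymb_le m y xi) _; rewrite ler_peMr ?(ltW p4)//.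
  have s2 : (0 <= 2 * s)%R by rewrite mulr_ge0// ltW.
  by have := ler_powR (ltW T1) s2; rewrite powRr0.
have h : (dsymb m y xi <= (T ^+ 2) ^+ m)%R.
  have h1 := cos_le1 (dotRn y xi); have h2 := cos_diff_le (dotRn y xi).
  rewrite /dsymb; apply: lerXn2r; last exact: le_trans tT.
    by rewrite nnegrE; lra.
  by rewrite nnegrE sqr_ge0.
apply: le_trans h _; rewrite -exprM.
have [TE|TE] := eqVneq T 0%R.
  have m0 : (0 < m)%N by rewrite -(ltr_nat R); exact: lt_le_trans sm.
  have s2 : (2 * s != 0)%R by rewrite mulf_neq0// gt_eqF.
  by rewrite TE (powR0 s2) mulr0 expr0n muln_eq0/= -leqn0 leqNgt m0.
have Tp : (0 < T)%R by rewrite lt_neqAle eq_sym TE.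
rewrite -powR_mulrn// natrM; apply: le_trans (_ : _ <= T `^ (2 * s))%R _.
  by apply: ger_powR; [rewrite Tp|rewrite ler_pM2l].
by rewrite ler_peMl ?powR_ge0// exprn_ege1// ler1n.
Qed.

Section fractional_laplacian.
Variables (s : R) (u g : V -> R[i]).
Hypotheses (s_gt0 : (0 < s)%R) (ug : is_fracLap s u g).

Lemma weighted_spectrum : exists v, [/\ is_fourierL2 u v, cmeasurable v &
  \int[mu]_xi (enorm xi `^ (2 * s) * cmod2 (v xi))%:E <= 4%:E * csq g].
Proof.
have [v [uv gv]] := ug; have [_ Lv _] := uv; have mv : cmeasurable v by case: Lv.
exists v; split => //; apply: le_trans (csq_fourierL2_le gv).
have [_ [mgv _] _] := gv.
rewrite csq_cmod2// le_eqVlt; apply/orP; left; apply/eqP; apply: eq_integral => xi _; congr EFin.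
case: (v xi) => a b; rewrite /cmod2 /= !mul0r subr0 addr0 !exprMn -mulrDr; congr (_ * _)%R.
by rewrite -[RHS]powR_mulrn ?powR_ge0// -powRrM mulrC.
Qed.

(** Of the factor 4^(m+2), the symbol contributes 4^m and each of the two passages between a
    function and its transform contributes 4. *)
Lemma fdiff_fracLap m y : (s <= m%:R)%R ->
  csqd m y u <= (4 ^+ m.+2 * enorm y `^ (2 * s))%:E * csq g.
Proof.
move=> sm; have [v [uv mv hv]] := weighted_spectrum.
have mc := measurable_cmod2 mv; have md := @measurable_dsymb m y.
have p4 : (0 <= 4 ^+ m :> R)%R by rewrite exprn_ge0.
have q0 : (0 <= 4 ^+ m * enorm y `^ (2 * s))%R by rewrite mulr_ge0 ?powR_ge0.
have mW : measurable_fun setT (fun xi : V => (enorm xi `^ (2 * s) * cmod2 (v xi))%:E).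
  by apply/measurable_EFinP; apply: measurable_funM => //; meas.
apply: le_trans (csqd_le_wsq m y uv) _.
rewrite !exprS -!mulrA EFinM -muleA; apply: lee_wpmul2l => //.
apply: (@le_trans _ _ ((4 ^+ m * enorm y `^ (2 * s))%:E *
    \int[mu]_xi (enorm xi `^ (2 * s) * cmod2 (v xi))%:E)); last first.
  rewrite (_ : (4 * (4 ^+ m * enorm y `^ (2 * s)))%R = (4 ^+ m * enorm y `^ (2 * s) * 4)%R); last by ring.
  by rewrite (EFinM _ 4) -muleA; apply: lee_wpmul2l.
rewrite -ge0_integralZl; [|by []|by []|by move=> x _; rewrite lee_fin mulr_ge0 ?powR_ge0 ?cmod2_ge0|by rewrite lee_fin].
apply: ge0_le_integral => //.
- by move=> x _; rewrite lee_fin mulr_ge0 ?dsymb_ge0 ?cmod2_ge0.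
- by apply/measurable_EFinP; exact: measurable_funM.
- exact: measurable_funeM.
- move=> x _; rewrite -EFinM lee_fin mulrA ler_wpM2r ?cmod2_ge0// -mulrA.
  exact: dsymb_powR.
Qed.

(** Here |xi|^(2 sg) <= 1 + |xi|^(2s): low frequencies are controlled by u and high ones by g. The
    constant is 64 = 4 * 4 * 4, from the symbol and the two passages to the transform. *)
Lemma fdiff1_fracLap (sg : R) y : (0 < sg)%R -> (sg <= 1)%R -> (sg <= s)%R ->
  csqd 1 y u <= (64 * enorm y `^ (2 * sg))%:E * (csq u + csq g).
Proof.
move=> sg0 sg1 sgs; have [v [uv mv hv]] := weighted_spectrum.
have mc := measurable_cmod2 mv; have md := @measurable_dsymb 1 y.
have q0 : (0 <= 4 * enorm y `^ (2 * sg))%R by rewrite mulr_ge0 ?powR_ge0.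
have mW (t : R) : measurable_fun setT (fun xi : V => (enorm xi `^ (2 * t) * cmod2 (v xi))%:E).
  by apply/measurable_EFinP; apply: measurable_funM => //; meas.
have hvu := csq_fourierL2_le uv; rewrite csq_cmod2// in hvu.
apply: le_trans (csqd_le_wsq 1 y uv) _.
apply: (@le_trans _ _ (4%:E * ((4 * enorm y `^ (2 * sg))%:E * (4%:E * (csq u + csq g))))); last first.
  rewrite !muleA -!EFinM (_ : (4 * (4 * enorm y `^ (2 * sg)) * 4)%R = (64 * enorm y `^ (2 * sg))%R)//.
  by ring.
apply: lee_wpmul2l => //.
apply: (@le_trans _ _ ((4 * enorm y `^ (2 * sg))%:E *
    (\int[mu]_xi ((cmod2 (v xi))%:E + (enorm xi `^ (2 * s) * cmod2 (v xi))%:E)))); last first.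
  apply: lee_wpmul2l; first by rewrite lee_fin.
  rewrite ge0_integralD//; last 3 first.
  - by move=> x _; rewrite lee_fin cmod2_ge0.
  - exact/measurable_EFinP.
  - by move=> x _; rewrite lee_fin mulr_ge0 ?powR_ge0 ?cmod2_ge0.
  by rewrite ge0_muleDr ?csq_ge0//; apply: leeD.
rewrite -ge0_integralZl; [|by []| |by move=> x _; rewrite -EFinD lee_fin addr_ge0 ?mulr_ge0 ?powR_ge0 ?cmod2_ge0|by rewrite lee_fin]; last first.
  by apply: emeasurable_funD => //; exact/measurable_EFinP.
apply: ge0_le_integral => //.
- by move=> x _; rewrite lee_fin mulr_ge0 ?dsymb_ge0 ?cmod2_ge0.
- by apply/measurable_EFinP; exact: measurable_funM.
- by apply: measurable_funeM; apply: emeasurable_funD => //; exact/measurable_EFinP.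
move=> x _; rewrite -EFinD -EFinM lee_fin.
apply: le_trans (ler_wpM2r (cmod2_ge0 _) (@dsymb_powR 1 sg y x sg0 sg1)) _.
rewrite expr1 mulrA -[leLHS]mulrA ler_wpM2l// -[X in (_ <= X + _)%R]mul1r -mulrDl ler_wpM2r ?cmod2_ge0//.
have [x1|x1] := leP (enorm x) 1%R.
  apply: (@le_trans _ _ 1%R); last by rewrite lerDl powR_ge0.
  apply: (@le_trans _ _ (1 `^ (2 * sg))%R); last by rewrite powR1.
  by apply: ge0_ler_powR; rewrite ?nnegrE ?enorm_ge0// mulr_ge0// ltW.
apply: (@le_trans _ _ (enorm x `^ (2 * s))%R); last by rewrite lerDr.
by apply: ler_powR; [exact: ltW|rewrite ler_pM2l].
Qed.

End fractional_laplacian.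
End complex_plancherel.

Local Notation normc := (@ComplexField.Normc.normc _).

(** The index phi j is taken in D 0, ..., D j at once and beyond its predecessor. Hence D j contains
    both phi j and phi (j + 1), which bounds consecutive terms of the subsequence. *)
Lemma ultra_subsequence (U : set_system nat) (D : nat -> set nat) :
  ProperFilter U -> \oo `<=` U -> (forall j, U (D j)) ->
  exists phi : nat -> nat,
    {homo phi : i j / (i < j)%N} /\ forall j, D j (phi j) /\ D j (phi j.+1).
Proof.
move=> UF ooU UD.
have UI j : U (fun k => forall i, (i <= j)%N -> D i k).
  elim: j => [|j IHj].
    by apply: (filterS _ (UD 0%N)) => k Dk i; rewrite leqn0 => /eqP->.
  apply: (filterS2 _ _ IHj (UD j.+1)) => k h Dk i.
  by rewrite leq_eqVlt => /orP[/eqP->//|]; rewrite ltnS; exact: h.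
have ex (p : nat * nat) : exists k, (p.2 < k)%N /\ forall i, (i <= p.1)%N -> D i k.
  have UN : U (fun k => (p.2 < k)%N) by apply: ooU; exact: nbhs_infty_gt.
  exact: filter_ex (filterI UN (UI p.1)).
have [pick hpick] := choice ex.
pose phi := fix phi j := pick (j, if j is j'.+1 then phi j' else 0%N).
have phiS j : (phi j < phi j.+1)%N by have [] := hpick (j.+1, phi j).
have phiD j i : (i <= j)%N -> D i (phi j).
  by case: j => [|j]; [have [_] := hpick (0, 0)%N|have [_] := hpick (j.+1, phi j)]; apply.
exists phi; split; first exact: homo_ltn ltn_trans phiS.
by move=> j; split; apply: phiD.
Qed.

(** * The imbedding *)

Section radial_functions.
Context {R : realType} {n : nat}.
Local Notation V := (Rn R n).
Local Notation mu := (lebesgue_Rn n : {sigma_finite_measure set V -> \bar R}).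

Lemma ae_reflect (a : V) (P : V -> Prop) :
  {ae mu, forall x, P x} -> {ae mu, forall x, P (reflectRn a x)}.
Proof.
move=> [N [mN N0 PN]]; exists [set x | N (reflectRn a x)].
set A := [set x | _].
have mA : measurable A by rewrite -[A]setTI; exact: measurable_reflectRn.
split => //; last by move=> x /= Px; exact: PN.
have m1 : measurable_fun setT (fun y : V => (\1_N y)%:E : \bar R).
  by apply/measurable_EFinP; exact: measurable_indic.
have := integral_indic mu measurableT mA; rewrite setIT => <-.
have n1 (y : V) : (0 <= (\1_N y : R)%:E)%E by rewrite lee_fin.
have E := ge0_integral_reflect a m1 n1.
have IN : (\int[mu]_x (\1_N x)%:E = 0)%E by rewrite integral_indic// setIT; exact: N0.
by rewrite -IN -E; apply: eq_integral => y _; rewrite !indicE.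
Qed.

Lemma radial_reflect (u : V -> R[i]) : radial u ->
  reflect_invariant (rep u) /\ reflect_invariant (imp u).
Proof.
move=> [f uf]; have h a : {ae mu, forall x, u (reflectRn a x) = u x}.
  by apply: filterS2 (ae_reflect a uf) uf => x -> ->; rewrite enorm_reflectRn.
by split => a; apply: filterS (h a) => x; rewrite /rep /imp => ->.
Qed.

End radial_functions.

Section sobolev.
Context {R : realType} {n : nat}.
Local Notation V := (Rn R n).
Local Notation mu := (lebesgue_Rn n : {sigma_finite_measure set V -> \bar R}).
Implicit Types (u v w : V -> R[i]) (s M K : R).
Local Open Scope ereal_scope.

(** On H^s the set from which [xget] chooses is nonempty, so the chosen function is an admissible
    fractional Laplacian. *)
Lemma is_fracLap_fracLap s u : Hs s u -> is_fracLap s u (fracLap s u).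
Proof. by move=> [_ [g _ ug]]; apply: xgetPex; exists g. Qed.

Lemma cLp_fracLap s u : Hs s u -> cLp 2 (fracLap s u).
Proof. by move=> /is_fracLap_fracLap[v [_ []]]. Qed.

Lemma cLp2_csq u : cLp 2 u -> exists2 A : R, (0 <= A)%R & cLnorm 2 u = A%:E /\ csq u <= (A ^+ 2)%:E.
Proof.
move=> [mu_ uoo].
have N0 : 0 <= cLnorm 2 u by exact: Lnorm_ge0.
have fN : cLnorm 2 u \is a fin_num by rewrite ge0_fin_numE.
exists (fine (cLnorm 2 u)); first exact: fine_ge0.
rewrite fineK//; split => //.
by rewrite -(cLnorm_le mu_ (fine_ge0 N0)) fineK.
Qed.

Lemma Hs_norm_csq s u M : Hs s u -> Hs_norm s u <= M%:E ->
  csq u <= (M ^+ 2)%:E /\ csq (fracLap s u) <= (M ^+ 2)%:E.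
Proof.
move=> Hu; have [A A0 [NA cA]] := cLp2_csq Hu.1.
have [B B0 [NB cB]] := cLp2_csq (cLp_fracLap Hu).
rewrite /Hs_norm NA NB !poweR_EFin lee_fin => hM.
rewrite !powR_mulrn// in hM.
have S0 : (0 <= A ^+ 2 + B ^+ 2)%R by rewrite addr_ge0 ?sqr_ge0.
have hS : (A ^+ 2 + B ^+ 2 <= M ^+ 2)%R.
  have M0 : (0 <= M)%R by apply: le_trans hM; exact: powR_ge0.
  rewrite -[leLHS](sqr_sqrtr S0) -powR12_sqrt//; apply: lerXn2r => //.
  by rewrite nnegrE powR_ge0.
split; [apply: le_trans cA _|apply: le_trans cB _]; rewrite lee_fin; apply: le_trans hS.
  by rewrite lerDl sqr_ge0.
by rewrite lerDr sqr_ge0.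
Qed.

(** The constant covers every requirement: 4^(m+2) for differences of order m, and 128 = 64 * 2 for
    first differences, bounded through both u and its fractional Laplacian. *)
Lemma rep_imp_Hclass s u m (M : R) : (0 < s)%R -> (s <= m%:R)%R -> Hs_rad s u ->
    csq u <= M%:E -> csq (fracLap s u) <= M%:E ->
  let K := ((4 ^+ m.+2 + 128) * M)%R in let sg := Order.min s 1%R in
  (Hclass m s K (rep u) /\ equi sg K (rep u)) /\ (Hclass m s K (imp u) /\ equi sg K (imp u)).
Proof.
move=> s0 sm [Hu urad] uM gM K sg.
have M0 : (0 <= M)%R by rewrite -lee_fin; exact: le_trans (csq_ge0 u) uM.
have p4 : (0 <= 4 ^+ m.+2 :> R)%R by rewrite exprn_ge0.
have [_ Lr Li] := cLp2P Hu.1; have [ir ii] := radial_reflect urad.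
have ug := is_fracLap_fracLap Hu.
have MK : (M <= K)%R by rewrite /K ler_peMl//; lra.
have hu : csq u <= K%:E by apply: le_trans uM _; rewrite lee_fin.
have hm y : csqd m y u <= (K * enorm y `^ (2 * s))%:E.
  apply: le_trans (fdiff_fracLap s0 ug y sm) _.
  apply: le_trans (lee_wpmul2l _ gM) _; first by rewrite lee_fin mulr_ge0 ?powR_ge0.
  rewrite -EFinM lee_fin mulrAC ler_wpM2r ?powR_ge0// ler_wpM2r// lerDl//.
have hs y : csqd 1 y u <= (K * enorm y `^ (2 * sg))%:E.
  have sg0 : (0 < sg)%R by rewrite lt_min s0 ltr01.
  have sg1 : (sg <= 1)%R by rewrite ge_min lexx orbT.
  have sgs : (sg <= s)%R by rewrite ge_min lexx.
  have hd := fdiff1_fracLap ug y sg0 sg1 sgs.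
  apply: le_trans hd _.
  apply: le_trans (lee_wpmul2l _ (leeD uM gM)) _; first by rewrite lee_fin mulr_ge0 ?powR_ge0.
  rewrite -EFinD -EFinM lee_fin mulrAC ler_wpM2r ?powR_ge0// /K.
  rewrite (_ : 64 * (M + M) = 128 * M)%R; last by ring.
  by rewrite ler_wpM2r// lerDr.
have part1 (X Y B : \bar R) : 0 <= Y -> X + Y <= B -> X <= B.
  by move=> Y0; apply: le_trans; rewrite leeDl.
have part2 (X Y B : \bar R) : 0 <= X -> X + Y <= B -> Y <= B.
  by move=> X0; apply: le_trans; rewrite leeDr.
split; split.
- split => //; first exact: part1 (sqint_ge0 _ _) hu.
  by move=> y; exact: part1 (sqint_ge0 _ _) (hm y).
- by move=> y; exact: part1 (sqint_ge0 _ _) (hs y).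
- split => //; first exact: part2 (sqint_ge0 _ _) hu.
  by move=> y; exact: part2 (sqint_ge0 _ _) (hm y).
- by move=> y; exact: part2 (sqint_ge0 _ _) (hs y).
Qed.

Lemma normc_le (z : R[i]) : (normc z <= `|complex.Re z| + `|complex.Im z|)%R.
Proof.
rewrite -(ler_pXn2r (n := 2))// ?nnegrE ?normc_ge0 ?addr_ge0// normc_sqr /cmod2.
rewrite -(real_normK (num_real (complex.Re z))) -(real_normK (num_real (complex.Im z))).
have := normr_ge0 (complex.Re z); have := normr_ge0 (complex.Im z).
by move: (`|_|)%R (`|_|)%R => a b a0 b0; rewrite sqrrD; nra.
Qed.

Lemma measurable_normc u : cmeasurable u -> measurable_fun setT (fun x => normc (u x)).
Proof.
move=> mu_; rewrite (_ : (fun x => _) = (fun x => Num.sqrt (cmod2 (u x)))).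
  apply: (@measurableT_comp _ _ _ _ _ _ (@Num.sqrt R)).
    by apply: continuous_measurable_fun; exact: sqrt_continuous.
  exact: measurable_cmod2.
by apply/funext => x; rewrite -normc_sqr sqrtr_sqr ger0_norm ?normc_ge0.
Qed.

(** |z| <= |Re z| + |Im z| and Minkowski's inequality; this is the return from real to complex
    functions. *)
Lemma weighted_norm_le (q c : R) u (A B : R) : (2 < q)%R -> cmeasurable u ->
    (0 <= A)%R -> (0 <= B)%R ->
  wnorm q c (rep u) <= A%:E -> wnorm q c (imp u) <= B%:E ->
  weighted_norm q c u <= (A + B)%:E.
Proof.
move=> q2 mu_ A0 B0 rA iB; have [mr mi] := mu_.
have q0 : (0 < q)%R by exact: lt_trans q2.
have wabs (f : V -> R) M : (0 <= M)%R -> wnorm q c f <= M%:E -> wnorm q c (fun x => `|f x|)%R <= M%:E.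
  move=> M0; rewrite !(wnorm_le _ q2 _ M0); apply: le_trans; rewrite le_eqVlt; apply/orP; left; apply/eqP.
  by apply: eq_integral => x _; rewrite normr_id.
have mar : measurable_fun setT (fun x => `|rep u x|)%R by exact: measurableT_comp.
have mai : measurable_fun setT (fun x => `|imp u x|)%R by exact: measurableT_comp.
have h : wnorm q c (fun x => `|rep u x| + `|imp u x|)%R <= (A + B)%:E.
  rewrite EFinD; apply: le_trans (@wnormD R n q c q2 _ _ mar mai) _; apply: leeD; exact: wabs.
have AB0 : (0 <= A + B)%R by exact: addr_ge0.
rewrite (wnorm_le _ q2 _ AB0) in h.
rewrite /weighted_norm.
have -> : (A + B)%:E = ((A + B) `^ q)%:E `^ q^-1.
  by rewrite poweR_EFin -powRrM mulfV ?gt_eqF// powRr1.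
have int0 : 0 <= \int[mu]_x (normc (u x) `^ q * enorm x `^ c)%:E.
  by apply: integral_ge0 => x _; rewrite lee_fin mulr_ge0 ?powR_ge0.
have i0 (x : \bar R) : 0 <= x -> x \in `[0, +oo] by move=> x0; rewrite in_itv/= x0 leey.
have Pq0 : 0 <= ((A + B) `^ q)%:E by rewrite lee_fin powR_ge0.
have qV0 : (0 <= q^-1)%R by rewrite invr_ge0 ltW.
apply: (gt0_ler_poweR qV0 (i0 _ int0) (i0 _ Pq0)).
apply: le_trans h; rewrite /wint.
have mn := measurable_normc mu_.
apply: ge0_le_integral => //.
- by move=> x _; rewrite lee_fin mulr_ge0 ?powR_ge0.
- by apply/measurable_EFinP; meas.
- by apply/measurable_EFinP; meas.
- move=> x _; rewrite lee_fin ler_wpM2r ?powR_ge0//.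
  apply: ge0_ler_powR; rewrite ?nnegrE ?normc_ge0 ?(ltW q0)//.
  by rewrite ger0_norm ?addr_ge0//; exact: normc_le.
Qed.

(* Dividing the limit by the weight is harmless where the weight vanishes (only at the
   origin): there 0^-1 = 0, and all the weighted functions vanish as well. *)
Lemma wnorm_complete (q c : R) (f : nat -> V -> R) : (2 < q)%R ->
  (forall k, measurable_fun setT (f k)) ->
  (forall k, wnorm q c (fun x => f k.+1 x - f k x)%R <= (2^-1 ^+ k)%:E) ->
  exists2 g : V -> R, measurable_fun setT g &
    forall k, wnorm q c (fun x => f k x - g x)%R <= (2 * 2^-1 ^+ k)%:E.
Proof.
move=> q2 mf fc; have q1 : (1 <= q)%R by lra.
have q0 : (0 < q)%R by lra.
have mF k := @measurable_wmul R n q c _ (mf k).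
have Fc k : 'N[mu]_q%:E[EFin \o (fun x => wmul q c (f k.+1) x - wmul q c (f k) x)%R] <= (2^-1 ^+ k)%:E.
  by rewrite -wmulB; exact: fc.
have [G mG hG] := Lq_complete q1 mF Fc.
exists (fun x => G x * enorm x `^ (- (c / q)))%R; first by meas.
move=> k; apply: le_trans (hG k).
have h0 : (0 <= 2 * 2^-1 ^+ k :> R)%R by rewrite mulr_ge0// exprn_ge0// invr_ge0.
have := hG k; have N0 : 0 <= 'N[mu]_q%:E[EFin \o (fun x => wmul q c (f k) x - G x)%R] by exact: Lnorm_ge0.
move=> hk; have fN : 'N[mu]_q%:E[EFin \o (fun x => wmul q c (f k) x - G x)%R] \is a fin_num.
  by rewrite ge0_fin_numE//; exact: le_lt_trans hk (ltry _).
rewrite -(fineK fN) /wnorm (Lnorm_lePr _ q1 _ (fine_ge0 N0)).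
have : 'N[mu]_q%:E[EFin \o (fun x => wmul q c (f k) x - G x)%R] <= (fine 'N[mu]_q%:E[EFin \o (fun x => wmul q c (f k) x - G x)%R])%:E.
  by rewrite fineK.
rewrite (Lnorm_lePr _ q1 _ (fine_ge0 N0)); apply: le_trans.
have mk := mF k; have mfk := mf k.
apply: ge0_le_integral => //.
- by apply/measurable_EFinP; rewrite /wmul; meas.
- by apply/measurable_EFinP; meas.
move=> x _; rewrite lee_fin; apply: ge0_ler_powR; rewrite ?nnegrE ?(ltW q0)//.
rewrite /wmul powRN; set W := (enorm x `^ (c / q))%R.
have [->|W0] := eqVneq W 0%R; first by rewrite mulr0 normr0.
by rewrite mulrBl mulfVK.
Qed.

End sobolev.

(** * Continuity and compactness of the imbedding *)

Section embedding_of_Hs_rad.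
Context {R : realType} {n : nat}.
Local Notation V := (Rn R n).
Variables (s q c : R).
Hypotheses (n_gt0 : (0 < n)%N) (s_gt0 : 0 < s) (s_lt : s < n%:R / 2).
Hypotheses (q_gt2 : 2 < q) (q_lt : q < critical_exponent n s c).
Hypotheses (c_gt : - (2 * s) < c) (c_lt : c < (n%:R - 1) * (q - 2) / 2).
Implicit Types u v w : V -> R[i].

Let c_gtN : - n%:R < c.
Proof.
move: s_lt c_gt; rewrite ltr_pdivlMr//; move: (n%:R : R) => N.
by move=> h1 h2; lra.
Qed.

Let gap_gt0 : 0 < @gap R n s q c.
Proof.
have d0 : 0 < n%:R - 2 * s by rewrite subr_gt0 mulrC -ltr_pdivlMr.
move: q_lt; rewrite /critical_exponent ltr_pdivlMr// /gap.
by move: (n%:R : R) => N h; lra.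
Qed.

(** The order of the differences: an integer at least s. *)
Let m := Num.bound s.

Let s_le_m : s <= m%:R.
Proof. by apply/ltW/archi_boundP/ltW. Qed.

Local Open Scope ereal_scope.

Lemma Hs_rad_sub_weighted_Lq u : Hs_rad s u -> weighted_Lq q c u.
Proof.
move=> Hu; have [[Lu _] _] := Hu.
have [A A0 [_ uA]] := cLp2_csq Lu; have [B B0 [_ gB]] := cLp2_csq (cLp_fracLap Hu.1).
pose M := (A ^+ 2 + B ^+ 2)%R.
have uM : csq u <= M%:E by apply: le_trans uA _; rewrite lee_fin lerDl sqr_ge0.
have gM : csq (fracLap s u) <= M%:E by apply: le_trans gB _; rewrite lee_fin lerDr sqr_ge0.
have [[hr _] [hi _]] := rep_imp_Hclass s_gt0 s_le_m Hu uM gM.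
have [C C0 hC] := wnorm_Hclass m n_gt0 s_gt0 q_gt2 c_gtN c_lt gap_gt0.
split; first exact: Lu.1.
have := weighted_norm_le q_gt2 Lu.1 _ _ (hC _ _ hr) (hC _ _ hi).
by move=> /(_ _ _)/le_lt_trans; apply; rewrite ?mulr_ge0 ?powR_ge0// ltry.
Qed.

Lemma Hs_rad_compact (u : nat -> V -> R[i]) (M : R) :
    (forall k, Hs_rad s (u k)) -> (forall k, Hs_norm s (u k) <= M%:E) ->
  exists (phi : nat -> nat) (w : V -> R[i]),
    [/\ {homo phi : i j / (i < j)%N}, weighted_Lq q c w &
        weighted_norm q c (u (phi k) - w)%R @[k --> \oo] --> 0].
Proof.
move=> Hu uM; pose sg := Order.min s 1%R; pose K := ((4 ^+ m.+2 + 128) * M ^+ 2)%R.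
have sg0 : (0 < sg)%R by rewrite lt_min s_gt0 ltr01.
have hK k : (Hclass m s K (rep (u k)) /\ equi sg K (rep (u k))) /\
    (Hclass m s K (imp (u k)) /\ equi sg K (imp (u k))).
  have [uk gk] := Hs_norm_csq (Hu k).1 (uM k).
  exact: rep_imp_Hclass s_gt0 s_le_m (Hu k) uk gk.
(* One ultrafilter, finer than the filter of neighbourhoods of infinity, serves the real and
   imaginary parts and all tolerances 2^-j. *)
have [U [UU ooU]] := ultraFilterLemma (_ : ProperFilter (\oo : set_system nat)).
have UF : ProperFilter U by exact: ultra_proper.
have e0 j : (0 < (2^-1 : R) ^+ j)%R by rewrite exprn_gt0// invr_gt0.
have pc (f : (V -> R[i]) -> V -> R) : (forall k, Hclass m s K (f (u k)) /\ equi sg K (f (u k))) ->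
    forall j, exists E, U E /\ forall k l, E k -> E l ->
      wnorm q c (fun x => f (u k) x - f (u l) x)%R <= (2^-1 ^+ j)%:E.
  move=> hf j.
  have [E UE hE] := Hclass_precompact n_gt0 s_gt0 q_gt2 sg0 c_gtN c_lt gap_gt0 UU
    (fun k => (hf k).1) (fun k => (hf k).2) (e0 j).
  by exists E.
have [E hE] := choice (pc _ (fun k => (hK k).1)).
have [F hF] := choice (pc _ (fun k => (hK k).2)).
have UEF j : U (E j `&` F j) by apply: filterI; [exact: (hE j).1|exact: (hF j).1].
have [phi [phi_mono hphi]] := ultra_subsequence UF ooU UEF.
have mu_ k : cmeasurable (u k) by have [[[]]] := Hu k.
have [gr mgr hgr] := @wnorm_complete R n q c (fun k => rep (u (phi k))) q_gt2
  (fun k => (mu_ (phi k)).1)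
  (fun k => (hE k).2 _ _ (hphi k).2.1 (hphi k).1.1).
have [gi mgi hgi] := @wnorm_complete R n q c (fun k => imp (u (phi k))) q_gt2
  (fun k => (mu_ (phi k)).2)
  (fun k => (hF k).2 _ _ (hphi k).2.2 (hphi k).1.2).
pose w x := Complex (gr x) (gi x).
have mw : cmeasurable w by split.
have d0 k : (0 <= 2 * 2^-1 ^+ k :> R)%R by rewrite mulr_ge0// ltW.
have hw k : weighted_norm q c (u (phi k) - w)%R <= (2 * 2^-1 ^+ k + 2 * 2^-1 ^+ k)%:E.
  apply: weighted_norm_le => //; first exact: cmeasurableB.
    by rewrite repB; exact: hgr.
  by rewrite impB; exact: hgi.
exists phi, w; split => //; last first.
  apply: cvge0P => [k|e e_gt0]; first exact: poweR_ge0.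
  have h1 : (`|2^-1 : R| < 1)%R by rewrite ger0_norm ?invr_ge0// invf_lt1// ltr1n.
  have /cvgrPdist_le/(_ e e_gt0) := @cvg_geometric R 4%R _ h1.
  apply: filterS => k; rewrite sub0r normrN /geometric/= => hk.
  apply: le_trans (hw k) _; rewrite lee_fin; apply: le_trans (ler_norm _) _.
  by apply: le_trans hk; rewrite (_ : 4 * 2^-1 ^+ k = 2 * 2^-1 ^+ k + 2 * 2^-1 ^+ k)%R//; ring.
(* The limit lies in the weighted space: by the imbedding u (phi 0) does, and each component of the
   limit is within 2 of it. *)
have [C C0 hC] := wnorm_Hclass m n_gt0 s_gt0 q_gt2 c_gtN c_lt gap_gt0.
have part (f g : V -> R) : measurable_fun setT f -> measurable_fun setT g -> Hclass m s K f ->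
    wnorm q c (fun x => f x - g x)%R <= (2 * 2^-1 ^+ 0)%:E ->
    wnorm q c g <= (C * K `^ 2^-1 + 2 * 2^-1 ^+ 0)%:E.
  move=> mf mg Hf fg.
  have -> : g = (fun x => f x - (f x - g x))%R by apply/funext => x; rewrite subKr.
  rewrite EFinD; apply: le_trans (@wnormB R n q c q_gt2 _ _ mf (measurable_funB mf mg)) _.
  by apply: leeD => //; exact: hC.
have [mr mi] := mu_ (phi 0%N).
have rG := part _ _ mr mgr (hK _).1.1 (hgr 0%N).
have iG := part _ _ mi mgi (hK _).2.1 (hgi 0%N).
have B0 : (0 <= C * K `^ 2^-1 + 2 * 2^-1 ^+ 0)%R by rewrite addr_ge0// mulr_ge0// powR_ge0.
split=> //; apply: le_lt_trans (weighted_norm_le q_gt2 mw B0 B0 rG iG) _.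
exact: ltry.
Qed.

End embedding_of_Hs_rad.

Theorem theorem5p1 (R : realType) (n : nat) (s c q : R)
    (n_ge1 : (1 <= n)%N) (s_gt0 : 0 < s) (s_lt : s < n%:R / 2)
    (q_gt2 : 2 < q) (q_lt : q < critical_exponent n s c)
    (c_gt : - (2 * s) < c) (c_lt : c < (n%:R - 1) * (q - 2) / 2) :
  @Hs_rad R n s `<=` weighted_Lq q c /\
  compact_linear_operator (Hs_rad s) (Hs_norm s)
    (weighted_Lq q c) (weighted_norm q c)
    (fun u : Rn R n -> R[i] => u).
Proof.
split; first by move=> u; exact: Hs_rad_sub_weighted_Lq.
split=> [//|u|u Hu [M uM]]; first exact: Hs_rad_sub_weighted_Lq.
exact: Hs_rad_compact Hu uM.
Qed.
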